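(* Let $\Phi$ be a constant Cayley form on $\mathbb{R}^8$, with associated flat metric $\eta_{ab}$. Parametrise perturbations $\phi\in\Lambda^4_{1+7+35}$ of $\Phi$ (tangent vectors to the orbit of Cayley forms) as $$\phi_{abcd}=-4\left(h_{[a}{}^{p}+\tfrac14\xi_{[a}{}^{p}\right)\Phi_{bcd]p},$$ with $h_{ab}$ a symmetric tensor field and $\xi_{ab}$ a field valued in $\Lambda^2_7$; put $h=\eta^{ab}h_{ab}$. Modulo total derivatives, the most general $\mathrm{Spin}(7)$-invariant Lagrangian that is quadratic in the perturbation and contains exactly two derivatives is $$\mathcal{L}=\frac{\rho}{2}(\partial_ah_{bc})^2+\frac{\alpha}{2}(\partial_ah)^2-\beta\,h\,\partial^a\partial^bh_{ab}-\gamma(\partial^ah_{ab})^2+\frac{\lambda}{2}(\partial_a\xi_{bc})^2-\mu\,\partial_bh^{ba}\,\partial^c\xi_{ca},$$ with real constants $\rho,\alpha,\beta,\gamma,\lambda,\mu$. It is invariant, modulo total derivatives, under the linearised diffeomorphisms $$\delta h_{ab}=\partial_{(a}\zeta_{b)},\qquad \delta\xi_{ab}=\partial_{[a}\zeta_{b]}-\frac12\Phi_{ab}{}^{pq}\partial_p\zeta_q$$ (for all vector fields $\zeta$) if and only if $$\alpha=-\rho+\mu,\quad\beta=\rho-\mu,\quad\gamma=\rho-\frac{\mu}{2},\quad\lambda=\frac{\mu}{8}.$$ Thus the diffeomorphism-invariant Lagrangians form the two-parameter family $\mathcal{L}=\rho\,\mathcal{L}_{GR}+\mu\,\mathcal{L}'$,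 where $$\mathcal{L}_{GR}=\frac12(\partial_ah_{bc})^2-\frac12(\partial_ah)^2-h\,\partial^a\partial^bh_{ab}-(\partial^ah_{ab})^2,$$ $$\mathcal{L}'=\frac12(\partial_ah)^2+h\,\partial^a\partial^bh_{ab}+\frac12(\partial^ah_{ab})^2+\frac1{16}(\partial_c\xi_{ab})^2-\partial_bh^{ba}\,\partial^c\xi_{ca}.$$
   Context: A Cayley form is a 4-form $\Phi$ on an 8-dimensional space which lies in a fixed $\mathrm{GL}(8,\mathbb{R})$-orbit of 4-forms with stabiliser $\mathrm{Spin}(7)$; it determines a Euclidean metric (here $\eta$, flat and constant, used to raise and contract indices) and an orientation. The conventions are fixed by $$\Phi_{ijkp}\Phi_{abc}{}^{p}= \eta_{ia}\eta_{jb}\eta_{kc}+\eta_{ib}\eta_{jc}\eta_{ka}+\eta_{ic}\eta_{ja}\eta_{kb}-\eta_{ia}\eta_{jc}\eta_{kb}-\eta_{ic}\eta_{jb}\eta_{ka}-\eta_{ib}\eta_{ja}\eta_{kc}$$ $$-\eta_{ia}\Phi_{jkbc}-\eta_{ja}\Phi_{kibc}-\eta_{ka}\Phi_{ijbc}-\eta_{ib}\Phi_{jkca}-\eta_{jb}\Phi_{kica}-\eta_{kb}\Phi_{ijca}-\eta_{ic}\Phi_{jkab}-\eta_{jc}\Phi_{kiab}-\eta_{kc}\Phi_{ijab},$$ and $\Phi$ is self-dual. Square (round) brackets denote (anti-)symmetrisation with weight one: $[\,]$ antisymmetrisation, $(\,)$ symmetrisation. For any tensor $t$, $(t_{a_1\dots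 a_k})^2$ means $t_{a_1\dots a_k}t^{a_1\dots a_k}$. $\Lambda^2_7\subset\Lambda^2$ is the eigenspace with eigenvalue $-3$ of $J_2(\beta)_{ij}=\frac12\Phi_{ij}{}^{ab}\beta_{ab}$. $\Lambda^4_{1+7+35}$ is the direct sum of the eigenspaces with eigenvalues $-12,-6,0$ of $J_4(\sigma)_{ijkl}=3\Phi_{[ij}{}^{pq}\sigma_{kl]pq}$; it is the tangent space at $\Phi$ to the $\mathrm{GL}(8,\mathbb{R})$-orbit. The transformations of $h,\xi$ are those induced by $\delta\phi=d(i_\zeta\Phi)$, i.e. $\delta\phi_{abcd}=-4\,\partial_{[a}\zeta^p\Phi_{bcd]p}$. Lagrangians have constant coefficients. *)

(* Defs.v *)
From HB Require Import structures.
From mathcomp Require Import all_boot all_order all_algebra all_fingroup.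
From mathcomp Require Import all_classical all_reals.
From mathcomp Require Import topology normedtype derive.

Set Implicit Arguments.
Unset Strict Implicit.
Unset Printing Implicit Defensive.
Import Order.TTheory GRing.Theory Num.Theory.
Import numFieldNormedType.Exports.
Local Open Scope ring_scope.

Fixpoint inversions (v : seq nat) : nat :=
  if v is a :: w then (count (fun b => b < a)%N w + inversions w)%N else 0%N.

Definition cayley_pos : seq (seq nat) :=
  [:: [:: 0; 2; 5; 7]; [:: 0; 3; 4; 7]; [:: 0; 3; 5; 6]; [:: 1; 2; 4; 7];
      [:: 1; 2; 5; 6]; [:: 1; 3; 4; 6]]%N.

Definition cayley_neg : seq (seq nat) :=
  [:: [:: 0; 1; 2; 3]; [:: 0; 1; 4; 5]; [:: 0; 1; 6; 7]; [:: 0; 2; 4; 6];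
      [:: 1; 3; 5; 7]; [:: 2; 3; 4; 5]; [:: 2; 3; 6; 7]; [:: 4; 5; 6; 7]]%N.

(* Components of the model Cayley form
     sum_(q in cayley_pos) e^q - sum_(q in cayley_neg) e^q
   on basis vectors. Its overall sign is the one for which the contraction
   identity cayley0_contraction below holds; the opposite 4-form satisfies the
   identity with the opposite sign in front of the terms linear in the form. *)
Definition cayley_sign (v : seq nat) : int :=
  (-1) ^+ inversions v *
  ((sort leq v \in cayley_pos)%:R - (sort leq v \in cayley_neg)%:R).

(* Both sides of the contraction identity (for the standard metric) are
   alternating in (i, j, k) and in (a, b, c), so increasing triples suffice. *)
Definition contraction_identity (f : nat -> nat -> nat -> nat -> int)
    (i j k a b c : nat) : bool :=
  let n (x y : nat) : int := (x == y)%:R in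
  foldr (fun p s => f i j k p * f a b c p + s) 0 (iota 0 8) ==
    n i a * n j b * n k c + n i b * n j c * n k a + n i c * n j a * n k b
  - n i a * n j c * n k b - n i c * n j b * n k a - n i b * n j a * n k c
  - n i a * f j k b c - n j a * f k i b c - n k a * f i j b c
  - n i b * f j k c a - n j b * f k i c a - n k b * f i j c a
  - n i c * f j k a b - n j c * f k i a b - n k c * f i j a b.

Definition increasing_triples : seq (nat * nat * nat) :=
  [seq t <- [seq (ij, k) | ij <- [seq (i, j) | i <- iota 0 8, j <- iota 0 8],
                           k <- iota 0 8] | t.1.1 < t.1.2 < t.2]%N.

Fact cayley0_contraction :
  all (fun t => all (fun u => contraction_identity
      (fun i j k l => cayley_sign [:: i; j; k; l])
      t.1.1 t.1.2 t.2 u.1.1 u.1.2 u.2)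
    increasing_triples) increasing_triples.
Proof. by vm_compute. Qed.

(* Self-duality for the orientation e^01234567. *)
Fact cayley0_selfdual :
  all (fun q => let q' := [seq i <- iota 0 8 | i \notin q] in
         cayley_sign q == (-1) ^+ inversions (q ++ q') * cayley_sign q')
    (cayley_pos ++ cayley_neg).
Proof. by vm_compute. Qed.

Definition tensor4 (R : Type) := 'I_8 -> 'I_8 -> 'I_8 -> 'I_8 -> R.

Definition cayley0 (R : realType) : tensor4 R := fun i j k l =>
  (cayley_sign [:: i : nat; j : nat; k : nat; l : nat])%:~R.

Definition pullback4 (R : realType) (g : 'M[R]_8) (s : tensor4 R) : tensor4 R :=
  fun a b c d => \sum_i \sum_j \sum_k \sum_l
    g i a * g j b * g k c * g l d * s i j k l.

(* Phi lies in the GL(8)-orbit of the model, and eta is the metric it induces.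
   Orthonormal frames of both orientations are allowed: the orientation in use
   is the one determined by Phi itself. *)
Definition cayley_form (R : realType) (Phi : tensor4 R) (eta : 'M[R]_8) : Prop :=
  exists2 g : 'M[R]_8, g \in unitmx &
    Phi = pullback4 g (cayley0 R) /\ eta = g^T *m g.

Definition spin7 (R : realType) (Phi : tensor4 R) (g : 'M[R]_8) : Prop :=
  g \in unitmx /\ pullback4 g Phi = Phi.

(* Antisymmetrisation with weight one. *)
Definition alt4 (R : realType) (t : tensor4 R) : tensor4 R := fun a b c d =>
  let v := tnth [tuple a; b; c; d] in
  (4`!%:R)^-1 * \sum_(s : 'S_4) (-1) ^+ s *
    t (v (s (inord 0))) (v (s (inord 1))) (v (s (inord 2))) (v (s (inord 3))).

Definition alternating4 (R : realType) (s : tensor4 R) : Prop :=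
  forall a b c d, [/\ s b a c d = - s a b c d, s a c b d = - s a b c d
                    & s a b d c = - s a b c d].

Section Algebra.
Context (R : realType) (Phi : tensor4 R) (eta : 'M[R]_8).

Let eta' := invmx eta.

(* Phi_{ab}^{pq} *)
Definition cayley_up (a b p q : 'I_8) : R :=
  \sum_r \sum_s Phi a b r s * eta' r p * eta' s q.

Definition J2 (beta : 'M[R]_8) : 'M[R]_8 :=
  \matrix_(i, j) (2^-1 * \sum_a \sum_b cayley_up i j a b * beta a b).

Definition Lambda2_7 (beta : 'M[R]_8) : Prop :=
  beta^T = - beta /\ J2 beta = - 3 *: beta.

Definition J4 (s : tensor4 R) : tensor4 R :=
  alt4 (fun i j k l => 3 * \sum_p \sum_q cayley_up i j p q * s k l p q).

Definition J4_eigen (m : R) (s : tensor4 R) : Prop :=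
  alternating4 s /\ forall a b c d, J4 s a b c d = m * s a b c d.

Definition Lambda4_1_7_35 (s : tensor4 R) : Prop :=
  exists s1 s7 s35 : tensor4 R,
    [/\ J4_eigen (-12) s1, J4_eigen (-6) s7, J4_eigen 0 s35 &
        forall a b c d, s a b c d = s1 a b c d + s7 a b c d + s35 a b c d].

(* -4 (h_[a^p + 1/4 xi_[a^p) Phi_bcd]p *)
Definition perturbation (h xi : 'M[R]_8) : tensor4 R := fun a b c d =>
  - 4 * alt4 (fun a b c d => \sum_p
    (\sum_q (h a q + 4^-1 * xi a q) * eta' q p) * Phi b c d p) a b c d.

End Algebra.

Section Fields.
Context (R : realType).

Definition pt8 := 'cV[R]_8.

Definition partial (a : 'I_8) (f : pt8 -> R) : pt8 -> R :=
  fun x => 'D_(delta_mx a 0) f x.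

(* C^infinity: every iterated partial derivative is Frechet differentiable. *)
Definition smooth (f : pt8 -> R) : Prop :=
  forall (s : seq 'I_8) (x : pt8), differentiable (foldr partial f s) x.

Definition smooth_mx (m n : nat) (f : pt8 -> 'M[R]_(m, n)) : Prop :=
  forall i j, smooth (fun x => f x i j).

(* Differential polynomials with constant coefficients in the components of a
   family of fields indexed by I. *)
Inductive diffpoly (I : Type) : Type :=
| DPconst of R
| DPvar of I
| DPadd of diffpoly I & diffpoly I
| DPmul of diffpoly I & diffpoly I
| DPpartial of 'I_8 & diffpoly I.

Fixpoint dp_eval (I : Type) (P : diffpoly I) (u : I -> pt8 -> R)
    : pt8 -> R :=
  match P with
  | DPconst r => fun _ => r
  | DPvar i => u i
  | DPadd P Q => fun x => dp_eval P u x + dp_eval Q u x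
  | DPmul P Q => fun x => dp_eval P u x * dp_eval Q u x
  | DPpartial a P => partial a (dp_eval P u)
  end.

Definition divergence (I : Type) (J : 'I_8 -> diffpoly I) (u : I -> pt8 -> R)
    : pt8 -> R :=
  fun x => \sum_a partial a (dp_eval (J a) u) x.

Definition pair_idx := ('I_8 * 'I_8 + 'I_8 * 'I_8)%type.

Definition pair_fields (h xi : pt8 -> 'M[R]_8) (i : pair_idx) : pt8 -> R :=
  match i with
  | inl p => fun x => h x p.1 p.2
  | inr p => fun x => xi x p.1 p.2
  end.

Definition triple_fields (h xi : pt8 -> 'M[R]_8) (zeta : pt8 -> 'cV[R]_8)
    (i : pair_idx + 'I_8) : pt8 -> R :=
  match i with
  | inl p => pair_fields h xi p
  | inr a => fun x => zeta x a 0
  end.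

(* A Lagrangian, as a functional of the fields (h, xi). *)
Definition lagrangian :=
  (pt8 -> 'M[R]_8) -> (pt8 -> 'M[R]_8) -> pt8 -> R.

End Fields.

Section Lagrangians.
Context (R : realType) (Phi : tensor4 R) (eta : 'M[R]_8).

Let eta' := invmx eta.

Definition h_field (h : pt8 R -> 'M[R]_8) : Prop :=
  smooth_mx h /\ forall x, (h x)^T = h x.

Definition xi_field (xi : pt8 R -> 'M[R]_8) : Prop :=
  smooth_mx xi /\ forall x, Lambda2_7 Phi eta (xi x).

Definition phi_field (phi : pt8 R -> tensor4 R) : Prop :=
  (forall a b c d, smooth (fun x => phi x a b c d)) /\
  forall x, Lambda4_1_7_35 Phi eta (phi x).

Definition eq_mod_div (L1 L2 : lagrangian R) : Prop :=
  exists J : 'I_8 -> diffpoly R pair_idx,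
    forall h xi, h_field h -> xi_field xi ->
    forall x, L1 h xi x - L2 h xi x = divergence J (pair_fields h xi) x.

Definition multi_idx := ('I_8 * 'I_8 * 'I_8 * 'I_8)%type.

Definition component (phi : pt8 R -> tensor4 R) (I : multi_idx) : pt8 R -> R :=
  fun x => let: (a, b, c, d) := I in phi x a b c d.

Definition coefs := multi_idx -> multi_idx -> 'I_8 -> 'I_8 -> R.

(* The Lagrangians that are quadratic in phi, with constant coefficients and
   exactly two derivatives in each term. *)
Definition quadratic_lagrangian (A B : coefs) (phi : pt8 R -> tensor4 R)
    : pt8 R -> R := fun x =>
  \sum_I \sum_J \sum_a \sum_b
    (A I J a b * partial a (component phi I) x * partial b (component phi J) x
     + B I J a b * component phi I x * partial a (partial b (component phi J)) x).

(* In terms of the parametrisation of phi. *)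
Definition lagrangian_of (A B : coefs) : lagrangian R := fun h xi =>
  quadratic_lagrangian A B (fun x => perturbation Phi eta (h x) (xi x)).

Definition spin7_invariant (A B : coefs) : Prop :=
  forall g : 'M[R]_8, spin7 Phi g -> forall phi, phi_field phi ->
  forall x, quadratic_lagrangian A B (fun y => pullback4 g (phi (g *m y))) x =
            quadratic_lagrangian A B phi (g *m x).

(* <s, t> = s_a t^a,  |t|^2 = t_{abc} t^{abc} *)
Definition dot1 (s t : 'I_8 -> R) : R := \sum_a \sum_b eta' a b * s a * t b.

Definition sqr3 (t : 'I_8 -> 'I_8 -> 'I_8 -> R) : R :=
  \sum_a \sum_b \sum_c \sum_p \sum_q \sum_r
    eta' a p * eta' b q * eta' c r * t a b c * t p q r.

Definition entry (m : pt8 R -> 'M[R]_8) (a b : 'I_8) : pt8 R -> R :=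
  fun x => m x a b.

Definition trace_eta (h : pt8 R -> 'M[R]_8) : pt8 R -> R :=
  fun x => \sum_a \sum_b eta' a b * h x a b.

(* (partial_a m_bc)^2 *)
Definition grad_sqr (m : pt8 R -> 'M[R]_8) (x : pt8 R) : R :=
  sqr3 (fun a b c => partial a (entry m b c) x).

(* (partial_a h)^2 *)
Definition grad_trace_sqr (h : pt8 R -> 'M[R]_8) (x : pt8 R) : R :=
  let dh a := partial a (trace_eta h) x in dot1 dh dh.

(* partial^a m_ab *)
Definition div1 (m : pt8 R -> 'M[R]_8) (x : pt8 R) (b : 'I_8) : R :=
  \sum_a \sum_c eta' a c * partial c (entry m a b) x.

(* partial^a partial^b m_ab *)
Definition div2 (m : pt8 R -> 'M[R]_8) (x : pt8 R) : R :=
  \sum_a \sum_b \sum_c \sum_d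
    eta' a c * eta' b d * partial c (partial d (entry m a b)) x.

Definition general_lagrangian (rho alpha beta gamma lambda mu : R)
    : lagrangian R := fun h xi x =>
  rho / 2 * grad_sqr h x + alpha / 2 * grad_trace_sqr h x
  - beta * (trace_eta h x * div2 h x) - gamma * dot1 (div1 h x) (div1 h x)
  + lambda / 2 * grad_sqr xi x - mu * dot1 (div1 h x) (div1 xi x).

Definition lagrangian_GR : lagrangian R := fun h xi x =>
  1 / 2 * grad_sqr h x - 1 / 2 * grad_trace_sqr h x
  - trace_eta h x * div2 h x - dot1 (div1 h x) (div1 h x).

Definition lagrangian' : lagrangian R := fun h xi x =>
  1 / 2 * grad_trace_sqr h x + trace_eta h x * div2 h x
  + 1 / 2 * dot1 (div1 h x) (div1 h x) + 1 / 16 * grad_sqr xi x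
  - dot1 (div1 h x) (div1 xi x).

(* partial_a zeta_b, with zeta_b = eta_bp zeta^p *)
Definition dzeta (zeta : pt8 R -> 'cV[R]_8) (x : pt8 R) (a b : 'I_8) : R :=
  partial a (fun y => \sum_p eta b p * zeta y p 0) x.

Definition delta_h (zeta : pt8 R -> 'cV[R]_8) : pt8 R -> 'M[R]_8 := fun x =>
  \matrix_(a, b) (2^-1 * (dzeta zeta x a b + dzeta zeta x b a)).

Definition delta_xi (zeta : pt8 R -> 'cV[R]_8) : pt8 R -> 'M[R]_8 := fun x =>
  \matrix_(a, b) (2^-1 * (dzeta zeta x a b - dzeta zeta x b a)
    - 2^-1 * \sum_p \sum_q cayley_up Phi eta a b p q * dzeta zeta x p q).

(* First-order variation of L along the transformation generated by zeta. *)
Definition variation (L : lagrangian R) (h xi : pt8 R -> 'M[R]_8)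
    (zeta : pt8 R -> 'cV[R]_8) (x : pt8 R) : R :=
  derive1 (fun e : R => L (fun y => h y + e *: delta_h zeta y)
                          (fun y => xi y + e *: delta_xi zeta y) x) 0.

Definition diffeo_invariant (L : lagrangian R) : Prop :=
  exists J : 'I_8 -> diffpoly R (pair_idx + 'I_8),
    forall h xi zeta, h_field h -> xi_field xi -> smooth_mx zeta ->
    forall x, variation L h xi zeta x = divergence J (triple_fields h xi zeta) x.

End Lagrangians.

(* Main.v *)
(* All statements are transported to the orthonormal frame in which Phi is the model
   form Phi0. Contracting three indices of a perturbation with Phi0 gives
   24 h + 18 (tr h) 1 + 24 xi, which recovers (h, xi).

   Modulo divergences a quadratic Lagrangian with two derivatives is determined by its
   symbol, a quadratic form in (h, xi) for each momentum k. Integration by parts gives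
   one direction. For the other, on a plane wave cos(k.x) a divergence is the derivative
   of a periodic function of the phase, so its mean vanishes.

   An invariant symbol is an invariant trilinear form on Sym^2 x V x V with
   V = Sym^2 + Lambda^2_7. The Clifford elements gamma_a and
   (gamma_a + gamma_b) / sqrt 2 of Spin(7) permute a basis of V up to signs, and the
   orbits of basis triples leave six constants. An element of Spin(7) is orthogonal,
   because self-duality and the contraction identity show that it preserves the metric.

   Invariance under diffeomorphisms says that the polar form of the symbol vanishes
   between (h, xi) and the variation generated by k and zeta. In the frame this polar
   form is a combination of four independent expressions, whose coefficients give the
   four linear conditions. *)

Require Import Defs.
From mathcomp Require Import all_boot all_order all_algebra all_fingroup.
From mathcomp Require Import all_classical all_reals.
From mathcomp Require Import topology normedtype derive realfun trigo.
From mathcomp Require Import ring lra zify.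
Set Implicit Arguments.
Unset Strict Implicit.
Unset Printing Implicit Defensive.
Import Order.TTheory GRing.Theory Num.Theory.
Import numFieldNormedType.Exports.
Local Open Scope ring_scope.

(** * The model Cayley form *)

(** Three obstacles shape the proof. The model form is a table and [R] is an abstract real field, so
    each finite check is made on integer matrices by [vm_compute] and then mapped into [R]; the
    square roots in the Spin(7) elements are kept apart as integer scales. A total derivative is the
    divergence of one differential polynomial serving all fields. The symbol is seen only for
    [K = k k^T] and on the diagonal, whereas the classification concerns trilinear forms.
    Polarisation bridges the gap, and the part antisymmetric in the two derivative indices is
    harmless because partial derivatives commute. The constants are found by elimination: a basis
    triple is fixed with sign -1, or moved to one of lower weight, or it is a normal form.
    Conversely, every choice of constants comes from an invariant Lagrangian in the perturbation
    because the inverse of the parametrisation is linear and commutes with Spin(7). *)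

Lemma alternating3_eq0 (R : realType) (f : 'I_8 -> 'I_8 -> 'I_8 -> R) :
    (forall i j k, f j i k = - f i j k) -> (forall i j k, f i k j = - f i j k) ->
    (forall i j k : 'I_8, (i < j < k)%N -> f i j k = 0) ->
  forall i j k, f i j k = 0.
Proof.
move=> f12 f23 f0.
have dup x : x = - x :> R -> x = 0 by move=> ?; lra.
have f0' (i j k : 'I_8) : (i < j)%N -> f i j k = 0.
  move=> ij; have [jk|kj|/val_inj <-] := ltngtP j k.
  - by apply: f0; rewrite ij.
  - have [ik|ki|/val_inj <-] := ltngtP i k.
    + by rewrite f23 f0 ?oppr0// ik.
    + by rewrite f23 f12 f0 ?oppr0// ki.
    + by rewrite f23 (dup (f i i j))// oppr0.
  - exact/dup.
move=> i j k; have [/f0'//|ji|/val_inj <-] := ltngtP i j.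
  by rewrite f12 f0'// oppr0.
exact/dup.
Qed.

Definition delta (R : realType) (i j : 'I_8) : R := (i == j)%:R.

Lemma sum_delta (R : realType) (b : 'I_8) (F : 'I_8 -> R) :
  \sum_e delta R e b * F e = F b.
Proof.
rewrite (bigD1 b)//= {1}/delta eqxx mul1r big1 ?addr0// => e /negPf eb.
by rewrite /delta eb mul0r.
Qed.

Lemma deltaC (R : realType) i j : delta R i j = delta R j i.
Proof. by rewrite /delta eq_sym. Qed.

Fact cayley_sign_alternating :
  all (fun a => all (fun b => all (fun c => all (fun d =>
    let s x y z t := cayley_sign [:: x; y; z; t] in
    [&& s b a c d == - s a b c d, s a c b d == - s a b c d
      & s a b d c == - s a b c d])
    (iota 0 8)) (iota 0 8)) (iota 0 8)) (iota 0 8).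
Proof. by vm_compute. Qed.

Lemma all_iota8P (P : nat -> bool) : all P (iota 0 8) -> forall i : 'I_8, P i.
Proof. by move=> /allP h i; apply: h; rewrite mem_iota/=. Qed.

Lemma cayley0_alternating (R : realType) : alternating4 (cayley0 R).
Proof.
move=> a b c d; have := cayley_sign_alternating.
move=> /all_iota8P/(_ a)/all_iota8P/(_ b)/all_iota8P/(_ c)/all_iota8P/(_ d).
by case/and3P => /eqP h1 /eqP h2 /eqP h3; split;
  rewrite /cayley0 ?h1 ?h2 ?h3 rmorphN.
Qed.

Lemma foldr_iota8 (F : nat -> int) :
  foldr (fun p s => F p + s) 0 (iota 0 8) = \sum_(p < 8) F p.
Proof. by rewrite -(big_mkord xpredT) /index_iota unlock. Qed.

Definition contraction_rhs (R : realType) (f : tensor4 R)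
    (i j k a b c : 'I_8) : R :=
    delta R i a * delta R j b * delta R k c
  + delta R i b * delta R j c * delta R k a
  + delta R i c * delta R j a * delta R k b
  - delta R i a * delta R j c * delta R k b
  - delta R i c * delta R j b * delta R k a
  - delta R i b * delta R j a * delta R k c
  - delta R i a * f j k b c - delta R j a * f k i b c - delta R k a * f i j b c
  - delta R i b * f j k c a - delta R j b * f k i c a - delta R k b * f i j c a
  - delta R i c * f j k a b - delta R j c * f k i a b - delta R k c * f i j a b.

Lemma contraction_identity_intr (R : realType) (f : nat -> nat -> nat -> nat -> int)
    (F := fun i j k l : 'I_8 => (f i j k l)%:~R : R) (i j k a b c : 'I_8) :
  contraction_identity f i j k a b c ->
  \sum_p F i j k p * F a b c p = contraction_rhs F i j k a b c.
Proof.
move/eqP; rewrite foldr_iota8; set n := fun x y : nat => (x == y)%:R : int.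
move=> /(congr1 (fun z : int => z%:~R : R)).
rewrite rmorph_sum !(rmorphB, rmorphD, rmorphM)/=.
have nE (x y : 'I_8) : (n x y)%:~R = delta R x y by rewrite /n /delta rmorph_nat.
rewrite !nE /contraction_rhs => <-.
by apply: eq_bigr => p _; rewrite rmorphM.
Qed.

Lemma cayley0_contraction1 (R : realType) i j k a b c :
  \sum_p cayley0 R i j k p * cayley0 R a b c p =
  contraction_rhs (cayley0 R) i j k a b c.
Proof.
have alt := cayley0_alternating R.
have a12 x y z t : cayley0 R y x z t = - cayley0 R x y z t by case: (alt x y z t).
have a23 x y z t : cayley0 R x z y t = - cayley0 R x y z t by case: (alt x y z t).
have a34 x y z t : cayley0 R x y t z = - cayley0 R x y z t by case: (alt x y z t).
apply/eqP; rewrite -subr_eq0; apply/eqP.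
move: a b c; apply: alternating3_eq0 => [a b c|a b c|a b c abc].
- have -> : \sum_p cayley0 R i j k p * cayley0 R b a c p =
     - \sum_p cayley0 R i j k p * cayley0 R a b c p.
    by rewrite -sumrN; apply: eq_bigr => p _; rewrite (a12 a b) mulrN.
  rewrite /contraction_rhs !(a34 _ _ b a) !(a34 _ _ c b) !(a34 _ _ c a).
  by rewrite !(a34 _ _ a c) !(a34 _ _ a b) !(a34 _ _ b c); ring.
- have -> : \sum_p cayley0 R i j k p * cayley0 R a c b p =
     - \sum_p cayley0 R i j k p * cayley0 R a b c p.
    by rewrite -sumrN; apply: eq_bigr => p _; rewrite (a23 a b c) mulrN.
  rewrite /contraction_rhs !(a34 _ _ b a) !(a34 _ _ c b) !(a34 _ _ c a).
  by ring.
move: i j k; apply: alternating3_eq0 => [i j k|i j k|i j k ijk].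
- have -> : \sum_p cayley0 R j i k p * cayley0 R a b c p =
     - \sum_p cayley0 R i j k p * cayley0 R a b c p.
    by rewrite -sumrN; apply: eq_bigr => p _; rewrite (a12 i j) mulNr.
  by rewrite /contraction_rhs !(a12 i j) !(a12 j k) !(a12 k i); ring.
- have -> : \sum_p cayley0 R i k j p * cayley0 R a b c p =
     - \sum_p cayley0 R i j k p * cayley0 R a b c p.
    by rewrite -sumrN; apply: eq_bigr => p _; rewrite (a23 i j k) mulNr.
  by rewrite /contraction_rhs !(a12 i j) !(a12 j k) !(a12 k i); ring.
have inc (x y z : 'I_8) : (x < y < z)%N ->
    (val x, val y, val z) \in increasing_triples.
  have im (t : 'I_8) : val t \in iota 0 8 by rewrite mem_iota/=.
  move=> xyz; rewrite mem_filter [X in X && _]xyz andTb.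
  apply/allpairsPdep; exists (val x, val y), (val z); split => //.
  by apply/allpairsPdep; exists (val x), (val y).
move/allP: cayley0_contraction => /(_ _ (inc _ _ _ ijk)) /allP.
move=> /(_ _ (inc _ _ _ abc)) /(contraction_identity_intr R) /eqP.
by rewrite -subr_eq0 => /eqP.
Qed.

(** * Weight-one antisymmetrisation of 4-tensors *)

Section Antisymmetrisation.
Context (R : realType).
Implicit Types s t : tensor4 R.

Lemma tensor4P s t : (forall a b c d, s a b c d = t a b c d) -> s = t.
Proof. by move=> st; do 4 (apply/funext => ?); exact: st. Qed.

Let val4 t (v : 'I_4 -> 'I_8) :=
  t (v (inord 0)) (v (inord 1)) (v (inord 2)) (v (inord 3)).

Let alt4E t (a b c d : 'I_8) : alt4 t a b c d =
  (4`!%:R)^-1 * \sum_(s : 'S_4) (-1) ^+ s * val4 t (tnth [tuple a; b; c; d] \o s).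
Proof. by []. Qed.

Lemma alt4D s t a b c d :
  alt4 (fun a b c d => s a b c d + t a b c d) a b c d = alt4 s a b c d + alt4 t a b c d.
Proof. by rewrite !alt4E -mulrDr -big_split; congr (_ * _); apply: eq_bigr => i _; rewrite mulrDr. Qed.

Lemma alt4Z k t a b c d :
  alt4 (fun a b c d => k * t a b c d) a b c d = k * alt4 t a b c d.
Proof.
rewrite !alt4E [RHS]mulrCA [X in _ = _ * X]mulr_sumr; congr (_ * _); apply: eq_bigr => i _.
by rewrite mulrCA.
Qed.

Let ord4 (i : 'I_4) : [\/ i = inord 0, i = inord 1, i = inord 2 | i = inord 3].
Proof.
case: i => -[|[|[|[|//]]]] ilt; [constructor 1|constructor 2|constructor 3|constructor 4];
  by apply/val_inj; rewrite /= inordK.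
Qed.

Let neq4 (i j : nat) : (i < 4)%N -> (j < 4)%N -> (inord i == inord j :> 'I_4) = (i == j).
Proof. by move=> i4 j4; rewrite -val_eqE/= !inordK. Qed.

Let tperm4 (i j k : nat) : (i < 4)%N -> (j < 4)%N -> (k < 4)%N ->
  tperm (inord i) (inord j) (inord k) =
  if k == i then inord j else if k == j then inord i else inord k :> 'I_4.
Proof.
move=> i4 j4 k4; rewrite permE/= !neq4//.
Qed.

(** Left multiplication by a transposition permutes the sum over ['S_4] and flips every sign. *)
Let alt4_swap t t' (i j : nat) a b c d : (i < 4)%N -> (j < 4)%N -> i != j ->
  (forall v, val4 t' v = val4 t (v \o tperm (inord i) (inord j))) ->
  alt4 t' a b c d = - alt4 t a b c d.
Proof.
move=> i4 j4 ij tt'; rewrite !alt4E -mulrN -sumrN; congr (_ * _).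
rewrite [RHS](reindex_inj (mulgI (tperm (inord i) (inord j))))/=.
apply: eq_bigr => s _; rewrite odd_permM odd_tperm neq4// ij.
rewrite -mulNr; congr (_ * _); first by rewrite /=; case: (odd_perm s); rewrite ?expr0 ?expr1 ?opprK.
rewrite tt'; congr (val4 t _); apply/funext => x /=.
by rewrite permM.
Qed.

Lemma alt4_swap12 t a b c d :
  alt4 (fun a b c d => t b a c d) a b c d = - alt4 t a b c d.
Proof. by apply: (@alt4_swap _ _ 0 1) => // v; rewrite /val4/= !tperm4. Qed.

Lemma alt4_swap23 t a b c d :
  alt4 (fun a b c d => t a c b d) a b c d = - alt4 t a b c d.
Proof. by apply: (@alt4_swap _ _ 1 2) => // v; rewrite /val4/= !tperm4. Qed.

Lemma alt4_swap34 t a b c d :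
  alt4 (fun a b c d => t a b d c) a b c d = - alt4 t a b c d.
Proof. by apply: (@alt4_swap _ _ 2 3) => // v; rewrite /val4/= !tperm4. Qed.

Lemma alt4_id t a b c d : alternating4 t -> alt4 t a b c d = t a b c d.
Proof.
move=> alt.
have a12 x y z w : t y x z w = - t x y z w by case: (alt x y z w).
have a23 x y z w : t x z y w = - t x y z w by case: (alt x y z w).
have a34 x y z w : t x y w z = - t x y z w by case: (alt x y z w).
(* A permutation is a product of transpositions, and each of the six transpositions of four slots is
   a composite of adjacent swaps. *)
have perm (s : 'S_4) : forall v, val4 t (v \o s) = (-1) ^+ s * val4 t v.
  have [ts -> _] := prod_tpermP s; elim: ts => [|[i j] ts IH] v.
    rewrite big_nil odd_perm1 expr0 mul1r; congr val4.
    by apply/funext => x /=; rewrite perm1.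
  rewrite big_cons odd_permM signr_addb odd_tperm/=.
  have -> : v \o (tperm i j * \prod_(t <- ts) tperm t.1 t.2)%g =
            (v \o (\prod_(t <- ts) tperm t.1 t.2)%g) \o tperm i j.
    by apply/funext => x /=; rewrite permM.
  rewrite -mulrA -IH; move: (v \o _) => w; have [->|] := eqVneq i j.
    by rewrite expr0 mul1r; congr val4; apply/funext => x /=; rewrite tperm1 perm1.
  rewrite expr1 mulN1r /val4/=.
  have a13 x y z u : t z y x u = - t x y z u by rewrite a12 a23 a12 opprK.
  have a24 x y z u : t x u z y = - t x y z u by rewrite a23 a34 a23 opprK.
  have a14 x y z u : t u y z x = - t x y z u by rewrite a12 a24 a12 opprK.
  case: (ord4 i) => ->; case: (ord4 j) => ->; rewrite ?eqxx// => _;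
    rewrite !tperm4//=; first [exact: a12|exact: a23|exact: a34|exact: a13|exact: a24|exact: a14].
rewrite alt4E; under eq_bigr do rewrite perm mulrA -expr2 sqrr_sign mul1r.
rewrite sumr_const card_Sn -[X in _ * X]mulr_natl mulrA mulVf ?pnatr_eq0//.
by rewrite mul1r /val4 !(tnth_nth a)/= !inordK.
Qed.

Lemma alternatingD s t : alternating4 s -> alternating4 t ->
  alternating4 (fun a b c d => s a b c d + t a b c d).
Proof.
move=> hs ht a b c d; case: (hs a b c d) => h1 h2 h3; case: (ht a b c d) => k1 k2 k3.
by split; rewrite ?h1 ?h2 ?h3 ?k1 ?k2 ?k3 opprD.
Qed.

Lemma alternatingZ k t : alternating4 t ->
  alternating4 (fun a b c d => k * t a b c d).
Proof.
move=> ht a b c d; case: (ht a b c d) => k1 k2 k3.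
by split; rewrite ?k1 ?k2 ?k3 mulrN.
Qed.

Let alt4N t a b c d :
  alt4 (fun a b c d => - t a b c d) a b c d = - alt4 t a b c d.
Proof.
by rewrite -mulN1r -alt4Z; congr (alt4 _ a b c d); apply: tensor4P => *; rewrite mulN1r.
Qed.

(** If [t] alternates in its last three slots, only the four cosets of [S_3] in [S_4] count. Their
    signed sum [u] is alternating, so it equals its own antisymmetrisation, to which each coset
    contributes [alt4 t]. *)
Lemma alt4_31 t a b c d :
  (forall a b c d, t a c b d = - t a b c d) ->
  (forall a b c d, t a b d c = - t a b c d) ->
  4 * alt4 t a b c d = t a b c d - t b a c d + t c a b d - t d a b c.
Proof.
move=> t23 t34.
pose f1 : tensor4 R := fun a b c d => t b a c d.
pose f2 : tensor4 R := fun a b c d => f1 a c b d.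
pose f3 : tensor4 R := fun a b c d => f2 a b d c.
have e1 : alt4 f1 a b c d = - alt4 t a b c d by exact: alt4_swap12.
have e2 : alt4 f2 a b c d = alt4 t a b c d by rewrite alt4_swap23 e1 opprK.
have e3 : alt4 f3 a b c d = - alt4 t a b c d by rewrite alt4_swap34 e2.
pose u : tensor4 R := fun a b c d => t a b c d - f1 a b c d + f2 a b c d - f3 a b c d.
have ualt : alternating4 u.
  move=> x y z w; rewrite /u /f3 /f2 /f1; split.
  - by rewrite (t23 z x y) (t23 w x y); ring.
  - by rewrite (t23 x y z) (t34 w x y); ring.
  - by rewrite (t34 x y z) (t34 y x z); ring.
transitivity (alt4 u a b c d); last exact: alt4_id.
by rewrite /u !(alt4D, alt4N) e1 e2 e3; ring.
Qed.

(** The same argument with the six (2,2)-shuffles, the cosets of [S_2 x S_2]; they are reached from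
    the identity by adjacent swaps. *)
Lemma alt4_22 t a b c d :
  (forall a b c d, t b a c d = - t a b c d) ->
  (forall a b c d, t a b d c = - t a b c d) ->
  6 * alt4 t a b c d = t a b c d + t c d a b - t a c b d - t b d a c
                     + t a d b c + t b c a d.
Proof.
move=> t12 t34.
pose f1 : tensor4 R := fun a b c d => t a c b d.
pose f2 : tensor4 R := fun a b c d => f1 a b d c.
pose f3 : tensor4 R := fun a b c d => f1 b a c d.
pose f4 : tensor4 R := fun a b c d => f3 a b d c.
pose f5 : tensor4 R := fun a b c d => f4 a c b d.
have e1 : alt4 f1 a b c d = - alt4 t a b c d by exact: alt4_swap23.
have e2 : alt4 f2 a b c d = alt4 t a b c d by rewrite alt4_swap34 e1 opprK.
have e3 : alt4 f3 a b c d = alt4 t a b c d by rewrite alt4_swap12 e1 opprK.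
have e4 : alt4 f4 a b c d = - alt4 t a b c d by rewrite alt4_swap34 e3.
have e5 : alt4 f5 a b c d = alt4 t a b c d by rewrite alt4_swap23 e4 opprK.
pose u : tensor4 R := fun a b c d =>
  t a b c d + f5 a b c d - f1 a b c d - f4 a b c d + f2 a b c d + f3 a b c d.
have ualt : alternating4 u.
  move=> x y z w; rewrite /u /f5 /f4 /f3 /f2 /f1; split.
  - by rewrite (t12 x y) (t34 z w x y); ring.
  - by rewrite (t12 y z) (t34 x w y z); ring.
  - by rewrite (t34 x y z w) (t12 z w x y); ring.
transitivity (alt4 u a b c d); last exact: alt4_id.
by rewrite /u !(alt4D, alt4N) e1 e2 e3 e4 e5; ring.
Qed.

End Antisymmetrisation.

(** * Contractions with a Cayley form *)

Section Contractions.
Context (R : realType).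
Local Notation I := 'I_8.
Local Notation dl := (delta R).

Lemma delta_diag i : dl i i = 1. Proof. by rewrite /delta eqxx. Qed.

Lemma sum_delta_r (b : I) (F : I -> R) : \sum_e dl b e * F e = F b.
Proof. by under eq_bigr do rewrite deltaC; rewrite sum_delta. Qed.

Definition sum3 (F : I -> I -> I -> R) : R := \sum_e \sum_f \sum_g F e f g.

Lemma eq_sum3 F G : (forall e f g, F e f g = G e f g) -> sum3 F = sum3 G.
Proof. by move=> FG; do 3 (apply: eq_bigr => ? _). Qed.

Lemma sum3D F G : sum3 (fun e f g => F e f g + G e f g) = sum3 F + sum3 G.
Proof.
by rewrite /sum3 -big_split; apply: eq_bigr => e _; rewrite -big_split;
  apply: eq_bigr => f _; rewrite -big_split.
Qed.

Lemma sum3N F : sum3 (fun e f g => - F e f g) = - sum3 F.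
Proof.
by rewrite /sum3 -sumrN; apply: eq_bigr => e _; rewrite -sumrN;
  apply: eq_bigr => f _; rewrite -sumrN.
Qed.

Lemma sum3_delta3 X b c d : sum3 (fun e f g => X e f g * (dl e b * dl f c * dl g d)) = X b c d.
Proof.
rewrite -[RHS](sum_delta b (fun e => X e c d)); apply: eq_bigr => e _.
rewrite -(sum_delta c (fun f => X e f d)) mulr_sumr; apply: eq_bigr => f _.
rewrite -(sum_delta d (fun g => X e f g)) !mulr_sumr; apply: eq_bigr => g _; ring.
Qed.

Lemma sum3_delta_i X Y b : sum3 (fun e f g => X e f g * (dl e b * Y f g)) =
  \sum_f \sum_g X b f g * Y f g.
Proof.
rewrite -(sum_delta b (fun e => \sum_f \sum_g X e f g * Y f g)); apply: eq_bigr => e _.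
rewrite mulr_sumr; apply: eq_bigr => f _; rewrite mulr_sumr; apply: eq_bigr => g _; ring.
Qed.

Lemma sum3_delta_j X Y b : sum3 (fun e f g => X e f g * (dl f b * Y g e)) =
  \sum_g \sum_e X e b g * Y g e.
Proof.
transitivity (sum3 (fun f g e => X e f g * (dl f b * Y g e))).
  rewrite /sum3 exchange_big; apply: eq_bigr => f _; exact: exchange_big.
exact: sum3_delta_i.
Qed.

Lemma sum3_delta_k X Y b : sum3 (fun e f g => X e f g * (dl g b * Y e f)) =
  \sum_e \sum_f X e f b * Y e f.
Proof.
transitivity (sum3 (fun g e f => X e f g * (dl g b * Y e f))).
  rewrite /sum3 [RHS]exchange_big; apply: eq_bigr => e _; exact: exchange_big.
exact: sum3_delta_i.
Qed.

Context (Phi : tensor4 R).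
Context (Phi_alt : alternating4 Phi).
Context (Phi_contraction : forall i j k a b c,
  \sum_p Phi i j k p * Phi a b c p = contraction_rhs Phi i j k a b c).

Let P12 a b c d : Phi b a c d = - Phi a b c d. Proof. by case: (Phi_alt a b c d). Qed.
Let P23 a b c d : Phi a c b d = - Phi a b c d. Proof. by case: (Phi_alt a b c d). Qed.
Let P34 a b c d : Phi a b d c = - Phi a b c d. Proof. by case: (Phi_alt a b c d). Qed.

Let Pdup x : x = - x -> x = 0 :> R. Proof. by move=> ?; lra. Qed.
Let P0_12 a c d : Phi a a c d = 0. Proof. exact/Pdup/P12. Qed.
Let P0_23 a c d : Phi a c c d = 0. Proof. exact/Pdup/P23. Qed.
Let P0_13 a c d : Phi a c a d = 0. Proof. by rewrite P23 P0_12 oppr0. Qed.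
Let P0_24 a c d : Phi c a d a = 0. Proof. by rewrite P34 P0_23 oppr0. Qed.

Let P0_14 a c d : Phi a c d a = 0. Proof. by rewrite P34 P0_13 oppr0. Qed.

Lemma sum3_contraction X b c d :
  sum3 (fun e f g => X e f g * contraction_rhs Phi e f g b c d) =
    X b c d + X c d b + X d b c - X b d c - X d c b - X c b d
  - \sum_f \sum_g X b f g * Phi f g c d - \sum_f \sum_g X f b g * Phi g f c d
  - \sum_f \sum_g X f g b * Phi f g c d
  - \sum_f \sum_g X c f g * Phi f g d b - \sum_f \sum_g X f c g * Phi g f d b
  - \sum_f \sum_g X f g c * Phi f g d b
  - \sum_f \sum_g X d f g * Phi f g b c - \sum_f \sum_g X f d g * Phi g f b c
  - \sum_f \sum_g X f g d * Phi f g b c.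
Proof.
under eq_sum3 do rewrite /contraction_rhs !(mulrDr, mulrN).
rewrite !(sum3D, sum3N) !sum3_delta3.
rewrite !(sum3_delta_i X (fun f g => Phi f g _ _)) !(sum3_delta_j X (fun f g => Phi f g _ _)).
rewrite !(sum3_delta_k X (fun f g => Phi f g _ _)).
rewrite ![\sum_g \sum_e X e _ g * _]exchange_big/=.
done.
Qed.

Lemma contraction2 i j a b :
  \sum_p \sum_q Phi i j p q * Phi a b p q =
  6 * (dl i a * dl j b - dl i b * dl j a) - 4 * Phi i j a b.
Proof.
under eq_bigr do rewrite Phi_contraction.
(* [X] is the part that does not involve the summed index [k] and is counted 8 times; every other
   surviving term carries a delta in [k]. *)
have [X XE] : {X | X = dl i a * dl j b - dl i b * dl j a - Phi i j a b} by eexists.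
pose Y k := dl i b * dl k a - dl i a * dl k b - Phi k i a b.
pose Z k := dl j a * dl k b - dl j b * dl k a - Phi j k a b.
have -> : \sum_k contraction_rhs Phi i j k a b k =
    \sum_k (X + dl k j * Y k + dl k i * Z k - dl k a * Phi i j b k
           - dl k b * Phi i j k a).
  apply: eq_bigr => k _; rewrite /contraction_rhs XE /Y /Z P0_24 P0_14 P0_23 P0_13.
  by rewrite (deltaC R j k) (deltaC R i k) delta_diag; ring.
have EX : \sum_(k < 8) X = 8 * X by rewrite sumr_const card_ord -[LHS]mulr_natl.
rewrite !(sumrB, big_split)/= !sum_delta EX.
by rewrite XE /Y /Z (P34 i j a b) (P12 i j a b); ring.
Qed.

Lemma contraction3 i a :
  \sum_p \sum_q \sum_r Phi i p q r * Phi a p q r = 42 * dl i a.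
Proof.
under eq_bigr do rewrite contraction2.
rewrite (eq_bigr (fun p => 6 * dl i a - 6 * (dl p a * dl i p))); last first.
  by move=> p _; rewrite P0_24 delta_diag; ring.
rewrite sumrB sumr_const card_ord -mulr_sumr sum_delta -mulr_natl; ring.
Qed.

(** The derivative at the identity of the action of GL(8) on 4-tensors. Applied to the Cayley form
    it sweeps out the tangent space to the orbit. *)
Definition gl_act (u : 'M[R]_8) (s : tensor4 R) : tensor4 R := fun a b c d =>
  \sum_p (u a p * s p b c d + u b p * s a p c d + u c p * s a b p d + u d p * s a b c p).

Definition pair_contraction (s : tensor4 R) : tensor4 R := fun i j k l =>
  \sum_p \sum_q Phi i j p q * s k l p q.

(** Up to a factor 4 this is the adjoint of [u |-> gl_act u Phi] on alternating tensors, see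
    [gl_act_dot]; it serves to invert the parametrisation. *)
Definition triple_contraction (s : tensor4 R) : 'M[R]_8 :=
  \matrix_(a, b) sum3 (fun e f g => s a e f g * Phi b e f g).

Lemma gl_act_alternating u s : alternating4 s -> alternating4 (gl_act u s).
Proof.
move=> alt.
have a12 a b c d : s b a c d = - s a b c d by case: (alt a b c d).
have a23 a b c d : s a c b d = - s a b c d by case: (alt a b c d).
have a34 a b c d : s a b d c = - s a b c d by case: (alt a b c d).
move=> a b c d; rewrite /gl_act -!sumrN; split; apply: eq_bigr => p _.
- by rewrite (a12 a p) (a12 p b) (a12 a b p) (a12 a b c); ring.
- by rewrite (a23 p b) (a23 a p c) (a23 a b p) (a23 a b c); ring.
- by rewrite (a34 p b) (a34 a p c) (a34 a b p) (a34 a b c); ring.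
Qed.

(** The left side contains two copies of [Phi] contracted in a single index, so the contraction
    identity eliminates one of them. *)
Lemma gl_act_triple_contraction_aux s a b c d : alternating4 s ->
  \sum_p triple_contraction s a p * Phi p b c d =
  6 * s a b c d - 3 * (pair_contraction s c d a b + pair_contraction s d b a c
                       + pair_contraction s b c a d).
Proof.
move=> alt.
have a23 x y z t : s x z y t = - s x y z t by case: (alt x y z t).
have a34 x y z t : s x y t z = - s x y z t by case: (alt x y z t).
have PP x y z t : Phi x y z t = Phi z t x y.
  by rewrite (P23 x z) (P12 z x) (P34 z x t) (P23 z t x); ring.
transitivity (sum3 (fun e f g => s a e f g * contraction_rhs Phi e f g b c d)).
  under eq_bigr do rewrite mxE mulr_suml.
  rewrite exchange_big; apply: eq_bigr => e _; under eq_bigr do rewrite mulr_suml.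
  rewrite exchange_big; apply: eq_bigr => f _; under eq_bigr do rewrite mulr_suml.
  rewrite exchange_big; apply: eq_bigr => g _; rewrite -Phi_contraction mulr_sumr.
  apply: eq_bigr => p _; rewrite (P34 e f p g) (P23 e p f) (P12 p e).
  by rewrite (P34 b c p d) (P23 b p c) (P12 p b); ring.
rewrite sum3_contraction.
have E1 x y z : \sum_f \sum_g s a x f g * Phi f g y z = pair_contraction s y z a x.
  by apply: eq_bigr => f _; apply: eq_bigr => g _; rewrite PP mulrC.
have E2 x y z : \sum_f \sum_g s a f x g * Phi g f y z = pair_contraction s y z a x.
  rewrite -E1; apply: eq_bigr => f _; apply: eq_bigr => g _.
  by rewrite (a23 a x f) (P12 f g) mulrNN.
have E3 x y z : \sum_f \sum_g s a f g x * Phi f g y z = pair_contraction s y z a x.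
  rewrite -E1; apply: eq_bigr => f _; apply: eq_bigr => g _.
  by rewrite (a34 a f x g) (a23 a x f) opprK.
rewrite !(E1, E2, E3) (a34 a c b d) (a23 a b c) (a34 a b c d) (a23 a b d) (a34 a b c d).
by rewrite (a23 a c d b) (a34 a c b d) (a23 a b c d) ; ring.
Qed.

(** The auxiliary identity is applied in each of the four slots. The tensor itself is collected four
    times, giving 24, and each of the six pair contractions twice, giving 6. *)
Lemma gl_act_triple_contraction s a b c d : alternating4 s ->
  gl_act (triple_contraction s) Phi a b c d =
  24 * s a b c d - 6 * (pair_contraction s a b c d + pair_contraction s c d a b
    - pair_contraction s a c b d - pair_contraction s b d a c
    + pair_contraction s a d b c + pair_contraction s b c a d).
Proof.
move=> alt; have G := fun a b c d => gl_act_triple_contraction_aux a b c d alt.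
have a12 x y z t : s y x z t = - s x y z t by case: (alt x y z t).
have a23 x y z t : s x z y t = - s x y z t by case: (alt x y z t).
have a34 x y z t : s x y t z = - s x y z t by case: (alt x y z t).
have c12 x y z t : pair_contraction s y x z t = - pair_contraction s x y z t.
  rewrite -sumrN; apply: eq_bigr => p _; rewrite -sumrN; apply: eq_bigr => q _.
  by rewrite (P12 x y) mulNr.
have c34 x y z t : pair_contraction s x y t z = - pair_contraction s x y z t.
  rewrite -sumrN; apply: eq_bigr => p _; rewrite -sumrN; apply: eq_bigr => q _.
  by rewrite (a12 z t) mulrN.
rewrite /gl_act !big_split/=.
set T := triple_contraction s in G *.
have -> : \sum_p T b p * Phi a p c d = - \sum_p T b p * Phi p a c d.
  by rewrite -sumrN; apply: eq_bigr => p _; rewrite (P12 p a) mulrN.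
have -> : \sum_p T c p * Phi a b p d = \sum_p T c p * Phi p a b d.
  by apply: eq_bigr => p _; rewrite (P23 a p) (P12 p a) opprK.
have -> : \sum_p T d p * Phi a b c p = - \sum_p T d p * Phi p a b c.
  rewrite -sumrN; apply: eq_bigr => p _.
  by rewrite (P34 a b p) (P23 a p) (P12 p a) !mulrN !opprK.
rewrite !G (a12 a b) (a12 a c b) (a23 a b c).
rewrite (a12 a d b c) (a23 a b d c) (a34 a b c d).
rewrite (c34 _ _ a b) !(c34 _ _ a c) (c34 _ _ a d) !(c34 _ _ b c) !(c34 _ _ b d) (c34 _ _ c d).
rewrite (c12 a c) !(c12 a d) (c12 b d).
ring.
Qed.

Lemma triple_contraction_gl_act u : triple_contraction (gl_act u Phi) =
  24 *: u + (18 * \tr u)%:M - 12 *: \matrix_(a, b) \sum_p \sum_q Phi a b p q * u p q.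
Proof.
apply/matrixP => a b; rewrite !mxE.
have PP x y z t : Phi x y z t = Phi z t x y.
  by rewrite (P23 x z) (P12 z x) (P34 z x t) (P23 z t x); ring.
pose U p q := \sum_e \sum_f Phi a p e f * Phi b q e f.
(* [t1] comes from the derivation acting on the free slot of [Phi], where three indices are
   contracted; the other three slots contribute equally and leave two contracted indices. Hence 24 =
   42 - 3 * 6, 18 = 3 * 6 and 12 = 3 * 4. *)
pose t1 c d e := \sum_p u a p * (Phi p c d e * Phi b c d e).
pose t2 c d e := \sum_p u c p * (Phi a p d e * Phi b c d e).
transitivity (sum3 t1 + (sum3 t2 + sum3 (fun d c e => t2 c d e)
    + sum3 (fun d e c => t2 c d e))).
  rewrite -!sum3D; apply: eq_sum3 => c d e; rewrite /gl_act /t1 /t2 mulr_suml -!big_split.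
  apply: eq_bigr => p _ /=; rewrite (P23 a p c) (P34 a c p) (P23 a p c).
  by rewrite (P23 b c d) (P23 b c e) (P34 b c d e); ring.
have -> : sum3 t1 = 42 * u a b.
  transitivity (\sum_p u a p * (42 * dl p b)); last first.
    by under eq_bigr do rewrite mulrCA mulrA mulrC deltaC; rewrite sum_delta_r mulrC.
  rewrite /sum3 /t1; under [RHS]eq_bigr do rewrite -contraction3 mulr_sumr.
  rewrite [RHS]exchange_big; apply: eq_bigr => c _.
  under [RHS]eq_bigr do rewrite mulr_sumr.
  rewrite [RHS]exchange_big; apply: eq_bigr => d _.
  under [RHS]eq_bigr do rewrite mulr_sumr.
  by rewrite [RHS]exchange_big.
have -> : sum3 (fun d e c => t2 c d e) = sum3 t2.
  rewrite /sum3 [RHS]exchange_big; apply: eq_bigr => d _; exact: exchange_big.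
have -> : sum3 (fun d c e => t2 c d e) = sum3 t2 by rewrite /sum3 [RHS]exchange_big.
have -> : sum3 t2 = \sum_c \sum_p u c p * (6 * (dl a b * dl p c - dl a c * dl p b) - 4 * Phi a p b c).
  apply: eq_bigr => c _; under [RHS]eq_bigr do rewrite -contraction2 mulr_sumr.
  rewrite [RHS]exchange_big; apply: eq_bigr => d _.
  under [RHS]eq_bigr do rewrite mulr_sumr.
  by rewrite [RHS]exchange_big.
have -> : \sum_c \sum_p u c p * (6 * (dl a b * dl p c - dl a c * dl p b) - 4 * Phi a p b c)
   = 6 * dl a b * \tr u - 6 * u a b - 4 * \sum_p \sum_q Phi a b p q * u p q.
  transitivity (\sum_c (6 * dl a b * u c c - dl c a * (6 * u c b)
                        - 4 * \sum_q Phi a b c q * u c q)).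
    apply: eq_bigr => c _; rewrite -(sum_delta c (fun p => 6 * dl a b * u c p)).
    rewrite -(sum_delta b (fun p => dl c a * (6 * u c p))) mulr_sumr -!sumrB.
    apply: eq_bigr => p _; rewrite (P23 a b p c) (P34 a b c p) (deltaC R a c); ring.
  by rewrite !sumrB -!mulr_sumr sum_delta; congr (_ - _ - _).
by rewrite /delta; case: eqP => _; ring.
Qed.

Lemma gl_act_dot u s : alternating4 s ->
  \sum_a sum3 (fun b c d => gl_act u Phi a b c d * s a b c d) =
  4 * \sum_a \sum_b u a b * triple_contraction s a b.
Proof.
move=> alt.
have a12 x y z t : s y x z t = - s x y z t by case: (alt x y z t).
have a23 x y z t : s x z y t = - s x y z t by case: (alt x y z t).
have a34 x y z t : s x y t z = - s x y z t by case: (alt x y z t).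
pose t a b c d := \sum_p u a p * Phi p b c d * s a b c d.
have t_eq : \sum_a sum3 (t a) = \sum_a \sum_b u a b * triple_contraction s a b.
  apply: eq_bigr => a _; under [RHS]eq_bigr do rewrite mxE /sum3 mulr_sumr.
  rewrite [RHS]exchange_big; apply: eq_bigr => c _.
  under [RHS]eq_bigr do rewrite mulr_sumr.
  rewrite [RHS]exchange_big; apply: eq_bigr => d _.
  under [RHS]eq_bigr do rewrite mulr_sumr.
  rewrite [RHS]exchange_big; apply: eq_bigr => e _; apply: eq_bigr => p _; ring.
transitivity (\sum_a sum3 (t a) + \sum_a sum3 (fun b c d => t b a c d)
   + \sum_a sum3 (fun b c d => t c a b d) + \sum_a sum3 (fun b c d => t d a b c)).
  rewrite -!big_split; apply: eq_bigr => a _ /=; rewrite -!sum3D.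
  apply: eq_sum3 => b c d; rewrite /gl_act /t mulr_suml -!big_split.
  apply: eq_bigr => p _ /=.
  rewrite (P12 p a) (P23 a p b) (P12 p a) (P34 a b p) (P23 a p b) (P12 p a).
  by rewrite (a12 a b) (a12 a c) (a23 a b c) (a12 a d) (a23 a b d) (a34 a b c); ring.
rewrite -t_eq.
have -> : \sum_a sum3 (fun b c d => t b a c d) = \sum_a sum3 (t a).
  by rewrite /sum3 [RHS]exchange_big.
have -> : \sum_a sum3 (fun b c d => t c a b d) = \sum_a sum3 (t a).
  rewrite /sum3 [RHS]exchange_big; apply: eq_bigr => a _; exact: exchange_big.
have -> : \sum_a sum3 (fun b c d => t d a b c) = \sum_a sum3 (t a).
  rewrite /sum3 [RHS]exchange_big; apply: eq_bigr => a _.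
  rewrite [RHS]exchange_big; apply: eq_bigr => b _; exact: exchange_big.
ring.
Qed.

End Contractions.

(** * Pullback of tensors *)

Section Pullback.
Context (R : realType).
Implicit Types (u v g : 'M[R]_8) (s : tensor4 R).

(** The pullback is split into four one-slot actions. Actions on different slots commute and those
    on the same slot compose, so identities between partially transformed tensors reduce to matrix
    identities. *)
Definition mode1 u s : tensor4 R := fun a b c d => \sum_p u a p * s p b c d.
Definition mode2 u s : tensor4 R := fun a b c d => \sum_p u b p * s a p c d.
Definition mode3 u s : tensor4 R := fun a b c d => \sum_p u c p * s a b p d.
Definition mode4 u s : tensor4 R := fun a b c d => \sum_p u d p * s a b c p.

Lemma sum_adjoint (x y : 'I_8 -> R) u : \sum_d (\sum_p u d p * x p) * y d =
  \sum_p x p * (\sum_d u^T p d * y d).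
Proof.
under eq_bigr do rewrite mulr_suml; rewrite exchange_big; apply: eq_bigr => p _.
by rewrite mulr_sumr; apply: eq_bigr => d _; rewrite mxE; ring.
Qed.

Let act_mul (u v : 'M[R]_8) (F : 'I_8 -> R) a :
  \sum_p u a p * (\sum_q v p q * F q) = \sum_q (u *m v) a q * F q.
Proof.
under eq_bigr do rewrite mulr_sumr; rewrite exchange_big; apply: eq_bigr => q _.
by rewrite mxE mulr_suml; apply: eq_bigr => p _; rewrite mulrA.
Qed.

Let act_comm (u v : 'M[R]_8) (F : 'I_8 -> 'I_8 -> R) a b :
  \sum_p u a p * (\sum_q v b q * F p q) = \sum_q v b q * (\sum_p u a p * F p q).
Proof.
under eq_bigr do rewrite mulr_sumr; rewrite exchange_big; apply: eq_bigr => q _.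
by rewrite mulr_sumr; apply: eq_bigr => p _; rewrite mulrCA.
Qed.

Let act_id (F : 'I_8 -> R) a : \sum_p (1%:M : 'M[R]_8) a p * F p = F a.
Proof.
rewrite -[RHS](sum_delta_r a F); apply: eq_bigr => p _.
by rewrite mxE.
Qed.

Lemma mode11 u v s : mode1 u (mode1 v s) = mode1 (u *m v) s.
Proof. by apply: tensor4P => *; apply: act_mul. Qed.
Lemma mode22 u v s : mode2 u (mode2 v s) = mode2 (u *m v) s.
Proof. by apply: tensor4P => *; apply: act_mul. Qed.
Lemma mode33 u v s : mode3 u (mode3 v s) = mode3 (u *m v) s.
Proof. by apply: tensor4P => *; apply: act_mul. Qed.
Lemma mode44 u v s : mode4 u (mode4 v s) = mode4 (u *m v) s.
Proof. by apply: tensor4P => *; apply: act_mul. Qed.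

Lemma mode21 u v s : mode2 u (mode1 v s) = mode1 v (mode2 u s).
Proof. by apply: tensor4P => a b c d; apply: (act_comm u v (fun p q => s q p c d)). Qed.
Lemma mode31 u v s : mode3 u (mode1 v s) = mode1 v (mode3 u s).
Proof. by apply: tensor4P => a b c d; apply: (act_comm u v (fun p q => s q b p d)). Qed.
Lemma mode41 u v s : mode4 u (mode1 v s) = mode1 v (mode4 u s).
Proof. by apply: tensor4P => a b c d; apply: (act_comm u v (fun p q => s q b c p)). Qed.
Lemma mode32 u v s : mode3 u (mode2 v s) = mode2 v (mode3 u s).
Proof. by apply: tensor4P => a b c d; apply: (act_comm u v (fun p q => s a q p d)). Qed.
Lemma mode42 u v s : mode4 u (mode2 v s) = mode2 v (mode4 u s).
Proof. by apply: tensor4P => a b c d; apply: (act_comm u v (fun p q => s a q c p)). Qed.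
Lemma mode43 u v s : mode4 u (mode3 v s) = mode3 v (mode4 u s).
Proof. by apply: tensor4P => a b c d; apply: (act_comm u v (fun p q => s a b q p)). Qed.

Lemma mode1_id s : mode1 1%:M s = s.
Proof. by apply: tensor4P => a b c d; apply: (act_id (fun p => s p b c d)). Qed.
Lemma mode2_id s : mode2 1%:M s = s.
Proof. by apply: tensor4P => a b c d; apply: (act_id (fun p => s a p c d)). Qed.
Lemma mode3_id s : mode3 1%:M s = s.
Proof. by apply: tensor4P => a b c d; apply: (act_id (fun p => s a b p d)). Qed.
Lemma mode4_id s : mode4 1%:M s = s.
Proof. by apply: tensor4P => a b c d; apply: (act_id (fun p => s a b c p)). Qed.

Lemma pullback4E g s :
  pullback4 g s = mode1 g^T (mode2 g^T (mode3 g^T (mode4 g^T s))).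
Proof.
apply: tensor4P => a b c d; rewrite /pullback4 /mode1.
apply: eq_bigr => i _; rewrite /mode2 mxE mulr_sumr; apply: eq_bigr => j _.
rewrite /mode3 mxE !mulr_sumr; apply: eq_bigr => k _.
rewrite /mode4 mxE !mulr_sumr; apply: eq_bigr => l _; rewrite mxE; ring.
Qed.

Lemma pullback4M g h s : pullback4 g (pullback4 h s) = pullback4 (h *m g) s.
Proof.
rewrite !pullback4E trmx_mul !(mode21, mode31, mode41, mode32, mode42, mode43).
by rewrite !(mode11, mode22, mode33, mode44, mode21, mode31, mode41, mode32, mode42, mode43).
Qed.

Lemma pullback4_id s : pullback4 1%:M s = s.
Proof. by rewrite pullback4E trmx1 mode4_id mode3_id mode2_id mode1_id. Qed.

Lemma gl_actE u s a b c d : gl_act u s a b c d =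
  mode1 u s a b c d + mode2 u s a b c d + mode3 u s a b c d + mode4 u s a b c d.
Proof. by rewrite /gl_act !big_split. Qed.

Lemma pullback4D g s t a b c d :
  pullback4 g (fun a b c d => s a b c d + t a b c d) a b c d =
  pullback4 g s a b c d + pullback4 g t a b c d.
Proof.
rewrite /pullback4 -big_split; apply: eq_bigr => i _; rewrite -big_split.
apply: eq_bigr => j _; rewrite -big_split; apply: eq_bigr => k _; rewrite -big_split.
by apply: eq_bigr => l _; rewrite /= mulrDr.
Qed.

Lemma pullback4Z g x s a b c d :
  pullback4 g (fun a b c d => x * s a b c d) a b c d = x * pullback4 g s a b c d.
Proof.
rewrite /pullback4 mulr_sumr; apply: eq_bigr => i _; rewrite mulr_sumr.
apply: eq_bigr => j _; rewrite mulr_sumr; apply: eq_bigr => k _; rewrite mulr_sumr.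
by apply: eq_bigr => l _; rewrite /= mulrCA.
Qed.

Lemma gl_act_pullback g u v s : u *m g^T = g^T *m v ->
  gl_act u (pullback4 g s) = pullback4 g (gl_act v s).
Proof.
move=> uv; apply: tensor4P => a b c d.
transitivity (pullback4 g (mode1 v s) a b c d + pullback4 g (mode2 v s) a b c d
  + pullback4 g (mode3 v s) a b c d + pullback4 g (mode4 v s) a b c d).
  rewrite gl_actE !pullback4E !(mode21, mode31, mode41, mode32, mode42, mode43).
  by rewrite !(mode11, mode22, mode33, mode44, mode21, mode31, mode41, mode32, mode42, mode43) uv.
by rewrite -!pullback4D; congr (pullback4 g _ a b c d); apply: tensor4P => *; rewrite gl_actE.
Qed.

Lemma pullback4_swap12 g s a b c d :
  pullback4 g (fun a b c d => s b a c d) a b c d = pullback4 g s b a c d.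
Proof.
rewrite /pullback4 exchange_big; apply: eq_bigr => i _; apply: eq_bigr => j _.
by apply: eq_bigr => k _; apply: eq_bigr => l _; ring.
Qed.

Lemma pullback4_swap23 g s a b c d :
  pullback4 g (fun a b c d => s a c b d) a b c d = pullback4 g s a c b d.
Proof.
rewrite /pullback4; apply: eq_bigr => i _; rewrite exchange_big.
by apply: eq_bigr => j _; apply: eq_bigr => k _; apply: eq_bigr => l _; ring.
Qed.

Lemma pullback4_swap34 g s a b c d :
  pullback4 g (fun a b c d => s a b d c) a b c d = pullback4 g s a b d c.
Proof.
rewrite /pullback4; apply: eq_bigr => i _; apply: eq_bigr => j _; rewrite exchange_big.
by apply: eq_bigr => k _; apply: eq_bigr => l _; ring.
Qed.

Lemma pullback4_alternating g s : alternating4 s -> alternating4 (pullback4 g s).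
Proof.
have N t : alternating4 t -> forall a b c d, - pullback4 g t a b c d =
    pullback4 g (fun a b c d => - t a b c d) a b c d.
  move=> _ a b c d; rewrite -mulN1r -pullback4Z; congr (pullback4 g _ a b c d).
  by apply: tensor4P => *; rewrite mulN1r.
move=> alt a b c d; rewrite N//; split.
- by rewrite -pullback4_swap12; congr (pullback4 g _ a b c d); apply: tensor4P => x y z t; case: (alt x y z t).
- by rewrite -pullback4_swap23; congr (pullback4 g _ a b c d); apply: tensor4P => x y z t; case: (alt x y z t).
- by rewrite -pullback4_swap34; congr (pullback4 g _ a b c d); apply: tensor4P => x y z t; case: (alt x y z t).
Qed.

(** With two slots frozen, contractions through the inverse metric become traces of matrix
    products. *)
Definition slice s i j : 'M[R]_8 := \matrix_(p, q) s i j p q.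

Lemma cayley_up_contract (Phi : tensor4 R) (eta m : 'M[R]_8) i j :
  \sum_p \sum_q cayley_up Phi eta i j p q * m p q =
  \tr ((slice Phi i j)^T *m invmx eta *m m *m (invmx eta)^T).
Proof.
set e := invmx eta.
transitivity (\sum_p \sum_q ((e^T *m slice Phi i j *m e) p q * m p q)).
  apply: eq_bigr => p _; apply: eq_bigr => q _; congr (_ * _).
  rewrite /cayley_up -/e mxE exchange_big; apply: eq_bigr => s _.
  rewrite mxE mulr_suml; apply: eq_bigr => r _; rewrite !mxE; ring.
rewrite -[LHS]/(\sum_p \sum_q _) exchange_big.
rewrite -mulmxA mxtrace_mulC -!mulmxA /mxtrace.
rewrite (_ : e^T *m ((slice Phi i j)^T *m (e *m m)) = (e^T *m slice Phi i j *m e)^T *m m).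
  apply: eq_bigr => q _; rewrite mxE; by apply: eq_bigr => p _; rewrite [in RHS]mxE mulmxA.
by rewrite !trmx_mul trmxK !mulmxA.
Qed.

Lemma slice_pullback g s a b : slice (pullback4 g s) a b =
  \sum_i \sum_j (g i a * g j b) *: (g^T *m slice s i j *m g).
Proof.
apply/matrixP => c d; rewrite mxE /pullback4 summxE; apply: eq_bigr => i _.
rewrite summxE; apply: eq_bigr => j _; rewrite !mxE mulr_sumr exchange_big.
apply: eq_bigr => l _; rewrite !mxE !mulr_suml mulr_sumr; apply: eq_bigr => k _.
by rewrite !mxE; ring.
Qed.

End Pullback.

(** * Naturality of the operators and of the parametrisation under a change of frame *)

Section Perturbations.
Context (R : realType).
Implicit Types (u v g eta : 'M[R]_8) (s Phi : tensor4 R).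

Definition metric_contraction Phi eta s : tensor4 R := fun i j k l =>
  \sum_p \sum_q cayley_up Phi eta i j p q * s k l p q.

Lemma J4_alternating Phi eta s a b c d : alternating4 Phi -> alternating4 s ->
  let t := metric_contraction Phi eta s in
  2 * J4 Phi eta s a b c d =
  t a b c d + t c d a b - t a c b d - t b d a c + t a d b c + t b c a d.
Proof.
move=> altP alts t; rewrite /J4.
have -> : 2 * alt4 (fun i j k l => 3 * t i j k l) a b c d = 6 * alt4 t a b c d.
  by rewrite alt4Z; ring.
apply: alt4_22 => x y z w; rewrite -sumrN; apply: eq_bigr => p _; rewrite -sumrN;
    apply: eq_bigr => q _.
  rewrite -mulNr; congr (_ * _); rewrite -sumrN; apply: eq_bigr => i _; rewrite -sumrN.
  by apply: eq_bigr => j _; case: (altP x y i j) => -> _ _; rewrite !mulNr.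
by case: (alts z w p q) => -> _ _; rewrite mulrN.
Qed.

Lemma metric_contractionE Phi eta s i j k l : metric_contraction Phi eta s i j k l =
  \tr ((slice Phi i j)^T *m invmx eta *m slice s k l *m (invmx eta)^T).
Proof.
by rewrite -cayley_up_contract; apply: eq_bigr => p _; apply: eq_bigr => q _; rewrite mxE.
Qed.

Lemma cayley_up1 Phi a b p q : cayley_up Phi 1%:M a b p q = Phi a b p q.
Proof.
rewrite /cayley_up invmx1 -[RHS](sum_delta p (fun r => Phi a b r q)).
apply: eq_bigr => r _; rewrite -(sum_delta q (fun s : 'I_8 => Phi a b r s)) mulr_sumr.
by apply: eq_bigr => z _; rewrite !mxE /delta; ring.
Qed.

Lemma invmx_gram g : g \in unitmx -> invmx (g^T *m g) = invmx g *m (invmx g)^T.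
Proof.
move=> gu; rewrite -[RHS]mul1mx -[in RHS](@mulVmx _ _ (g^T *m g)); last first.
  by rewrite unitmx_mul unitmx_tr gu.
rewrite -!mulmxA (mulmxA g (invmx g)) mulmxV// mul1mx -trmx_mul mulVmx//.
by rewrite trmx1 mulmx1.
Qed.

(** Since [e] is the product of the inverse of [g] with its transpose, cyclicity of the trace brings
    each [g] next to an inverse. This is how raised indices disappear in an orthonormal frame. *)
Lemma metric_trace_pullback g (A S : 'M[R]_8) (e := invmx (g^T *m g)) : g \in unitmx ->
  \tr ((g^T *m A *m g)^T *m e *m (g^T *m S *m g) *m e^T) = \tr (A^T *m S).
Proof.
move=> gu; rewrite /e invmx_gram// !trmx_mul !trmxK; set G := invmx g.
have gG : g *m G = 1%:M by exact: mulmxV.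
have Gg : G^T *m g^T = 1%:M by rewrite -trmx_mul gG trmx1.
rewrite -!mulmxA mxtrace_mulC -!mulmxA Gg mulmx1 gG mulmx1.
by rewrite (mulmxA G^T) Gg mul1mx (mulmxA g) gG mul1mx.
Qed.

Lemma metric_contraction_pullback g Phi s : g \in unitmx ->
  metric_contraction (pullback4 g Phi) (g^T *m g) (pullback4 g s) =
  pullback4 g (metric_contraction Phi 1%:M s).
Proof.
move=> gu; apply: tensor4P => a b c d; rewrite metric_contractionE (slice_pullback _ Phi).
set e := invmx _; rewrite raddf_sum !mulmx_suml raddf_sum/=; apply: eq_bigr => i _.
rewrite raddf_sum !mulmx_suml raddf_sum/=; apply: eq_bigr => j _.
rewrite slice_pullback mulmx_sumr !mulmx_suml raddf_sum/=; apply: eq_bigr => k _.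
rewrite mulmx_sumr !mulmx_suml raddf_sum/=; apply: eq_bigr => l _.
rewrite [(_ *: _)^T]linearZ/= -!scalemxAl -scalemxAr -!scalemxAl !mxtraceZ metric_trace_pullback//.
by rewrite metric_contractionE invmx1 trmx1 !mulmx1; ring.
Qed.

Lemma J4_pullback g Phi s : g \in unitmx -> alternating4 Phi -> alternating4 s ->
  J4 (pullback4 g Phi) (g^T *m g) (pullback4 g s) = pullback4 g (J4 Phi 1%:M s).
Proof.
move=> gu altP alts; apply: tensor4P => a b c d; 
have two (x y : R) : 2 * x = 2 * y -> x = y by move=> ?; lra.
apply: two.
rewrite J4_alternating; [|exact: pullback4_alternating..].
rewrite metric_contraction_pullback//; set t := metric_contraction Phi _ s.
(* Pullback is known to commute with adjacent swaps, so the six shuffles of [J4_alternating] are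
   generated one swap at a time. *)
pose t1 : tensor4 R := fun a b c d => t a c b d.
pose t2 : tensor4 R := fun a b c d => t1 a b d c.
pose t3 : tensor4 R := fun a b c d => t1 b a c d.
pose t4 : tensor4 R := fun a b c d => t3 a b d c.
pose t5 : tensor4 R := fun a b c d => t4 a c b d.
rewrite -pullback4Z.
transitivity (pullback4 g t a b c d + pullback4 g t5 a b c d
  + - 1 * pullback4 g t1 a b c d + - 1 * pullback4 g t4 a b c d
  + pullback4 g t2 a b c d + pullback4 g t3 a b c d).
  have e1 x y z w : pullback4 g t1 x y z w = pullback4 g t x z y w by exact: pullback4_swap23.
  have e2 x y z w : pullback4 g t2 x y z w = pullback4 g t x w y z.
    by rewrite -e1; exact: pullback4_swap34.
  have e3 x y z w : pullback4 g t3 x y z w = pullback4 g t y z x w.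
    by rewrite -e1; exact: pullback4_swap12.
  have e4 x y z w : pullback4 g t4 x y z w = pullback4 g t y w x z.
    by rewrite -e3; exact: pullback4_swap34.
  have e5 x y z w : pullback4 g t5 x y z w = pullback4 g t z w x y.
    by rewrite -e4; exact: pullback4_swap23.
  by rewrite e1 e2 e3 e4 e5; ring.
rewrite -!pullback4Z -!pullback4D; congr (pullback4 g _ a b c d).
by apply: tensor4P => x y z w; rewrite J4_alternating// /t5 /t4 /t3 /t2 /t1 -/t; ring.
Qed.

Lemma J4_eigen_pullback g Phi m s : g \in unitmx -> alternating4 Phi ->
  J4_eigen Phi 1%:M m s -> J4_eigen (pullback4 g Phi) (g^T *m g) m (pullback4 g s).
Proof.
move=> gu altP [alts hs]; split; first exact: pullback4_alternating.
move=> a b c d; rewrite J4_pullback// -pullback4Z; congr (pullback4 g _ a b c d).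
exact: tensor4P.
Qed.

Lemma J2E Phi eta beta i j : J2 Phi eta beta i j =
  2^-1 * \tr ((slice Phi i j)^T *m invmx eta *m beta *m (invmx eta)^T).
Proof. by rewrite mxE cayley_up_contract. Qed.

Lemma J2_pullback g Phi beta : g \in unitmx ->
  J2 (pullback4 g Phi) (g^T *m g) (g^T *m beta *m g) = g^T *m J2 Phi 1%:M beta *m g.
Proof.
move=> gu; apply/matrixP => a b; rewrite J2E slice_pullback.
rewrite !(raddf_sum, mulmx_suml)/= mulr_sumr mxE.
under [RHS]eq_bigr do rewrite mxE mulr_suml.
rewrite [RHS]exchange_big; apply: eq_bigr => i _.
rewrite !(raddf_sum, mulmx_suml)/= mulr_sumr; apply: eq_bigr => j _.
rewrite [(_ *: _)^T]linearZ/= -!scalemxAl mxtraceZ metric_trace_pullback//.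
by rewrite J2E invmx1 trmx1 !mulmx1 mxE; ring.
Qed.

Lemma Lambda2_7_pullback g Phi beta : g \in unitmx -> Lambda2_7 Phi 1%:M beta ->
  Lambda2_7 (pullback4 g Phi) (g^T *m g) (g^T *m beta *m g).
Proof.
move=> gu [b1 b2]; split; first by rewrite !trmx_mul trmxK b1 mulNmx mulmxN mulmxA.
by rewrite J2_pullback// b2 -scalemxAr -scalemxAl.
Qed.

(** The integrand alternates in its last three slots, so 4 cancels the weight of the
    antisymmetrisation; the minus sign is that of moving [p] from the last slot of [Phi] to the
    first. *)
Lemma perturbationE Phi eta h xi : alternating4 Phi ->
  perturbation Phi eta h xi = gl_act ((h + 4^-1 *: xi) *m invmx eta) Phi.
Proof.
move=> alt; set u := _ *m _.
have a12 x y z t : Phi y x z t = - Phi x y z t by case: (alt x y z t).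
have a23 x y z t : Phi x z y t = - Phi x y z t by case: (alt x y z t).
have a34 x y z t : Phi x y t z = - Phi x y z t by case: (alt x y z t).
pose t : tensor4 R := fun a b c d => \sum_p u a p * Phi b c d p.
have -> : perturbation Phi eta h xi = fun a b c d => - 4 * alt4 t a b c d.
  apply: tensor4P => a b c d; rewrite /perturbation; congr (_ * alt4 _ a b c d).
  apply: tensor4P => x y z w; apply: eq_bigr => p _; congr (_ * _).
  by rewrite mxE; apply: eq_bigr => q _; rewrite !mxE.
apply: tensor4P => a b c d; rewrite mulNr alt4_31; last 2 first.
- by move=> x y z w; rewrite /t -sumrN; apply: eq_bigr => p _; rewrite a12; ring.
- by move=> x y z w; rewrite /t -sumrN; apply: eq_bigr => p _; rewrite a23; ring.
rewrite !opprD !opprK -!sumrN /gl_act !big_split/=; congr (_ + _ + _ + _);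
  rewrite -?sumrN; apply: eq_bigr => p _.
- by rewrite (a34 b c p) (a23 b p) (a12 p b); ring.
- by rewrite (a34 a c p) (a23 a p); ring.
- by rewrite (a34 a b p); ring.
Qed.

Lemma perturbation_pullback g Phi h xi : g \in unitmx -> alternating4 Phi ->
  perturbation (pullback4 g Phi) (g^T *m g) (g^T *m h *m g) (g^T *m xi *m g) =
  pullback4 g (perturbation Phi 1%:M h xi).
Proof.
move=> gu alt; rewrite !perturbationE//; last exact: pullback4_alternating.
apply: gl_act_pullback; rewrite invmx_gram// invmx1 mulmx1.
rewrite scalemxAl scalemxAr -mulmxDl -mulmxDr -!mulmxA -trmx_mul mulmxV// trmx1 mulmx1.
by rewrite mulmxV// mulmx1.
Qed.

End Perturbations.

(** * Parametrisation of the perturbations *)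

Arguments cayley0 : simpl never.
Arguments cayley_sign : simpl never.

Section Parametrisation.
Context (R : realType).
Local Notation Phi0 := (cayley0 R).
Local Notation T := (triple_contraction Phi0).
Let altP := cayley0_alternating R.
Let ctrP := @cayley0_contraction1 R.
Implicit Types (u v h xi g : 'M[R]_8) (s : tensor4 R).

Lemma gl_actD u v s : gl_act (u + v) s =
  fun a b c d => gl_act u s a b c d + gl_act v s a b c d.
Proof.
apply: tensor4P => a b c d; rewrite /gl_act -big_split; apply: eq_bigr => p _ /=.
by rewrite !mxE; ring.
Qed.

Lemma gl_actZ x u s : gl_act (x *: u) s = fun a b c d => x * gl_act u s a b c d.
Proof.
apply: tensor4P => a b c d; rewrite /gl_act mulr_sumr; apply: eq_bigr => p _ /=.
by rewrite !mxE; ring.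
Qed.

Lemma metric_contraction1 s : metric_contraction Phi0 1%:M s = pair_contraction Phi0 s.
Proof.
apply: tensor4P => a b c d; apply: eq_bigr => p _; apply: eq_bigr => q _.
by rewrite cayley_up1.
Qed.

(** The six pair contractions in [gl_act_triple_contraction] are exactly those of [2 * J4]. All
    knowledge of the spectrum of [J4] comes from this relation. *)
Lemma J4_cayley0 s a b c d : alternating4 s ->
  12 * J4 Phi0 1%:M s a b c d = 24 * s a b c d - gl_act (T s) Phi0 a b c d.
Proof.
move=> alt; rewrite gl_act_triple_contraction//.
have := @J4_alternating R Phi0 1%:M s a b c d altP alt.
rewrite /= metric_contraction1 => e.
rewrite (_ : 12 * _ = 6 * (2 * J4 Phi0 1%:M s a b c d)); last by ring.
by rewrite e; ring.
Qed.

Lemma J2_cayley0 u : J2 Phi0 1%:M u = 2^-1 *: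
  \matrix_(a, b) \sum_p \sum_q Phi0 a b p q * u p q.
Proof.
apply/matrixP => a b; rewrite !mxE; congr (_ * _); apply: eq_bigr => p _.
by apply: eq_bigr => q _; rewrite cayley_up1.
Qed.

Lemma triple_contraction_cayley0 u :
  T (gl_act u Phi0) = 24 *: u + (18 * \tr u)%:M - 24 *: J2 Phi0 1%:M u.
Proof.
rewrite triple_contraction_gl_act// J2_cayley0 scalerA; congr (_ - _ *: _).
by lra.
Qed.

Lemma J2_skew u : (J2 Phi0 1%:M u)^T = - J2 Phi0 1%:M u.
Proof.
rewrite J2_cayley0; apply/matrixP => a b; rewrite !mxE -mulrN; congr (_ * _).
rewrite -sumrN; apply: eq_bigr => p _; rewrite -sumrN; apply: eq_bigr => q _.
by case: (altP a b p q) => -> _ _; rewrite mulNr.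
Qed.

Lemma J2_sym u : u^T = u -> J2 Phi0 1%:M u = 0.
Proof.
move=> us; rewrite J2_cayley0; apply/matrixP => a b; rewrite !mxE.
set x := \sum_p _; suff: x = - x by move=> ?; lra.
rewrite {1}/x exchange_big -sumrN; apply: eq_bigr => p _; rewrite -sumrN.
by apply: eq_bigr => q _; case: (altP a b p q) => _ _ ->; rewrite -[in LHS]us mxE mulNr.
Qed.

Lemma J2_is_linear x u v : J2 Phi0 1%:M (x *: u + v) = x *: J2 Phi0 1%:M u + J2 Phi0 1%:M v.
Proof.
rewrite !J2_cayley0; apply/matrixP => a b; rewrite !mxE mulrCA -mulrDr; congr (_ * _).
rewrite mulr_sumr -big_split; apply: eq_bigr => p _.
rewrite mulr_sumr -big_split; apply: eq_bigr => q _ /=.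
by rewrite !mxE; ring.
Qed.

(** On skew matrices [(J - 1) (J + 3) = 0], by the two-index contraction of the Cayley form. The
    eigenvalue -3 gives [Lambda2_7] and the eigenvalue 1 gives the Lie algebra of Spin(7). *)
Lemma J2_J2 u : u^T = - u ->
  J2 Phi0 1%:M (J2 Phi0 1%:M u) = 3 *: u - 2 *: J2 Phi0 1%:M u.
Proof.
move=> us; have u' p q : u q p = - u p q by rewrite -[u in LHS]trmxK us !mxE.
rewrite J2_cayley0 J2_cayley0; apply/matrixP => i j; rewrite !mxE.
transitivity (2^-1 * \sum_c \sum_d 2^-1 *
   ((6 * (delta R i c * delta R j d - delta R i d * delta R j c) - 4 * Phi0 i j c d) * u c d)).
  congr (_ * _); transitivity
     (\sum_a \sum_b \sum_c \sum_d 2^-1 * (Phi0 i j a b * Phi0 c d a b) * u c d).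
    apply: eq_bigr => a _; apply: eq_bigr => b _; rewrite !mxE !mulr_sumr.
    apply: eq_bigr => c _; rewrite !mulr_sumr; apply: eq_bigr => d _.
    have -> : Phi0 a b c d = Phi0 c d a b.
      have P12 x y z w : Phi0 y x z w = - Phi0 x y z w by case: (altP x y z w).
      have P23 x y z w : Phi0 x z y w = - Phi0 x y z w by case: (altP x y z w).
      have P34 x y z w : Phi0 x y w z = - Phi0 x y z w by case: (altP x y z w).
      by rewrite (P23 a c) (P12 c a) (P34 c a d) (P23 c d a); ring.
    by ring.
  under eq_bigr do rewrite exchange_big.
  rewrite exchange_big; apply: eq_bigr => c _.
  under eq_bigr do rewrite exchange_big.
  rewrite exchange_big; apply: eq_bigr => d _.
  rewrite -(contraction2 altP ctrP) mulr_suml mulr_sumr; apply: eq_bigr => a _.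
  by rewrite mulr_suml mulr_sumr; apply: eq_bigr => b _; ring.
have -> : \sum_c \sum_d 2^-1 * ((6 * (delta R i c * delta R j d - delta R i d * delta R j c)
    - 4 * Phi0 i j c d) * u c d) = 3 * u i j - 3 * u j i - 2 * \sum_c \sum_d Phi0 i j c d * u c d.
  transitivity (\sum_c (3 * (delta R c i * u c j) - 3 * (delta R c j * u c i)
        - 2 * \sum_d Phi0 i j c d * u c d)).
    apply: eq_bigr => c _.
    rewrite -(sum_delta j (fun d => delta R c i * u c d)).
    rewrite -(sum_delta i (fun d => delta R c j * u c d)) !mulr_sumr -!sumrB.
    apply: eq_bigr => d _; rewrite (deltaC R i c) (deltaC R j c) (deltaC R i d) (deltaC R j d).
    by field.
  by rewrite !sumrB -!mulr_sumr !sum_delta.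
by rewrite (u' i j); field.
Qed.

(** By the adjunction [gl_act_dot] the squared norm of [gl_act u Phi0] pairs [u] with its triple
    contraction, so it vanishes; a vanishing sum of squares has vanishing terms. *)
Lemma gl_act_eq0 u : T (gl_act u Phi0) = 0 -> forall a b c d, gl_act u Phi0 a b c d = 0.
Proof.
move=> Tu; set s := gl_act u Phi0 in Tu *.
have s_alt : alternating4 s by exact: gl_act_alternating.
have := gl_act_dot altP u s_alt; rewrite Tu.
under [X in _ = _ * X]eq_bigr do under eq_bigr do rewrite mxE mulr0.
rewrite [X in _ = _ * X]big1 ?mulr0; last by move=> *; rewrite big1.
rewrite -/s /sum3 => e a b c d.
have pos x y z w : 0 <= s x y z w * s x y z w by rewrite -expr2 sqr_ge0.
have p1 x y z : 0 <= \sum_w s x y z w * s x y z w by apply: sumr_ge0.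
have p2 x y : 0 <= \sum_z \sum_w s x y z w * s x y z w by apply: sumr_ge0.
have p3 x : 0 <= \sum_y \sum_z \sum_w s x y z w * s x y z w by apply: sumr_ge0.
move/eqP: e; rewrite psumr_eq0// => /allP/(_ a); rewrite mem_index_enum => /(_ isT)/=.
rewrite psumr_eq0// => /allP/(_ b); rewrite mem_index_enum => /(_ isT)/=.
rewrite psumr_eq0// => /allP/(_ c); rewrite mem_index_enum => /(_ isT)/=.
rewrite psumr_eq0// => /allP/(_ d); rewrite mem_index_enum => /(_ isT)/=.
by rewrite mulf_eq0 orbb => /eqP.
Qed.

Lemma J20 : J2 Phi0 1%:M 0 = 0.
Proof. by apply: J2_sym; rewrite trmx0. Qed.

Lemma J2Z x u : J2 Phi0 1%:M (x *: u) = x *: J2 Phi0 1%:M u.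
Proof. by rewrite -[x *: u]addr0 J2_is_linear J20 addr0. Qed.

Lemma J2D u v : J2 Phi0 1%:M (u + v) = J2 Phi0 1%:M u + J2 Phi0 1%:M v.
Proof. by rewrite -[u]scale1r J2_is_linear !scale1r. Qed.

Lemma J2N u : J2 Phi0 1%:M (- u) = - J2 Phi0 1%:M u.
Proof. by rewrite -scaleN1r J2Z scaleN1r. Qed.

(** The projector [(1 - J) / 4] is 1 on the eigenvalue -3 and 0 on the eigenvalue 1. *)
Definition Lambda2_7_part u : 'M[R]_8 := 4^-1 *: (u - J2 Phi0 1%:M u).

Lemma Lambda2_7_partP u : u^T = - u -> Lambda2_7 Phi0 1%:M (Lambda2_7_part u).
Proof.
move=> us; split; first by rewrite linearZ/= linearB/= us J2_skew -opprD scalerN.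
rewrite /Lambda2_7_part J2Z J2D J2N J2_J2//; move: (J2 _ _ u) => w.
by apply/matrixP => i j; rewrite !mxE; field.
Qed.

(** The complementary part [v] satisfies [J v = v] and has trace 0, so the terms [24 v] and
    [-24 J v] of its triple contraction cancel: [v] annihilates the form. *)
Lemma gl_act_Lambda2_7_part u : u^T = - u ->
  gl_act u Phi0 = gl_act (Lambda2_7_part u) Phi0.
Proof.
move=> us; pose v := u - Lambda2_7_part u.
have Jv : J2 Phi0 1%:M v = v.
  rewrite /v /Lambda2_7_part J2D J2N J2Z J2D J2N J2_J2//; move: (J2 _ _ u) => w.
  by apply/matrixP => i j; rewrite !mxE; field.
have vs : v^T = - v by rewrite -Jv J2_skew.
have v0 a b c d : gl_act v Phi0 a b c d = 0.
  apply: gl_act_eq0; rewrite triple_contraction_cayley0 Jv addrAC subrr add0r.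
  suff -> : \tr v = 0 by rewrite mulr0 raddf0.
  have := congr1 mxtrace vs; rewrite mxtrace_tr linearN/= => ?; lra.
rewrite -[u in LHS](subrK (Lambda2_7_part u)) -/v gl_actD.
by apply: tensor4P => a b c d; rewrite v0 add0r.
Qed.

Lemma perturbation_cayley0 h xi :
  perturbation Phi0 1%:M h xi = gl_act (h + 4^-1 *: xi) Phi0.
Proof. by rewrite perturbationE// invmx1 mulmx1. Qed.

(** [J4_cayley0] reads [gl_act (T s) Phi0 = 12 (2 - m) s] on an eigenvector, so every eigenvalue
    other than 2 lies in the image of the derivation. *)
Lemma eigen_perturbation m s : J4_eigen Phi0 1%:M m s -> m != 2 ->
  exists u, s = gl_act u Phi0.
Proof.
move=> [alt es] m2; exists ((12 * (2 - m))^-1 *: T s); rewrite gl_actZ.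
apply: tensor4P => a b c d; have := J4_cayley0 a b c d alt; rewrite es => e.
have -> : gl_act (T s) Phi0 a b c d = 12 * (2 - m) * s a b c d by lra.
by rewrite mulKf// mulf_neq0// ?pnatr_eq0// subr_eq0 eq_sym.
Qed.

Lemma gl_act_perturbation u : exists h xi,
  [/\ h^T = h, Lambda2_7 Phi0 1%:M xi & gl_act u Phi0 = perturbation Phi0 1%:M h xi].
Proof.
pose h := 2^-1 *: (u + u^T); pose b := 2^-1 *: (u - u^T).
have bs : b^T = - b by rewrite linearZ/= linearB/= trmxK -scalerN opprB.
(* The 4 compensates the 1/4 of the parametrisation. *)
exists h, (4 *: Lambda2_7_part b); split.
- by rewrite linearZ/= linearD/= trmxK addrC.
- have [p1 p2] := Lambda2_7_partP bs; split.
    by rewrite linearZ/= p1 scalerN.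
  by rewrite J2Z p2 !scalerA; congr (_ *: _); ring.
- rewrite perturbation_cayley0 scalerA mulVf ?pnatr_eq0// scale1r.
  rewrite gl_actD -gl_act_Lambda2_7_part// -gl_actD; congr (gl_act _ Phi0).
  by apply/matrixP => i j; rewrite !mxE; field.
Qed.

Lemma perturbation_exists_std s : Lambda4_1_7_35 Phi0 1%:M s ->
  exists h xi, [/\ h^T = h, Lambda2_7 Phi0 1%:M xi & s = perturbation Phi0 1%:M h xi].
Proof.
move=> [s1 [s7 [s35 [e1 e7 e35 se]]]].
have [u1 E1] := eigen_perturbation e1 ltac:(by apply/eqP; lra).
have [u7 E7] := eigen_perturbation e7 ltac:(by apply/eqP; lra).
have [u35 E35] := eigen_perturbation e35 ltac:(by apply/eqP; lra).
have [h [xi [hs xis E]]] := gl_act_perturbation (u1 + u7 + u35).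
exists h, xi; split => //; rewrite -E !gl_actD; apply: tensor4P => a b c d.
by rewrite se E1 E7 E35.
Qed.

Lemma triple_contraction_perturbation h xi : h^T = h -> Lambda2_7 Phi0 1%:M xi ->
  T (perturbation Phi0 1%:M h xi) = 24 *: h + (18 * \tr h)%:M + 24 *: xi.
Proof.
move=> hs [xis xi7]; rewrite perturbation_cayley0 triple_contraction_cayley0.
have tr0 : \tr xi = 0.
  have := congr1 mxtrace xis; rewrite mxtrace_tr linearN/= => ?; lra.
(* On [xi / 4] the operator [24 (1 - J)] is 96 / 4 = 24, because [J] is -3 there. *)
rewrite mxtraceD mxtraceZ tr0 mulr0 addr0 J2D J2Z J2_sym// xi7 add0r.
by apply/matrixP => i j; rewrite !mxE; field.
Qed.

Lemma perturbation_inj_std h xi h' xi' :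
  h^T = h -> Lambda2_7 Phi0 1%:M xi -> h'^T = h' -> Lambda2_7 Phi0 1%:M xi' ->
  perturbation Phi0 1%:M h xi = perturbation Phi0 1%:M h' xi' -> h = h' /\ xi = xi'.
Proof.
move=> hs xis hs' xis' /(congr1 (triple_contraction Phi0)).
rewrite !triple_contraction_perturbation//.
case: xis xis' => [xs _] [xs' _] e.
have es := congr1 trmx e; rewrite !linearD/= !linearZ/= hs hs' xs xs' !tr_scalar_mx in es.
(* Half the sum of the equation and its transpose isolates the symmetric parts. *)
have eh : 24 *: h + (18 * \tr h)%:M = 24 *: h' + (18 * \tr h')%:M.
  apply/matrixP => i j; have := congr1 (fun m : 'M_8 => m i j) e.
  have := congr1 (fun m : 'M_8 => m i j) es; rewrite !mxE => ? ?; lra.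
have ex : xi = xi'.
  apply/matrixP => i j; have := congr1 (fun m : 'M_8 => m i j) e.
  by rewrite eh mxE [RHS]mxE => /addrI; rewrite !mxE => ?; lra.
split=> //.
(* Taking traces multiplies [\tr h] by 24 + 8 * 18 = 168, which is not zero. *)
have tt : \tr h = \tr h'.
  have := congr1 mxtrace eh; rewrite !mxtraceD !mxtraceZ !mxtrace_scalar => ?; lra.
apply/matrixP => i j; have := congr1 (fun m : 'M_8 => m i j) eh.
by rewrite tt !mxE => /addIr ?; lra.
Qed.

Lemma J4_gl_act u : J4 Phi0 1%:M (gl_act u Phi0) = gl_act
  (2 *: u - 12^-1 *: T (gl_act u Phi0)) Phi0.
Proof.
apply: tensor4P => a b c d.
have := J4_cayley0 a b c d (gl_act_alternating u altP).
rewrite gl_actD -scaleNr !gl_actZ => ?; lra.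
Qed.

Lemma perturbation_mem_std h xi : h^T = h -> Lambda2_7 Phi0 1%:M xi ->
  Lambda4_1_7_35 Phi0 1%:M (perturbation Phi0 1%:M h xi).
Proof.
move=> hs xis.
pose h1 : 'M[R]_8 := (8^-1 * \tr h)%:M.
have [xis1 xi7] := xis.
(* By [J4_gl_act] the eigenvalue is 2 minus a twelfth of the factor of the triple contraction: 168
   on multiples of the identity, 96 on [Lambda2_7] and 24 on traceless symmetric matrices give -12,
   -6 and 0. *)
exists (gl_act h1 Phi0), (gl_act (4^-1 *: xi) Phi0), (gl_act (h - h1) Phi0).
have eig m u : 2 *: u - 12^-1 *: T (gl_act u Phi0) = m *: u ->
    J4_eigen Phi0 1%:M m (gl_act u Phi0).
  by move=> e; split; [exact: gl_act_alternating|rewrite J4_gl_act e gl_actZ].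
have tr0 : \tr xi = 0.
  have := congr1 mxtrace xis1; rewrite mxtrace_tr linearN/= => ?; lra.
have trh1 : \tr h1 = \tr h by rewrite mxtrace_scalar -mulr_natl; field.
split.
- apply: eig; rewrite triple_contraction_cayley0 trh1 J2_sym ?tr_scalar_mx//.
  by apply/matrixP => i j; rewrite !mxE; case: (i == j) => /=; rewrite ?mulr1n ?mulr0n; field.
- apply: eig; rewrite triple_contraction_cayley0 mxtraceZ tr0 !mulr0 raddf0 J2Z xi7.
  by apply/matrixP => i j; rewrite !mxE; field.
- apply: eig; rewrite triple_contraction_cayley0 mxtraceD linearN/= trh1 subrr mulr0.
  rewrite raddf0 J2_sym ?linearB/= ?hs ?tr_scalar_mx//.
  by apply/matrixP => i j; rewrite !mxE; field.
move=> a b c d; rewrite perturbation_cayley0.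
rewrite -[gl_act h1 _ a b c d + _]/((fun a b c d => gl_act h1 Phi0 a b c d + gl_act (4^-1 *: xi) Phi0 a b c d) a b c d).
rewrite -gl_actD -[RHS]/((fun a b c d => gl_act (h1 + 4^-1 *: xi) Phi0 a b c d + gl_act (h - h1) Phi0 a b c d) a b c d).
by rewrite -gl_actD; congr (gl_act _ _ a b c d); rewrite addrAC [h1 + _]addrC subrK.
Qed.

End Parametrisation.

(** * Transport between the model frame and an arbitrary one *)

Section Frames.
Context (R : realType) (g : 'M[R]_8) (gu : g \in unitmx).
Local Notation Phi0 := (cayley0 R).
Local Notation Phi := (pullback4 g Phi0).
Local Notation eta := (g^T *m g).
Let altP := cayley0_alternating R.

Definition conjmx8 (u m : 'M[R]_8) : 'M[R]_8 := u^T *m m *m u.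

Lemma conjmx8K m : conjmx8 (invmx g) (conjmx8 g m) = m.
Proof.
rewrite /conjmx8 !mulmxA -trmx_mul mulmxV// trmx1 mul1mx -mulmxA mulmxV//.
by rewrite mulmx1.
Qed.

Lemma conjmx8VK m : conjmx8 g (conjmx8 (invmx g) m) = m.
Proof.
rewrite /conjmx8 !mulmxA -trmx_mul mulVmx// trmx1 mul1mx -mulmxA mulVmx//.
by rewrite mulmx1.
Qed.

Lemma conjmx8_sym u m : m^T = m -> (conjmx8 u m)^T = conjmx8 u m.
Proof. by move=> ms; rewrite /conjmx8 !trmx_mul trmxK ms mulmxA. Qed.

Lemma pullback4K s : pullback4 (invmx g) (pullback4 g s) = s.
Proof. by rewrite pullback4M mulmxV// pullback4_id. Qed.

Lemma pullback4VK s : pullback4 g (pullback4 (invmx g) s) = s.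
Proof. by rewrite pullback4M mulVmx// pullback4_id. Qed.

Lemma J4_eigen_frame m s :
  J4_eigen Phi eta m s -> J4_eigen Phi0 1%:M m (pullback4 (invmx g) s).
Proof.
move=> [alt es]; have alt' := pullback4_alternating (invmx g) alt; split=> //.
have := J4_pullback gu altP alt'; rewrite pullback4VK => e a b c d.
rewrite -[J4 _ _ _]pullback4K -e -pullback4Z; congr (pullback4 _ _ a b c d).
exact: tensor4P.
Qed.

Lemma Lambda2_7_frame b : Lambda2_7 Phi eta (conjmx8 g b) <-> Lambda2_7 Phi0 1%:M b.
Proof.
split=> [[b1 b2]|]; last exact: Lambda2_7_pullback.
split; apply: (can_inj conjmx8K).
  rewrite {2}/conjmx8 mulmxN mulNmx -/(conjmx8 g b) -b1 /conjmx8.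
  by rewrite !trmx_mul trmxK mulmxA.
rewrite -[LHS]J2_pullback// -/(conjmx8 g b) b2 /conjmx8 -scalemxAr -scalemxAl//.
Qed.

Lemma Lambda4_frame s :
  Lambda4_1_7_35 Phi eta s <-> Lambda4_1_7_35 Phi0 1%:M (pullback4 (invmx g) s).
Proof.
split=> -[s1 [s7 [s35 [e1 e7 e35 se]]]].
  exists (pullback4 (invmx g) s1), (pullback4 (invmx g) s7), (pullback4 (invmx g) s35).
  split; [exact: J4_eigen_frame..|] => a b c d.
  by rewrite -!pullback4D; congr (pullback4 _ _ a b c d); exact: tensor4P.
exists (pullback4 g s1), (pullback4 g s7), (pullback4 g s35).
split; [exact: J4_eigen_pullback..|] => a b c d.
rewrite -[s]pullback4VK -!pullback4D; congr (pullback4 _ _ a b c d); exact: tensor4P.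
Qed.

Lemma perturbation_frame h xi : perturbation Phi eta (conjmx8 g h) (conjmx8 g xi) =
  pullback4 g (perturbation Phi0 1%:M h xi).
Proof. exact: perturbation_pullback. Qed.

Lemma Lambda4_perturbation s : Lambda4_1_7_35 Phi eta s <->
  exists! m : 'M[R]_8 * 'M[R]_8,
    [/\ m.1^T = m.1, Lambda2_7 Phi eta m.2 & s = perturbation Phi eta m.1 m.2].
Proof.
split=> [|[[h xi] [[/= hs xis ->] _]]]; last first.
  apply/Lambda4_frame; rewrite -[h]conjmx8VK -[xi]conjmx8VK perturbation_frame pullback4K.
  apply: perturbation_mem_std; first exact: conjmx8_sym.
  by apply/Lambda2_7_frame; rewrite conjmx8VK.
move/Lambda4_frame/perturbation_exists_std => [h [xi [hs xis e]]].
exists (conjmx8 g h, conjmx8 g xi); split.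
  split; [exact: conjmx8_sym|exact/Lambda2_7_frame|].
  by rewrite perturbation_frame -e pullback4VK.
move=> [h' xi'] [/= hs' xis' e'].
have [] := @perturbation_inj_std R h xi (conjmx8 (invmx g) h') (conjmx8 (invmx g) xi') hs xis.
- exact: conjmx8_sym.
- by apply/Lambda2_7_frame; rewrite conjmx8VK.
- by rewrite -e e' -[h' in LHS]conjmx8VK -[xi' in LHS]conjmx8VK perturbation_frame pullback4K.
by move=> -> ->; rewrite !conjmx8VK.
Qed.

End Frames.

(** * The stabiliser is orthogonal *)

(** A Levi-Civita symbol computed by comparisons: the sign of the sorting permutation, or 0 when an
    entry is repeated. It makes determinants of basis vectors computable over [int]. *)
Fixpoint seq_sign (v : seq nat) : int :=
  if v is a :: w then
    foldr (fun b x => (if (a < b)%N then x else if a == b then 0 else - x))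
      (seq_sign w) w
  else 1.

Section Determinants.
Context (R : realType).
Implicit Types (g : 'M[R]_8) (s t : tensor4 R).

Lemma seq_signE (v : seq nat) : (seq_sign v)%:~R =
  \prod_(i < size v) \prod_(j < size v | (i < j)%N)
    Num.sg ((nth 0%N v j)%:R - (nth 0%N v i)%:R) :> R.
Proof.
elim: v => [|a w IH]; first by rewrite big_ord0.
rewrite big_ord_recl/= big_mkcond big_ord_recl/= mul1r.
transitivity ((\prod_(j < size w) Num.sg ((nth 0%N w j)%:R - a%:R : R)) * (seq_sign w)%:~R); last first.
  rewrite IH; congr (_ * _); apply: eq_bigr => i _.
  by rewrite [RHS]big_mkcond big_ord_recl/= mul1r big_mkcond.
move: (seq_sign w) => x; clear IH; elim: w => [|b w IH] /=.
  by rewrite big_ord0 mul1r.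
rewrite big_ord_recl/= -mulrA -IH; case: ltngtP => ab.
- by rewrite gtr0_sg ?mul1r// subr_gt0 ltr_nat.
- by rewrite ltr0_sg ?subr_lt0 ?ltr_nat// mulN1r rmorphN.
- by rewrite ab subrr sgr0 mul0r.
Qed.

(** The Vandermonde matrix of the values of [v] is that of 0, ..., 7 times the transposed selection
    matrix [A]. The second factorises with positive determinant, so [\det A] has the sign of a
    product of differences; and [\det A] is 0, 1 or -1. *)
Lemma det_one_hot (v : seq 'I_8) : size v = 8 ->
  \det (\matrix_(i, j) (nth ord0 v i == j)%:R : 'M[R]_8) = (seq_sign (map val v))%:~R.
Proof.
move=> sv; set A := \matrix_(i, j) _.
have sgA : Num.sg (\det A) = (seq_sign (map val v))%:~R.
  rewrite seq_signE size_map sv.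
  pose x := \row_(i < 8) (i : nat)%:R : 'rV[R]_8.
  pose y := \row_(i < 8) (nth ord0 v i : nat)%:R : 'rV[R]_8.
  have e : Vandermonde 8 y = Vandermonde 8 x *m A^T.
    apply/matrixP => i j; rewrite !mxE (bigD1 (nth ord0 v j))//= !mxE eqxx mulr1.
    by rewrite big1 ?addr0// => k /negPf kj; rewrite !mxE eq_sym kj mulr0.
  have := congr1 (fun m => Num.sg (\det m)) e; rewrite det_mulmx det_tr sgrM.
  rewrite !det_Vandermonde; set p := \prod_i _.
  have -> : Num.sg (\prod_(i < 8) \prod_(j < 8 | (i < j)%N) (x 0 j - x 0 i)) = 1.
    apply: gtr0_sg; apply: prodr_gt0 => i _; apply: prodr_gt0 => j ij.
    by rewrite !mxE subr_gt0 ltr_nat.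
  rewrite mul1r => <-; rewrite /p.
  rewrite (big_morph Num.sg (@sgrM R) (sgr1 R)); apply: eq_bigr => i _.
  rewrite (big_morph Num.sg (@sgrM R) (sgr1 R)); apply: eq_bigr => j _.
  by rewrite !mxE !(nth_map ord0) ?sv.
rewrite -sgA; have [inj|ninj] := boolP (injectiveb [ffun i : 'I_8 => nth ord0 v i]).
  have -> : A = perm_mx (Perm inj).
    by apply/matrixP => i j; rewrite !mxE; congr (_ == _)%:R; rewrite -pvalE ffunE.
  by rewrite det_perm; case: odd_perm; rewrite ?expr0 ?expr1 ?sgrN ?sgr1.
have [i [j [ij eij]]] : exists i : 'I_8, exists j : 'I_8, i != j /\ nth ord0 v i = nth ord0 v j.
  move/injectivePn: ninj => [i [j ij]]; rewrite !ffunE => e.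
  by exists i, j; split.
rewrite (determinant_alternate ij) ?sgr0// => k.
by rewrite !mxE eij.
Qed.

Definition row_det (v : seq 'rV[R]_8) : R := \det (\matrix_(i, j) nth 0 v i 0 j : 'M[R]_8).

Local Notation e_ i := (delta_mx 0 i : 'rV[R]_8).

Lemma row_det_slot v r w : (size v < 8)%N ->
  row_det (v ++ r :: w) = \sum_p r 0 p * row_det (v ++ e_ p :: w).
Proof.
move=> sv; pose k : 'I_8 := Ordinal sv.
rewrite /row_det (expand_det_row _ k); apply: eq_bigr => p _.
rewrite !mxE nth_cat ltnn subnn/=; congr (_ * _).
rewrite [RHS](expand_det_row _ k) (bigD1 p)//= big1 ?addr0; last first.
  by move=> q qp; rewrite !mxE nth_cat ltnn subnn/= mxE (negPf qp) andbF mul0r.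
rewrite mxE nth_cat ltnn subnn/= mxE !eqxx mul1r /cofactor; congr (_ * \det _).
apply/matrixP => i j; rewrite !mxE !nth_cat; case: ltnP => // kl.
suff : (lift k i - size v)%N != 0%N by case: (_ - _)%N.
rewrite subn_eq0 -ltnNge ltn_neqAle kl andbT.
by have := neq_lift k i; rewrite -val_eqE.
Qed.

Lemma row_detM v g : size v = 8 -> row_det [seq r *m g | r <- v] = \det g * row_det v.
Proof.
move=> sv; rewrite mulrC -det_mulmx; congr (\det _); apply/matrixP => i j.
by rewrite !mxE (nth_map 0) ?sv// !mxE; apply: eq_bigr => k _; rewrite mxE.
Qed.

Lemma row_det_delta (v : seq 'I_8) : size v = 8 ->
  row_det [seq e_ i | i <- v] = (seq_sign (map val v))%:~R.
Proof.
move=> sv; rewrite -det_one_hot//; congr (\det _); apply/matrixP => i j.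
by rewrite !mxE (nth_map ord0) ?sv// mxE eqxx eq_sym.
Qed.

Definition det_tensor (a b c d : 'rV[R]_8) : tensor4 R := fun i j k l =>
  row_det [:: a; b; c; d; e_ i; e_ j; e_ k; e_ l].

Definition dot4 s t : R := \sum_a \sum_b \sum_c \sum_d s a b c d * t a b c d.

(** The Hodge dual without its factor 1/4!; the model form is therefore an eigenvector of eigenvalue
    24 and not 1. *)
Definition star s : tensor4 R := fun a b c d =>
  dot4 s (det_tensor (e_ a) (e_ b) (e_ c) (e_ d)).

Lemma det_tensor_pullback g a b c d i j k l :
  pullback4 g^T (det_tensor a b c d) i j k l =
  row_det [:: a; b; c; d; row i g; row j g; row k g; row l g].
Proof.
rewrite (@row_det_slot [:: a; b; c; d] (row i g)) //; apply: eq_bigr => p _.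
rewrite (@row_det_slot [:: a; b; c; d; e_ p] (row j g)) // mulr_sumr; apply: eq_bigr => q _.
rewrite (@row_det_slot [:: a; b; c; d; e_ p; e_ q] (row k g)) // !mulr_sumr.
apply: eq_bigr => r _.
rewrite (@row_det_slot [:: a; b; c; d; e_ p; e_ q; e_ r] (row l g)) // !mulr_sumr.
by apply: eq_bigr => s _; rewrite !mxE /det_tensor !mulrA.
Qed.

End Determinants.

(** Tabulated once, so that the large finite checks look entries up instead of sorting and counting
    inversions each time. *)
Definition cayley_table : seq (seq (seq (seq int))) := Eval vm_compute in
  [seq [seq [seq [seq cayley_sign [:: a; b; c; d] | d <- iota 0 8]
    | c <- iota 0 8] | b <- iota 0 8] | a <- iota 0 8].

Definition cayley_int (a b c d : nat) : int :=
  nth 0 (nth [::] (nth [::] (nth [::] cayley_table a) b) c) d.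

Lemma cayley_tableE : cayley_table =
  [seq [seq [seq [seq cayley_sign [:: a; b; c; d] | d <- iota 0 8]
    | c <- iota 0 8] | b <- iota 0 8] | a <- iota 0 8].
Proof. by vm_compute. Qed.

Lemma cayley0_int (R : realType) a b c d : cayley0 R a b c d = (cayley_int a b c d)%:~R.
Proof.
rewrite /cayley0 /cayley_int cayley_tableE.
by rewrite !(nth_map 0%N) ?size_iota// !nth_iota// !add0n.
Qed.

Definition int_sum (F : nat -> int) : int := foldr (fun p s => F p + s) 0 (iota 0 8).

Lemma int_sumE (R : realType) (F : nat -> int) (G : 'I_8 -> R) :
  (forall i : 'I_8, G i = (F i)%:~R) -> \sum_i G i = (int_sum F)%:~R.
Proof.
move=> FG; rewrite /int_sum foldr_iota8 rmorph_sum.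
by apply: eq_bigr => i _; rewrite FG.
Qed.

Fact star_cayley_int :
  all (fun a => all (fun b => all (fun c => all (fun d =>
    if [&& a < b, b < c & c < d]%N then
    int_sum (fun i => int_sum (fun j => int_sum (fun k => int_sum (fun l =>
      let x := cayley_int i j k l in
      if x == 0 then 0 else x * seq_sign [:: a; b; c; d; i; j; k; l]))))  ==
    24 * cayley_int a b c d else true) (iota 0 8)) (iota 0 8)) (iota 0 8)) (iota 0 8).
Proof. by vm_compute. Qed.


(** * The Hodge dual and pullback *)

Section Star.
Context (R : realType).
Implicit Types (g u : 'M[R]_8) (s t : tensor4 R).
Local Notation Phi0 := (cayley0 R).
Local Notation e_ i := (delta_mx 0 i : 'rV[R]_8).

Lemma alternating4_eq0 s : alternating4 s ->
    (forall a b c d : 'I_8, (a < b)%N -> (b < c)%N -> (c < d)%N -> s a b c d = 0) ->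
  forall a b c d, s a b c d = 0.
Proof.
move=> alt s0.
have s12 x y z w : s y x z w = - s x y z w by case: (alt x y z w).
have s23 x y z w : s x z y w = - s x y z w by case: (alt x y z w).
have s34 x y z w : s x y w z = - s x y z w by case: (alt x y z w).
have dup x : x = - x -> x = 0 :> R by move=> ?; lra.
move=> a b c d; move: a b c; apply: alternating3_eq0 => [a b c|a b c|a b c /andP[ab bc]];
  [exact: s12|exact: s23|].
have [cd|dc|/val_inj <-] := ltngtP c d; [exact: s0| |exact/dup].
rewrite s34; have [bd|db|/val_inj <-] := ltngtP b d.
- by rewrite s0 ?oppr0.
- rewrite s23; have [ad|da|/val_inj <-] := ltngtP a d.
  + by rewrite s0 ?oppr0.
  + by rewrite s12 s0 ?oppr0.
  + by rewrite (dup (s a a b c)) ?oppr0.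
- by rewrite (dup (s a b b c)) ?oppr0.
Qed.

Lemma row_det_swap v (r r' : 'rV[R]_8) w : size (v ++ r :: r' :: w) = 8 ->
  row_det (v ++ r' :: r :: w) = - row_det (v ++ r :: r' :: w).
Proof.
rewrite size_cat/= => sv.
have k1 : (size v < 8)%N by lia.
have k2 : ((size v).+1 < 8)%N by lia.
pose i1 := Ordinal k1; pose i2 := Ordinal k2.
rewrite /row_det; set A := (X in _ = - \det X); set B := (X in \det X = _).
have -> : B = row_perm (tperm i1 i2) A.
  apply/matrixP => i j; rewrite !mxE permE/=.
  have [->|n1] := eqVneq i i1.
    by rewrite /= !nth_cat ltnn subnn ltnNge leqnSn/= subSnn.
  have [->|n2] := eqVneq i i2.
    by rewrite /= !nth_cat ltnn subnn ltnNge leqnSn/= subSnn.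
  rewrite !nth_cat; case: ltnP => // vi.
  move: n1 n2; rewrite -!val_eqE/= => n1 n2.
  have : (1 < i - size v)%N by rewrite ltn_subRL addn1; lia.
  by case: (_ - _)%N => [|[|]].
rewrite row_permE det_mulmx det_perm odd_tperm -val_eqE/= neq_ltn ltnSn/=.
by rewrite expr1 mulN1r.
Qed.

Lemma dot4_pullback g s t : dot4 (pullback4 g s) t = dot4 s (pullback4 g^T t).
Proof.
have a4 u x y : dot4 (mode4 u x) y = dot4 x (mode4 u^T y).
  by do 3 (apply: eq_bigr => ? _); exact: sum_adjoint.
have ex3 x y : dot4 x y = \sum_a \sum_b \sum_d \sum_c x a b c d * y a b c d.
  by do 2 (apply: eq_bigr => ? _); exact: exchange_big.
have a3 u x y : dot4 (mode3 u x) y = dot4 x (mode3 u^T y).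
  rewrite !ex3; do 3 (apply: eq_bigr => ? _).
  exact: (sum_adjoint (fun p => x _ _ p _) (fun p => y _ _ p _)).
have ex2 x y : dot4 x y = \sum_a \sum_d \sum_c \sum_b x a b c d * y a b c d.
  rewrite ex3; apply: eq_bigr => a _; rewrite exchange_big; apply: eq_bigr => d _.
  exact: exchange_big.
have a2 u x y : dot4 (mode2 u x) y = dot4 x (mode2 u^T y).
  rewrite !ex2; do 3 (apply: eq_bigr => ? _).
  exact: (sum_adjoint (fun p => x _ p _ _) (fun p => y _ p _ _)).
have ex1 x y : dot4 x y = \sum_d \sum_c \sum_b \sum_a x a b c d * y a b c d.
  rewrite ex2 exchange_big; apply: eq_bigr => d _; rewrite exchange_big.
  by apply: eq_bigr => c _; exact: exchange_big.
have a1 u x y : dot4 (mode1 u x) y = dot4 x (mode1 u^T y).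
  rewrite !ex1; do 3 (apply: eq_bigr => ? _).
  exact: (sum_adjoint (fun p => x p _ _ _) (fun p => y p _ _ _)).
rewrite !pullback4E a1 a2 a3 a4 trmxK.
by rewrite !(mode21, mode31, mode41, mode32, mode42, mode43).
Qed.

Let dot4_sumr s (x : 'I_8 -> R) (t : 'I_8 -> tensor4 R) :
  \sum_p x p * dot4 s (t p) = dot4 s (fun a b c d => \sum_p x p * t p a b c d).
Proof.
under eq_bigr do rewrite mulr_sumr.
rewrite exchange_big; apply: eq_bigr => a _; under eq_bigr do rewrite mulr_sumr.
rewrite exchange_big; apply: eq_bigr => b _; under eq_bigr do rewrite mulr_sumr.
rewrite exchange_big; apply: eq_bigr => c _; under eq_bigr do rewrite mulr_sumr.
rewrite exchange_big; apply: eq_bigr => d _; rewrite mulr_sumr.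
by apply: eq_bigr => p _; ring.
Qed.

(** Adjunction moves the inner [g] to the last four rows of the determinant and the outer pullback
    puts [g] into the first four. All eight rows are then multiplied by [g], which costs
    [\det g]. *)
Lemma star_pullback g s : pullback4 g^T (star (pullback4 g s)) =
  fun a b c d => \det g * star s a b c d.
Proof.
apply: tensor4P => a b c d; set s' := pullback4 g s.
transitivity (dot4 s' (det_tensor (row a g) (row b g) (row c g) (row d g))).
  transitivity (\sum_i row a g 0 i * \sum_j row b g 0 j * \sum_k row c g 0 k *
      \sum_l row d g 0 l * dot4 s' (det_tensor (e_ i) (e_ j) (e_ k) (e_ l))).
    apply: eq_bigr => i _; rewrite mulr_sumr; apply: eq_bigr => j _.
    rewrite !mulr_sumr; apply: eq_bigr => k _; rewrite !mulr_sumr.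
    by apply: eq_bigr => l _; rewrite !mxE /star; ring.
  under eq_bigr do under eq_bigr do under eq_bigr do rewrite dot4_sumr.
  under eq_bigr do under eq_bigr do rewrite dot4_sumr.
  under eq_bigr do rewrite dot4_sumr.
  rewrite dot4_sumr; congr (dot4 s' _); apply: tensor4P => p q r o.
  rewrite /det_tensor (@row_det_slot R [::] (row a g))//; apply: eq_bigr => i _.
  congr (_ * _); rewrite (@row_det_slot R [:: e_ i] (row b g))//; apply: eq_bigr => j _.
  congr (_ * _); rewrite (@row_det_slot R [:: e_ i; e_ j] (row c g))//; apply: eq_bigr => k _.
  by congr (_ * _); rewrite (@row_det_slot R [:: e_ i; e_ j; e_ k] (row d g)).
rewrite /s' dot4_pullback /star /dot4 mulr_sumr; apply: eq_bigr => i _.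
rewrite mulr_sumr; apply: eq_bigr => j _; rewrite mulr_sumr; apply: eq_bigr => k _.
rewrite mulr_sumr; apply: eq_bigr => l _; rewrite det_tensor_pullback !rowE mulrCA.
by congr (_ * _); exact: (@row_detM R [:: e_ a; e_ b; e_ c; e_ d; e_ i; e_ j; e_ k; e_ l]).
Qed.

Lemma star_alternating s : alternating4 (star s).
Proof.
move=> a b c d; rewrite /star.
have N x : - dot4 s x = dot4 s (fun a b c d => - x a b c d).
  by rewrite -sumrN; do 3 (apply: eq_bigr => ? _; rewrite -sumrN);
    apply: eq_bigr => ? _; rewrite mulrN.
split; rewrite [RHS]N; congr (dot4 s _); apply: tensor4P => i j k l.
- exact: (@row_det_swap [::]).
- exact: (@row_det_swap [:: _]).
- exact: (@row_det_swap [:: _; _]).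
Qed.

Lemma star_cayley0 : star Phi0 = fun a b c d => 24 * Phi0 a b c d.
Proof.
apply: tensor4P => a b c d; apply/eqP; rewrite -subr_eq0 -mulNr; apply/eqP.
move: a b c d; apply: alternating4_eq0.
  by apply: alternatingD; [exact: star_alternating|apply/alternatingZ/cayley0_alternating].
move=> a b c d ab bc cd; have := star_cayley_int.
move=> /all_iota8P/(_ a)/all_iota8P/(_ b)/all_iota8P/(_ c)/all_iota8P/(_ d).
rewrite (_ : [&& _, _ & _] = true); last by rewrite ab bc cd.
move=> /eqP/(congr1 (fun z : int => z%:~R : R)).
rewrite [X in _ = X]intrM rmorph_nat -cayley0_int => e.
suff -> : star Phi0 a b c d = 24 * Phi0 a b c d by rewrite mulNr subrr.
rewrite -e; apply: int_sumE => i.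
apply: int_sumE => j; apply: int_sumE => k; apply: int_sumE => l.
rewrite cayley0_int; move: (cayley_int i j k l) => x; cbv zeta.
have [->|_] := eqVneq x 0; first by rewrite mul0r.
rewrite intrM; congr (_ * _).
exact: (@row_det_delta R [:: a; b; c; d; i; j; k; l]).
Qed.

(** Self-duality turns invariance under [g] into a statement about [g^T]. This second relation is
    what the contraction identity needs in order to control the metric. *)
Lemma cayley0_trmx g : pullback4 g Phi0 = Phi0 ->
  pullback4 g^T Phi0 = fun a b c d => \det g * Phi0 a b c d.
Proof.
move=> gP; have := star_pullback g Phi0; rewrite gP star_cayley0 => e.
apply: tensor4P => a b c d; have := congr1 (fun t : tensor4 R => t a b c d) e.
by rewrite /= pullback4Z => ?; lra.
Qed.

End Star.

(** * Spin(7) preserves the metric *)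

Section Orthogonality.
Context (R : realType).
Implicit Types (g u : 'M[R]_8) (s t A B : tensor4 R).
Local Notation Phi0 := (cayley0 R).
Local Notation dl := (delta R).

Definition lin2 (x : R) A (y : R) B : tensor4 R := fun a b c d =>
  x * A a b c d + y * B a b c d.

Let sum_lin2 (u A B : 'I_8 -> R) x y : \sum_p u p * (x * A p + y * B p) =
  x * (\sum_p u p * A p) + y * (\sum_p u p * B p).
Proof. by rewrite !mulr_sumr -big_split; apply: eq_bigr => p _ /=; ring. Qed.

Let mode1_lin2 u x A y B : mode1 u (lin2 x A y B) = lin2 x (mode1 u A) y (mode1 u B).
Proof. by apply: tensor4P => *; apply: sum_lin2. Qed.
Let mode2_lin2 u x A y B : mode2 u (lin2 x A y B) = lin2 x (mode2 u A) y (mode2 u B).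
Proof. by apply: tensor4P => *; apply: sum_lin2. Qed.
Let mode3_lin2 u x A y B : mode3 u (lin2 x A y B) = lin2 x (mode3 u A) y (mode3 u B).
Proof. by apply: tensor4P => *; apply: sum_lin2. Qed.
Let mode4_lin2 u x A y B : mode4 u (lin2 x A y B) = lin2 x (mode4 u A) y (mode4 u B).
Proof. by apply: tensor4P => *; apply: sum_lin2. Qed.

Definition scl x s := lin2 x s 0 s.

Let sclE x s a b c d : scl x s a b c d = x * s a b c d.
Proof. by rewrite /scl /lin2; ring. Qed.

Definition dot34 A B : tensor4 R := fun i j k l =>
  \sum_a \sum_b A i j a b * B k l a b.

Let dot34_mode4 u A B : dot34 (mode4 u A) B = dot34 A (mode4 u^T B).
Proof. by apply: tensor4P => i j k l; apply: eq_bigr => a _; apply: sum_adjoint. Qed.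

Let dot34_mode3 u A B : dot34 (mode3 u A) B = dot34 A (mode3 u^T B).
Proof.
apply: tensor4P => i j k l; rewrite /dot34 exchange_big [RHS]exchange_big.
by apply: eq_bigr => b _; apply: (sum_adjoint (fun p => A i j p b) (fun p => B k l p b)).
Qed.

Let dot34_left (u : 'I_8 -> R) (F : 'I_8 -> 'I_8 -> 'I_8 -> R) (G : 'I_8 -> 'I_8 -> R) :
  \sum_a \sum_b (\sum_p u p * F p a b) * G a b =
  \sum_p u p * (\sum_a \sum_b F p a b * G a b).
Proof.
under [RHS]eq_bigr do rewrite mulr_sumr; rewrite [RHS]exchange_big.
apply: eq_bigr => a _; under [RHS]eq_bigr do rewrite mulr_sumr.
rewrite [RHS]exchange_big; apply: eq_bigr => b _; rewrite mulr_suml.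
by apply: eq_bigr => p _; ring.
Qed.

Let dot34C A B i j k l : dot34 A B i j k l = dot34 B A k l i j.
Proof. by apply: eq_bigr => a _; apply: eq_bigr => b _; rewrite mulrC. Qed.

Let dot34_mode1 u A B : dot34 (mode1 u A) B = mode1 u (dot34 A B).
Proof. by apply: tensor4P => i j k l; apply: (dot34_left _ (fun p => A p j)). Qed.
Let dot34_mode2 u A B : dot34 (mode2 u A) B = mode2 u (dot34 A B).
Proof. by apply: tensor4P => i j k l; apply: (dot34_left _ (fun p => A i p)). Qed.
Let dot34_mode1r u A B : dot34 A (mode1 u B) = mode3 u (dot34 A B).
Proof.
apply: tensor4P => i j k l; rewrite dot34C dot34_mode1.
by apply: eq_bigr => p _; rewrite dot34C.
Qed.
Let dot34_mode2r u A B : dot34 A (mode2 u B) = mode4 u (dot34 A B).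
Proof.
apply: tensor4P => i j k l; rewrite dot34C dot34_mode2.
by apply: eq_bigr => p _; rewrite dot34C.
Qed.

Definition delta4 : tensor4 R := fun a b c d => dl a c * dl b d - dl a d * dl b c.

Let modesE := (mode21, mode31, mode41, mode32, mode42, mode43, @mode11 R, @mode22 R, @mode33 R, @mode44 R).

Lemma dot34_cayley0 : dot34 Phi0 Phi0 = lin2 6 delta4 (- 4) Phi0.
Proof.
apply: tensor4P => i j k l.
have := contraction2 (cayley0_alternating R) (@cayley0_contraction1 R) i j k l.
by rewrite /dot34 => ->; rewrite /lin2 /delta4; ring.
Qed.

Let delta4_mode34 u k l a b : mode3 u (mode4 u delta4) k l a b = u a k * u b l - u a l * u b k.
Proof.
transitivity (\sum_p u a p * (dl k p * u b l - dl l p * u b k)).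
  apply: eq_bigr => p _; congr (_ * _); rewrite /mode4 /delta4.
  transitivity (\sum_q (dl q l * (u b q * dl k p) - dl q k * (u b q * dl l p))).
    by apply: eq_bigr => q _; rewrite (deltaC R l q) (deltaC R k q); ring.
  by rewrite sumrB !sum_delta; ring.
transitivity (\sum_p (dl p k * (u a p * u b l) - dl p l * (u a p * u b k))).
  by apply: eq_bigr => q _; rewrite (deltaC R l q) (deltaC R k q); ring.
by rewrite sumrB !sum_delta.
Qed.

Let delta4_conj u v : u *m v^T = 1%:M ->
  mode1 u (mode2 u (mode3 v (mode4 v delta4))) = delta4.
Proof.
move=> uv; apply: tensor4P => i j k l.
have uvE a b : \sum_p u a p * v b p = dl a b.
  have := congr1 (fun m : 'M_8 => m a b) uv; rewrite mxE [RHS]mxE /delta => <-.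
  by apply: eq_bigr => p _; rewrite mxE.
transitivity (\sum_p u i p * (\sum_q u j q * (v k p * v l q - v k q * v l p))).
  by apply: eq_bigr => p _; congr (_ * _); apply: eq_bigr => q _; rewrite delta4_mode34.
transitivity (\sum_p ((u i p * v k p) * dl j l - (u i p * v l p) * dl j k)).
  apply: eq_bigr => p _; rewrite -!uvE !mulr_sumr -sumrB; apply: eq_bigr => q _; ring.
by rewrite sumrB -!mulr_suml !uvE.
Qed.

(** The contraction of two copies of the form in two indices is compared with itself after [g] has
    acted on some slots only. This forces [\det g = 1], and then that the Gram matrix [S = g g^T]
    acts trivially on 2-forms; such a matrix is the identity. *)
Lemma spin7_cayley0_orthogonal g : spin7 Phi0 g -> g^T *m g = 1%:M.
Proof.
move=> [gu gP]; have gT := cayley0_trmx gP; set d := \det g in gT.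
set G := invmx g.
have gG : g *m G = 1%:M by exact: mulmxV.
have Gg : G *m g = 1%:M by exact: mulVmx.
have gGT : G^T *m g^T = 1%:M by rewrite -trmx_mul gG trmx1.
have GgT : g^T *m G^T = 1%:M by rewrite -trmx_mul Gg trmx1.
have X1 : mode3 g^T (mode4 g^T Phi0) = mode1 G^T (mode2 G^T Phi0).
  by rewrite -[in RHS]gP pullback4E !modesE gGT mode1_id mode2_id.
have gT' : pullback4 g^T Phi0 = scl d Phi0.
  by rewrite gT; apply: tensor4P => *; rewrite sclE.
have X2 : mode1 g (mode2 g Phi0) = scl d (mode3 G (mode4 G Phi0)).
  rewrite /scl -mode3_lin2 -mode4_lin2 -/(scl d Phi0) -gT' pullback4E trmxK !modesE.
  by rewrite Gg mode3_id mode4_id.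
set Om := lin2 6 delta4 (- 4) Phi0.
(* One contraction is evaluated twice: [X1] moves the matrices to the free slots, while [X2] makes
   them cancel in the contracted ones and leaves the factor [d]. *)
have OmE : mode1 G^T (mode2 G^T (mode3 g (mode4 g Om))) = scl d Om.
  transitivity (dot34 (mode3 g^T (mode4 g^T Phi0)) (mode1 g (mode2 g Phi0))).
    rewrite X1 dot34_mode1 dot34_mode2 dot34_mode1r dot34_mode2r dot34_cayley0 -/Om.
    done.
  rewrite X2 dot34_mode3 dot34_mode4 !trmxK.
  have -> : mode4 g (mode3 g (scl d (mode3 G (mode4 G Phi0)))) = scl d Phi0.
    by rewrite /scl mode3_lin2 mode4_lin2 !modesE gG mode3_id mode4_id.
  apply: tensor4P => i j k l; rewrite sclE /Om -dot34_cayley0 /dot34 mulr_sumr.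
  apply: eq_bigr => a _; rewrite mulr_sumr; apply: eq_bigr => b _; rewrite sclE; ring.
(* Tracing slots 2 and 4 cancels [G^T] against [g] and turns [Om] into 42 times the identity; what
   remains of [OmE] is [g G] on one side and [d] on the other. *)
have d1 : d = 1.
  pose c24 (t : tensor4 R) (i k : 'I_8) := \sum_j t i j k j.
  have c24_mode (t : tensor4 R) i k : c24 (mode2 G^T (mode4 g t)) i k = c24 t i k.
    transitivity (\sum_p \sum_q (\sum_j G p j * g j q) * t i p k q).
      rewrite /c24; under eq_bigr do rewrite /mode2.
      rewrite exchange_big; apply: eq_bigr => p _ /=; rewrite /mode4.
      under eq_bigr do rewrite mulr_sumr.
      rewrite exchange_big; apply: eq_bigr => q _; rewrite mulr_suml.
      by apply: eq_bigr => j _; rewrite mxE; ring.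
    apply: eq_bigr => p _; rewrite -[RHS](sum_delta_r p (fun q => t i p k q)).
    apply: eq_bigr => q _; congr (_ * _).
    by have := congr1 (fun m : 'M_8 => m p q) Gg; rewrite mxE [RHS]mxE.
  have OmD i k : c24 Om i k = 42 * dl i k.
    rewrite /c24 -(contraction3 (cayley0_alternating R) (@cayley0_contraction1 R)).
    by apply: eq_bigr => j _; rewrite /Om -dot34_cayley0.
  have c24_1 u (t : tensor4 R) i k : c24 (mode1 u t) i k = \sum_p u i p * c24 t p k.
    rewrite /c24 exchange_big; apply: eq_bigr => p _; by rewrite mulr_sumr.
  have c24_3 u (t : tensor4 R) i k : c24 (mode3 u t) i k = \sum_p u k p * c24 t i p.
    rewrite /c24 exchange_big; apply: eq_bigr => p _; by rewrite mulr_sumr.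
  have := congr1 (fun t => c24 t ord0 ord0) OmE.
  rewrite [in LHS](_ : mode1 _ _ = mode3 g (mode1 G^T (mode2 G^T (mode4 g Om)))); last first.
    by rewrite !modesE.
  rewrite c24_3; under eq_bigr do rewrite c24_1.
  under eq_bigr do under eq_bigr do rewrite c24_mode OmD.
  have -> : c24 (scl d Om) ord0 ord0 = d * 42.
    transitivity (d * c24 Om ord0 ord0); last by rewrite OmD delta_diag mulr1.
    by rewrite /c24 mulr_sumr; apply: eq_bigr => j _; rewrite sclE.
  set L := (X in X = _ -> _); suff -> : L = 42 by move=> e; lra.
  rewrite /L.
  transitivity (42 * \sum_p g ord0 p * G p ord0).
    rewrite mulr_sumr; apply: eq_bigr => p _.
    transitivity (g ord0 p * \sum_q dl q p * (42 * G q ord0)); last by rewrite sum_delta; ring.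
    by congr (_ * _); apply: eq_bigr => q _; rewrite [G^T _ _]mxE; ring.
  by have := congr1 (fun m : 'M_8 => m ord0 ord0) gG; rewrite mxE [RHS]mxE eqxx => ->; rewrite mulr1.
(* The delta part of [Om] is invariant by itself, hence so is the part in [Phi0]. *)
have Phi_inv : mode1 G^T (mode2 G^T (mode3 g (mode4 g Phi0))) = Phi0.
  have := OmE; rewrite d1 /Om !(mode4_lin2, mode3_lin2, mode2_lin2, mode1_lin2).
  rewrite delta4_conj// => e; apply: tensor4P => a b c z.
  by have := congr1 (fun t : tensor4 R => t a b c z) e; rewrite sclE /lin2 => ?; lra.
have X3 : mode1 g^T (mode2 g^T Phi0) = mode3 g (mode4 g Phi0).
  by rewrite -[in LHS]Phi_inv !modesE GgT mode1_id mode2_id.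
have X4 : mode1 g (mode2 g (mode3 g (mode4 g Phi0))) = Phi0.
  have := gT'; rewrite pullback4E trmxK => ->; apply: tensor4P => *.
  by rewrite sclE d1 mul1r.
pose S := g *m g^T.
(* In [X4] the matrices on slots 3 and 4 are traded, through [X3], for [g^T] on slots 1 and 2. *)
have X5 : mode1 S (mode2 S Phi0) = Phi0.
  by rewrite /S -mode11 -mode22 -[in RHS]X4 -X3 !modesE.
have X6 : mode3 S (mode4 S Om) = Om.
  by rewrite /Om -dot34_cayley0 -dot34_mode2r -dot34_mode1r X5.
have PP x y z w : Phi0 x y z w = Phi0 z w x y.
  have altP := cayley0_alternating R.
  have P12 x' y' z' w' : Phi0 y' x' z' w' = - Phi0 x' y' z' w' by case: (altP x' y' z' w').
  have P23 x' y' z' w' : Phi0 x' z' y' w' = - Phi0 x' y' z' w' by case: (altP x' y' z' w').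
  have P34 x' y' z' w' : Phi0 x' y' w' z' = - Phi0 x' y' z' w' by case: (altP x' y' z' w').
  by rewrite (P23 x z) (P12 z x) (P34 z x w) (P23 z w x); ring.
have X7 : mode3 S (mode4 S Phi0) = Phi0.
  apply: tensor4P => a b c z; rewrite [RHS]PP -[in RHS]X5.
  by apply: eq_bigr => p _; congr (_ * _); apply: eq_bigr => q _; rewrite PP.
(* All 2 by 2 minors of [S] are those of the identity matrix. *)
have X8 k l a b : S a k * S b l - S a l * S b k = dl k a * dl l b - dl k b * dl l a.
  have := congr1 (fun t : tensor4 R => t k l a b) X6.
  by rewrite /Om mode4_lin2 mode3_lin2 X7 /lin2 delta4_mode34 /delta4 => ?; lra.
have ST : S^T = S by rewrite /S trmx_mul trmxK.
have S0 k : 0 <= S k k.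
  by rewrite /S mxE; apply: sumr_ge0 => j _; rewrite mxE -expr2; exact: sqr_ge0.
have SE : g *m g^T = S by [].
clearbody S; clear X5 X6 X7.
have Ssym a b : S a b = S b a by rewrite -[S in LHS]ST mxE.
have dn (a b : 'I_8) : a != b -> dl a b = 0 by rewrite /delta => /negPf ->.
have S2 k l : k != l -> S k k * S l l - S k l * S k l = 1.
  by move=> kl; have := X8 k l k l; rewrite !delta_diag (dn _ _ kl) (Ssym l k) => ?; lra.
have ex3 (a b : 'I_8) : exists c : 'I_8, (c != a) && (c != b).
  have /fintype.subsetPn[c _] : ~~ ([set: 'I_8]%SET \subset [set a; b]%SET).
    by apply/negP => /subset_leq_card; rewrite cardsT card_ord cards2; case: (a != b).
  by rewrite !finset.inE negb_or => h; exists c.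
(* The entry [S l m] times a principal minor equal to 1 is a combination of two vanishing minors
   that involve a third index [k]. *)
have Soff l m : l != m -> S l m = 0.
  move=> lm; have [k /andP[kl km]] := ex3 l m.
  have e1 := X8 k l k m; have e2 := X8 l k l m; have e3 := S2 k l kl.
  move: e1 e2; rewrite !delta_diag (dn _ _ kl) (dn _ _ km) (dn _ _ lm).
  rewrite (dn l k) 1?eq_sym// (Ssym m l) (Ssym m k) (Ssym l k) => e1 e2.
  have : S l m * (S k k * S l l - S k l * S k l) = 0.
    have -> : S l m * (S k k * S l l - S k l * S k l) =
      S l l * (S k k * S l m - S k m * S k l) + S k l * (S l l * S k m - S l m * S k l) by ring.
    have -> : S k k * S l m - S k m * S k l = 0 by lra.
    have -> : S l l * S k m - S l m * S k l = 0 by lra.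
    by rewrite !mulr0 addr0.
  by rewrite e3 mulr1.
(* Three diagonal entries have pairwise products 1, so each has square 1; a diagonal entry of a Gram
   matrix is non-negative. *)
have Sdiag k : S k k = 1.
  have [l /andP[lk _]] := ex3 k k; have [m /andP[mk ml]] := ex3 k l.
  have e1 := S2 l k lk; have e2 := S2 m k mk; have e3 := S2 m l ml.
  move: e1 e2 e3; rewrite (Soff l k)// (Soff m k)// (Soff m l)// !mulr0 !subr0 => e1 e2 e3.
  have : S k k * S k k = 1.
    transitivity ((S l l * S k k) * (S m m * S k k)); last by rewrite e1 e2 mulr1.
    by rewrite mulrACA (mulrC (S l l)) e3 mul1r.
  by move=> /eqP; rewrite -expr2 sqrp_eq1// => /eqP.
apply: mulmx1C; rewrite SE; apply/matrixP => a b; rewrite [RHS]mxE.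
by have [->|ab] := eqVneq a b; rewrite ?Sdiag ?Soff.
Qed.

End Orthogonality.

(** * Clifford basis of the fields *)

Definition imx := seq (seq int).
Definition imx_get (m : imx) (i j : nat) : int := nth 0 (nth [::] m i) j.
Definition imx_build (f : nat -> nat -> int) : imx := [seq [seq f i j | j <- iota 0 8] | i <- iota 0 8].
Definition imx_mul (a b : imx) : imx :=
  imx_build (fun i j => int_sum (fun k => imx_get a i k * imx_get b k j)).
Definition imx_tr (a : imx) : imx := imx_build (fun i j => imx_get a j i).
Definition imx_scale (x : int) (a : imx) : imx := imx_build (fun i j => x * imx_get a i j).
Definition imx_add (a b : imx) : imx := imx_build (fun i j => imx_get a i j + imx_get b i j).
Definition imx_trace (a : imx) : int := int_sum (fun i => imx_get a i i).
Definition imx1 : imx := imx_build (fun i j => (i == j)%:R).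

(* The forms e^0 /\ e^a - i_a i_0 Phi span Lambda^2_7 and satisfy the Clifford
   relations of R^7. *)
Definition gamma (a : nat) : imx := Eval vm_compute in
  imx_build (fun p q => ((p == 0) && (q == a))%N%:R - ((p == a) && (q == 0))%N%:R
     - cayley_int p q 0 a).
Definition gammas : seq imx := Eval vm_compute in [seq gamma a | a <- iota 1 7].
Definition triples : seq (seq nat) := Eval vm_compute in
  flatten [seq flatten [seq [seq [:: a; b; c] | c <- iota b.+1 (7 - b)] | b <- iota a.+1 (7 - a)] | a <- iota 1 7].
Definition supports : seq (seq nat) := Eval vm_compute in
  [::] :: triples ++ [seq [:: a] | a <- iota 1 7].
(* An orthogonal basis: 1 and the products of three distinct gammas are the 36
   symmetric matrices, the gammas the last 7. *)
Definition clifford_basis : seq imx := Eval vm_compute in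
  [seq foldr (fun a m => imx_mul (nth [::] gammas a.-1) m) imx1 s | s <- supports].

(* (n, m) stands for m / sqrt n, namely gamma_a and (gamma_a + gamma_(a+1)) / sqrt 2.
   These lie in Spin(7) and permute the Clifford basis up to sign. *)
Definition reflections : seq (nat * imx) := Eval vm_compute in
  [seq (1%N, m) | m <- gammas] ++
  [seq (2%N, imx_add (nth [::] gammas a) (nth [::] gammas a.+1)) | a <- iota 0 6].

Definition conj_imx (p m : imx) := imx_mul (imx_tr p) (imx_mul m p).
(** [find] returns 43, the size of the basis, when nothing matches; the search then goes through the
    negatives of the basis elements. *)
Definition image_of (p : nat * imx) (m : imx) : nat * bool :=
  let c := conj_imx p.2 m in
  let n : int := p.1%:R in
  let i := find (fun b => c == imx_scale n b) clifford_basis in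
  if (i < 43)%N then (i, false) else (find (fun b => c == imx_scale (- n) b) clifford_basis, true).
Definition images : seq (seq (nat * bool)) := Eval vm_compute in
  [seq [seq image_of p m | m <- clifford_basis] | p <- reflections].

Definition basis_image (r i : nat) : nat * bool := nth (0%N, false) (nth [::] images r) i.
Definition refl_scale (r : nat) : int := (nth (1%N, [::]) reflections r).1%:R.
Definition refl_mx (r : nat) : imx := (nth (1%N, [::]) reflections r).2.
Definition basis_mx (i : nat) : imx := nth [::] clifford_basis i.

Definition pair_sum (ms : seq imx) (a b c d : nat) : int :=
  foldr (fun m s => imx_get m a b * imx_get m c d + s) 0 ms.

Fact images_spec : all (fun r =>
    (imx_mul (imx_tr (refl_mx r)) (refl_mx r) == imx_scale (refl_scale r) imx1)
    && all (fun i => let: (j, s) := basis_image r i in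
       (j < 43)%N && ((j < 36) == (i < 36))%N &&
       (conj_imx (refl_mx r) (basis_mx i) ==
          imx_scale (if s then - refl_scale r else refl_scale r) (basis_mx j)))
      (iota 0 43))
  (iota 0 13).
Proof. by vm_compute. Qed.

Definition all4 (P : nat -> nat -> nat -> nat -> bool) : bool :=
  all (fun a => all (fun b => all (fun c => all (fun d => P a b c d)
    (iota 0 8)) (iota 0 8)) (iota 0 8)) (iota 0 8).

Fact sym_basis_complete : all4 (fun a b c d =>
  pair_sum (take 36 clifford_basis) a b c d ==
  4 * (((a == c) && (b == d))%:R + ((a == d) && (b == c))%:R)).
Proof. by vm_compute. Qed.

(** The right side is 8 times the projector onto [Lambda2_7], and each gamma has squared norm 8. The
    relation also recovers the Cayley form from the gammas, so membership in Spin(7) can be tested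
    on them. *)
Fact gammas_complete : all4 (fun a b c d =>
  pair_sum gammas a b c d ==
  ((a == c) && (b == d))%:R - ((a == d) && (b == c))%:R - cayley_int a b c d).
Proof. by vm_compute. Qed.

Fact reflections_gammas : all (fun r =>
    let ms := [seq conj_imx (refl_mx r) m | m <- gammas] in
    let n := refl_scale r in
    all4 (fun a b c d => pair_sum ms a b c d == n * n * pair_sum gammas a b c d))
  (iota 0 13).
Proof. by vm_compute. Qed.

Fact basis_symmetry :
  all (fun m => imx_tr m == m) (take 36 clifford_basis) && all (fun m => imx_tr m == imx_scale (-1) m) gammas
  && (drop 36 clifford_basis == gammas).
Proof. by vm_compute. Qed.

Fact gammas_J2 : all (fun m => all (fun p => all (fun q =>
    int_sum (fun a => int_sum (fun b => cayley_int p q a b * imx_get m a b)) ==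
    - 6 * imx_get m p q) (iota 0 8)) (iota 0 8)) gammas.
Proof. by vm_compute. Qed.

(* In the coordinates 1..7 of the vector representation, sorting a triple of
   supports by adjacent transpositions lowers this weight. *)
Definition support_weight (s : seq nat) : nat := sumn [seq (8 - a)%N | a <- s].
Definition weights : seq nat := Eval vm_compute in [seq support_weight s | s <- supports].
Definition weight (i : nat) : nat := nth 0%N weights i.
(** The coefficients 4, 2, 1 give each label a binary code recording which of the three supports
    contain it. Swapping two neighbouring labels changes the weight by the difference of their
    codes, so lowering the weight sorts the labels by code. *)
Definition triple_weight (t : nat * nat * nat) : nat :=
  (4 * weight t.1.1 + 2 * weight t.1.2 + weight t.2)%N.
Definition triple_image (r : nat) (t : nat * nat * nat) : nat * nat * nat * bool :=
  let: (i, j, l) := t in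
  let: (i', si) := basis_image r i in let: (j', sj) := basis_image r j in let: (l', sl) := basis_image r l in
  (i', j', l', si (+) sj (+) sl).
(** Either the triple returns to itself with sign -1, so that an invariant form vanishes on it, or
    it moves to a triple of lower weight. *)
Definition reducible_by (t : nat * nat * nat) (r : nat) : bool :=
  let: (t', s) := triple_image r t in
  if t' == t then s else (triple_weight t' < triple_weight t)%N.

(* Under vm_compute, has would evaluate both sides of each disjunction. *)
Fixpoint lazy_has (T : Type) (p : T -> bool) (s : seq T) : bool :=
  if s is x :: s' then if p x then true else lazy_has p s' else false.

(* Every basis triple reduces to one of these, on which the values of an invariant
   form match the six constants; the last one mirrors the fourth. *)
Definition normal_triples : seq (nat * nat * nat) :=
  [:: (0, 0, 0); (0, 35, 35); (0, 42, 42); (35, 0, 35); (35, 16, 36); (35, 28, 5);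
      (35, 35, 0)]%N.

Fact triples_reducible :
  all (fun i => all (fun j => all (fun l =>
    if (35 < j)%N && (l < 36)%N then true
    else if lazy_has (reducible_by (i, j, l)) (iota 0 13) then true
    else (i, j, l) \in normal_triples)
  (iota 0 43)) (iota 0 43)) (iota 0 36).
Proof. by vm_compute. Qed.

Section IntegerMatrices.
Context (R : realType).

Definition mxR (m : imx) : 'M[R]_8 := \matrix_(i, j) (imx_get m i j)%:~R.

Lemma imx_get_build f (i j : 'I_8) : imx_get (imx_build f) i j = f i j.
Proof.
by rewrite /imx_get /imx_build !(nth_map 0%N) ?size_iota// !nth_iota// !add0n.
Qed.

Lemma mxR_mul a b : mxR (imx_mul a b) = mxR a *m mxR b.
Proof.
apply/matrixP => i j; rewrite !mxE imx_get_build; apply/esym/int_sumE => k.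
by rewrite !mxE intrM.
Qed.

Lemma mxR_tr a : mxR (imx_tr a) = (mxR a)^T.
Proof. by apply/matrixP => i j; rewrite !mxE imx_get_build. Qed.

Lemma mxR_scale x a : mxR (imx_scale x a) = x%:~R *: mxR a.
Proof. by apply/matrixP => i j; rewrite !mxE imx_get_build intrM. Qed.

Lemma mxR1 : mxR imx1 = 1%:M.
Proof. by apply/matrixP => i j; rewrite !mxE imx_get_build rmorph_nat. Qed.

Lemma mxR_trace a : \tr (mxR a) = (imx_trace a)%:~R.
Proof. by apply: int_sumE => k; rewrite mxE. Qed.

Lemma pair_sumE ms (a b c d : 'I_8) :
  (pair_sum ms a b c d)%:~R = \sum_(m <- ms) mxR m a b * mxR m c d :> R.
Proof.
elim: ms => [|m ms IH]; first by rewrite big_nil.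
by rewrite big_cons -IH !mxE -intrM -intrD.
Qed.

Lemma all4P P : all4 P -> forall a b c d : 'I_8, P a b c d.
Proof. by move=> h a b c d; move: h => /all_iota8P/(_ a)/all_iota8P/(_ b)/all_iota8P/(_ c)/all_iota8P/(_ d). Qed.

Lemma mxR_conj p m : mxR (conj_imx p m) = conjmx8 (mxR p) (mxR m).
Proof. by rewrite /conj_imx !mxR_mul mxR_tr /conjmx8 mulmxA. Qed.

End IntegerMatrices.

(** * Elements of Spin(7) built from the gammas *)

Section Spin7Elements.
Context (R : realType).
Local Notation Phi0 := (cayley0 R).
Implicit Types (g u v K : 'M[R]_8).

Lemma gammas_cayley0 (a b c d : 'I_8) :
  \sum_(m <- gammas) mxR R m a b * mxR R m c d =
  delta R a c * delta R b d - delta R a d * delta R b c - Phi0 a b c d.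
Proof.
rewrite -pair_sumE; have /eqP -> := all4P gammas_complete a b c d.
by rewrite !rmorphB/= -cayley0_int !rmorph_nat -!mulnb !natrM.
Qed.

Lemma cayley0_gammas : Phi0 = fun a b c d =>
  delta4 R a b c d - \sum_(m <- gammas) mxR R m a b * mxR R m c d.
Proof. by apply: tensor4P => a b c d; rewrite gammas_cayley0 /delta4; ring. Qed.

Lemma pullback4_mul g (A B : 'M[R]_8) a b c d :
  pullback4 g (fun a b c d => A a b * B c d) a b c d = conjmx8 g A a b * conjmx8 g B c d.
Proof.
have E (m : 'M[R]_8) x y : conjmx8 g m x y = \sum_i \sum_j g i x * g j y * m i j.
  rewrite /conjmx8 mxE exchange_big; apply: eq_bigr => j _; rewrite mxE mulr_suml.
  by apply: eq_bigr => i _; rewrite mxE; ring.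
rewrite !E mulr_suml; apply: eq_bigr => i _; rewrite mulr_suml; apply: eq_bigr => j _.
rewrite mulr_sumr; apply: eq_bigr => k _; rewrite mulr_sumr; apply: eq_bigr => l _.
by ring.
Qed.

Lemma pullback4_sum g (T : Type) (r : seq T) (F : T -> tensor4 R) a b c d :
  pullback4 g (fun a b c d => \sum_(m <- r) F m a b c d) a b c d =
  \sum_(m <- r) pullback4 g (F m) a b c d.
Proof.
elim: r => [|m r IH].
  rewrite big_nil /pullback4 big1// => i _; rewrite big1// => j _; rewrite big1// => k _.
  by rewrite big1// => l _; rewrite big_nil mulr0.
rewrite big_cons -IH -pullback4D; congr (pullback4 g _ a b c d).
by apply: tensor4P => x y z t; rewrite big_cons.
Qed.

Lemma pullback4_delta4 g : g^T *m g = 1%:M -> pullback4 g (delta4 R) = delta4 R.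
Proof.
move=> gg; apply: tensor4P => a b c d.
have E x y : \sum_i g i x * g i y = delta R x y.
  have := congr1 (fun m : 'M_8 => m x y) gg; rewrite mxE [RHS]mxE /delta => <-.
  by apply: eq_bigr => i _; rewrite mxE.
rewrite /pullback4.
transitivity (\sum_i \sum_j \sum_k (delta R k i * (g i a * g j b * g k c * g j d)
    - delta R k j * (g i a * g j b * g k c * g i d))).
  apply: eq_bigr => i _; apply: eq_bigr => j _; apply: eq_bigr => k _.
  transitivity (\sum_l (delta R l j * (delta R k i * (g i a * g j b * g k c * g l d))
    - delta R l i * (delta R k j * (g i a * g j b * g k c * g l d)))).
    apply: eq_bigr => l _; rewrite /delta4 (deltaC R i k) (deltaC R j l) (deltaC R i l) (deltaC R j k).
    by ring.
  by rewrite sumrB !sum_delta.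
under eq_bigr do under eq_bigr do rewrite sumrB !sum_delta.
rewrite /delta4 -!E.
transitivity (\sum_i \sum_j (g i a * g i c * (g j b * g j d))
  - \sum_i \sum_j (g i a * g i d * (g j b * g j c))).
  rewrite -sumrB; apply: eq_bigr => i _; rewrite -sumrB; apply: eq_bigr => j _; ring.
by rewrite !mulr_suml; congr (_ - _); apply: eq_bigr => i _; rewrite mulr_sumr.
Qed.

Definition spin_reflection (r : nat) : 'M[R]_8 :=
  (Num.sqrt (refl_scale r)%:~R)^-1 *: mxR R (refl_mx r).

Lemma refl_scale_gt0 r : 0 < (refl_scale r)%:~R :> R.
Proof.
rewrite ltr0z /refl_scale.
have : all (fun p => 0 < p.1)%N reflections by vm_compute.
have [/(nth_default (1%N, [::])) -> //|rlt /all_nthP h] := leqP (size reflections) r.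
by have := h (1%N, [::]) _ rlt; rewrite ltr0n.
Qed.

(** A conjugation uses the element twice, so the square root disappears and only the integer scale
    is left. *)
Lemma spin_reflection_conj r (m : 'M[R]_8) : conjmx8 (spin_reflection r) m =
  (refl_scale r)%:~R^-1 *: conjmx8 (mxR R (refl_mx r)) m.
Proof.
rewrite /conjmx8 /spin_reflection [(_ *: _)^T]linearZ/= -!scalemxAl -scalemxAr scalerA -expr2.
by rewrite exprVn sqr_sqrtr// ltW// refl_scale_gt0.
Qed.

Lemma spin_reflection_orthogonal r : (r < 13)%N ->
  (spin_reflection r)^T *m spin_reflection r = 1%:M.
Proof.
move=> r13; have := spin_reflection_conj r 1%:M; rewrite {1}/conjmx8 mulmx1 => ->.
have /allP/(_ r) := images_spec; rewrite mem_iota r13 => /(_ isT)/andP[/eqP/(congr1 (mxR R))].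
rewrite mxR_mul mxR_tr mxR_scale mxR1 => e _.
by rewrite /conjmx8 mulmx1 e scalerA mulVf ?scale1r// gt_eqF// refl_scale_gt0.
Qed.

(** The form is [delta4] minus the sum of the tensor squares of the gammas. Orthogonality preserves
    the first term, and [reflections_gammas] preserves the second once the scale is divided out
    twice. *)
Lemma spin_reflection_spin7 r : (r < 13)%N -> spin7 Phi0 (spin_reflection r).
Proof.
move=> r13; have o := spin_reflection_orthogonal r13; split.
  by have [] := mulmx1_unit o.
set g := spin_reflection r in o *; pose G := fun a b c d : 'I_8 =>
  \sum_(m <- gammas) mxR R m a b * mxR R m c d.
apply: tensor4P => a b c d.
transitivity (pullback4 g (delta4 R) a b c d + - 1 * pullback4 g G a b c d).
  rewrite -pullback4Z -pullback4D; congr (pullback4 g _ a b c d).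
  by rewrite cayley0_gammas; apply: tensor4P => *; rewrite mulN1r.
rewrite pullback4_delta4// mulN1r [in RHS]cayley0_gammas; congr (_ - _); rewrite /G /g.
rewrite pullback4_sum; under eq_bigr do rewrite pullback4_mul !spin_reflection_conj -!mxR_conj.
have n0 : (refl_scale r)%:~R != 0 :> R by rewrite gt_eqF// refl_scale_gt0.
have /allP/(_ r) := reflections_gammas; rewrite mem_iota r13 => /(_ isT)/all4P/(_ a b c d)/eqP.
move=> /(congr1 (fun z : int => z%:~R : R)); rewrite !intrM !pair_sumE big_map => e.
transitivity ((refl_scale r)%:~R^-1 * (refl_scale r)%:~R^-1 *
  \sum_(m <- gammas) mxR R (conj_imx (refl_mx r) m) a b * mxR R (conj_imx (refl_mx r) m) c d).
  by rewrite mulr_sumr; apply: eq_bigr => m _; rewrite !mxE; ring.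
by rewrite e -!mulrA mulKf ?mulKf.
Qed.

End Spin7Elements.

(** * Invariant forms on the fields *)

Definition trace3 (i j l : nat) : int :=
  imx_trace (imx_mul (basis_mx i) (imx_mul (basis_mx j) (basis_mx l))).
Definition trace2 (i j : nat) : int := imx_trace (imx_mul (basis_mx i) (basis_mx j)).
Definition trace1 (i : nat) : int := imx_trace (basis_mx i).

Section InvariantForms.
Context (R : realType).
Local Notation Phi0 := (cayley0 R).
Local Notation M8 := 'M[R]_8.
Implicit Types (g u v K h xi : M8).

(** A pair [(h, xi)] is carried as the single matrix [h + xi]; the symmetric and skew parts recover
    it and make all forms total on matrices. *)
Definition sym_part u : M8 := 2^-1 *: (u + u^T).
Definition skew_part u : M8 := 2^-1 *: (u - u^T).

Lemma sym_part_linear x u v : sym_part (x *: u + v) = x *: sym_part u + sym_part v.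
Proof. by apply/matrixP => i j; rewrite !mxE; ring. Qed.

Lemma skew_part_linear x u v : skew_part (x *: u + v) = x *: skew_part u + skew_part v.
Proof. by apply/matrixP => i j; rewrite !mxE; ring. Qed.

Lemma sym_part_conj g u : sym_part (conjmx8 g u) = conjmx8 g (sym_part u).
Proof.
rewrite /sym_part /conjmx8 !trmx_mul trmxK -!scalemxAr -scalemxAl.
by rewrite mulmxDr mulmxDl mulmxA.
Qed.

Lemma skew_part_conj g u : skew_part (conjmx8 g u) = conjmx8 g (skew_part u).
Proof.
rewrite /skew_part /conjmx8 !trmx_mul trmxK -!scalemxAr -scalemxAl.
by rewrite mulmxBr mulmxBl mulmxA.
Qed.

Lemma sym_partE h xi : h^T = h -> xi^T = - xi -> sym_part (h + xi) = h.
Proof. by move=> hs xs; rewrite /sym_part [(h + xi)^T]linearD/= hs xs; apply/matrixP => i j; rewrite !mxE; field. Qed.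

Lemma skew_partE h xi : h^T = h -> xi^T = - xi -> skew_part (h + xi) = xi.
Proof. by move=> hs xs; rewrite /skew_part [(h + xi)^T]linearD/= hs xs; apply/matrixP => i j; rewrite !mxE; field. Qed.

(** The polar form of the symbol. The [beta] term has the sign opposite to the Lagrangian, because
    there both derivatives fall on one factor. The transposes on [x] and [x'] let traces stand for
    inner products of skew matrices. *)
Definition quadratic_form (rho alpha beta gamma lambda mu : R) (K h x h' x' : M8) : R :=
    rho / 2 * (\tr K * \tr (h *m h')) + alpha / 2 * (\tr K * (\tr h * \tr h'))
  + beta / 2 * (\tr h * \tr (K *m h') + \tr h' * \tr (K *m h))
  - gamma / 2 * (\tr (K *m (h *m h')) + \tr (K *m (h' *m h)))
  + lambda / 2 * (\tr K * \tr (x *m x'^T))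
  - mu / 2 * (\tr (K *m (h *m x'^T)) + \tr (K *m (h' *m x^T))).

(* K stands for the square k k^T of the momentum, u and v for sums h + xi *)
Definition general_form (rho alpha beta gamma lambda mu : R) (K u v : M8) : R :=
  quadratic_form rho alpha beta gamma lambda mu K
    (sym_part u) (skew_part u) (sym_part v) (skew_part v).

Lemma general_formC rho alpha beta gamma lambda mu K u v :
  general_form rho alpha beta gamma lambda mu K u v =
  general_form rho alpha beta gamma lambda mu K v u.
Proof.
rewrite /general_form /quadratic_form (mxtrace_mulC (sym_part u)).
rewrite -[\tr (skew_part u *m (skew_part v)^T)]mxtrace_tr trmx_mul trmxK.
move: (sym_part u) (skew_part u) (sym_part v) (skew_part v) => h x h' x'.
by move: (\tr _) (\tr _) (\tr _) (\tr _) (\tr _) => *; ring.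
Qed.

Let trD (A B : M8) : (A + B)^T = A^T + B^T. Proof. by rewrite linearD. Qed.
Let trZ x (A : M8) : (x *: A)^T = x *: A^T. Proof. by rewrite linearZ. Qed.

Lemma general_form_linearl rho alpha beta gamma lambda mu u v x K K' :
  general_form rho alpha beta gamma lambda mu (x *: K + K') u v =
  x * general_form rho alpha beta gamma lambda mu K u v +
  general_form rho alpha beta gamma lambda mu K' u v.
Proof.
rewrite /general_form; move: (sym_part u) (skew_part u) (sym_part v) (skew_part v) => h y h' y'.
rewrite /quadratic_form !mulmxDl -!scalemxAl !mxtraceD !mxtraceZ.
set a1 := \tr K; set a2 := \tr K'; set b1 := \tr (K *m h'); set b2 := \tr (K' *m h').
set c1 := \tr (K *m h); set c2 := \tr (K' *m h).
set d1 := \tr (K *m (h *m h')); set d2 := \tr (K' *m (h *m h')).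
set e1 := \tr (K *m (h' *m h)); set e2 := \tr (K' *m (h' *m h)).
set f1 := \tr (K *m (h *m y'^T)); set f2 := \tr (K' *m (h *m y'^T)).
set g1 := \tr (K *m (h' *m y^T)); set g2 := \tr (K' *m (h' *m y^T)).
clearbody a1 a2 b1 b2 c1 c2 d1 d2 e1 e2 f1 f2 g1 g2.
move: (\tr (h *m h')) (\tr h) (\tr h') (\tr (y *m y'^T)) => *; ring.
Qed.

Lemma general_form_linearm rho alpha beta gamma lambda mu K v x u u' :
  general_form rho alpha beta gamma lambda mu K (x *: u + u') v =
  x * general_form rho alpha beta gamma lambda mu K u v +
  general_form rho alpha beta gamma lambda mu K u' v.
Proof.
rewrite /general_form sym_part_linear skew_part_linear.
move: (sym_part u) (skew_part u) (sym_part u') (skew_part u') (sym_part v) (skew_part v).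
move=> h y h' y' k z; rewrite /quadratic_form trD trZ.
rewrite !(mulmxDl, mulmxDr) -!scalemxAl -!scalemxAr !mxtraceD !mxtraceZ.
set a1 := \tr (h *m k); set a2 := \tr (h' *m k); set b1 := \tr h; set b2 := \tr h'.
set c1 := \tr (K *m h); set c2 := \tr (K *m h').
set d1 := \tr (K *m (h *m k)); set d2 := \tr (K *m (h' *m k)).
set e1 := \tr (K *m (k *m h)); set e2 := \tr (K *m (k *m h')).
set f1 := \tr (K *m (h *m z^T)); set f2 := \tr (K *m (h' *m z^T)).
set g1 := \tr (K *m (k *m y^T)); set g2 := \tr (K *m (k *m y'^T)).
set i1 := \tr (y *m z^T); set i2 := \tr (y' *m z^T).
clearbody a1 a2 b1 b2 c1 c2 d1 d2 e1 e2 f1 f2 g1 g2 i1 i2.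
move: (\tr K) (\tr (K *m k)) (\tr k) => *; ring.
Qed.

Lemma mxtrace_conj g m : g *m g^T = 1%:M -> \tr (conjmx8 g m) = \tr m.
Proof. by move=> gg; rewrite /conjmx8 mxtrace_mulC mulmxA gg mul1mx. Qed.

Lemma conjmx8M g m n : g *m g^T = 1%:M -> conjmx8 g m *m conjmx8 g n = conjmx8 g (m *m n).
Proof.
by move=> gg; rewrite /conjmx8 -!mulmxA (mulmxA g g^T) gg mul1mx.
Qed.

Lemma conjmx8_tr g m : (conjmx8 g m)^T = conjmx8 g m^T.
Proof. by rewrite /conjmx8 !trmx_mul trmxK mulmxA. Qed.

Lemma general_form_conj rho alpha beta gamma lambda mu g K u v : g^T *m g = 1%:M ->
  general_form rho alpha beta gamma lambda mu (conjmx8 g K) (conjmx8 g u) (conjmx8 g v) =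
  general_form rho alpha beta gamma lambda mu K u v.
Proof.
move=> /mulmx1C gg; rewrite /general_form /quadratic_form !sym_part_conj !skew_part_conj !conjmx8_tr.
by rewrite !conjmx8M// !mxtrace_conj.
Qed.

Definition basisR (i : nat) : M8 := mxR R (basis_mx i).

Lemma basis_sym (i : nat) : (i < 36)%N -> (basisR i)^T = basisR i.
Proof.
move=> i36; have /andP[/andP[/allP h _] _] := basis_symmetry.
rewrite -mxR_tr; congr mxR; apply/eqP/h; rewrite /basis_mx -(nth_take _ i36).
by apply: mem_nth.
Qed.

Lemma basis_gamma (i : nat) : (i < 7)%N -> basisR (36 + i) = mxR R (nth [::] gammas i).
Proof.
move=> i7; have /andP[_ /eqP <-] := basis_symmetry.
by rewrite nth_drop.
Qed.

Lemma gamma_skew m : m \in gammas -> (mxR R m)^T = - mxR R m.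
Proof.
move=> mg; have /andP[/andP[_ /allP h] _] := basis_symmetry.
by rewrite -mxR_tr (eqP (h _ mg)) mxR_scale mulrN1z scaleN1r.
Qed.

Lemma gamma_Lambda2_7 m : m \in gammas -> Lambda2_7 Phi0 1%:M (mxR R m).
Proof.
move=> mg; split; first exact: gamma_skew.
rewrite J2_cayley0; apply/matrixP => p q; rewrite 3!mxE.
have /allP/(_ _ mg)/all_iota8P/(_ p)/all_iota8P/(_ q)/eqP/(congr1 (fun z : int => z%:~R : R)) := gammas_J2.
rewrite intrM => e; transitivity (2^-1 * (- 6 * (imx_get m p q)%:~R : R)); last first.
  by rewrite !mxE; field.
congr (_ * _); rewrite -[- 6]/((- 6)%:~R) -e.
apply: int_sumE => a; apply: int_sumE => b; by rewrite cayley0_int mxE intrM.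
Qed.

Definition field_space u := exists h xi, [/\ h^T = h, Lambda2_7 Phi0 1%:M xi & u = h + xi].

Lemma basis_field_space i : (i < 43)%N -> field_space (basisR i).
Proof.
move=> i43; have [i36|i36] := ltnP i 36.
  exists (basisR i), 0; split; [exact: basis_sym| |by rewrite addr0].
  by split; rewrite ?trmx0 ?oppr0// J20 scaler0.
rewrite -(subnKC i36) basis_gamma; last by lia.
exists 0, (mxR R (nth [::] gammas (i - 36))); split; rewrite ?trmx0 ?add0r//.
by apply: gamma_Lambda2_7; apply: mem_nth; rewrite [size _]/=; lia.
Qed.

(** This is the completeness relation [sym_basis_complete] contracted with [K]; 8 is the squared
    norm of each basis matrix. *)
Lemma sym_expand K : K^T = K ->
  K = \sum_(i < 36) (8^-1 * \tr (basisR i *m K)) *: basisR i.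
Proof.
move=> Ks; have i4 : (4 : int)%:~R = 4 :> R by rewrite rmorph_nat.
have KsE c d : K c d = K d c by rewrite -[in LHS]Ks mxE.
apply/matrixP => a b.
have -> : \sum_(i < 36) (8^-1 * \tr (basisR i *m K)) *: basisR i =
    \sum_(m <- take 36 clifford_basis) (8^-1 * \tr (mxR R m *m K)) *: mxR R m.
  rewrite (big_nth [::]) big_mkord; apply: eq_bigr => i _.
  by rewrite nth_take.
rewrite summxE.
transitivity (\sum_c \sum_d 8^-1 * K d c * \sum_(m <- take 36 clifford_basis) mxR R m c d * mxR R m a b).
  transitivity (\sum_c \sum_d 2^-1 * K d c * (delta R c a * delta R d b + delta R c b * delta R d a)).
    transitivity (\sum_c (delta R c a * (2^-1 * K b c) + delta R c b * (2^-1 * K a c))).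
      by rewrite big_split/= !sum_delta (KsE b a); field.
    apply: eq_bigr => c _.
    rewrite -(sum_delta b (fun d => delta R c a * (2^-1 * K d c))).
    rewrite -(sum_delta a (fun d => delta R c b * (2^-1 * K d c))) -big_split.
    by apply: eq_bigr => d _ /=; ring.
  apply: eq_bigr => c _; apply: eq_bigr => d _.
  rewrite -pair_sumE (eqP (all4P sym_basis_complete c d a b)) intrM i4 intrD !rmorph_nat -!mulnb !natrM.
  by rewrite /delta; field.
under eq_bigr do under eq_bigr do rewrite mulr_sumr.
under eq_bigr do rewrite exchange_big.
rewrite exchange_big; apply: eq_bigr => m _; rewrite [RHS]mxE /mxtrace mulr_sumr [RHS]mulr_suml.
apply: eq_bigr => c _; rewrite [(_ *m _) c c]mxE mulr_sumr [RHS]mulr_suml.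
by apply: eq_bigr => d _; ring.
Qed.

(** The gammas resolve 8 times the projector, and the term in the Cayley form is evaluated by the
    eigenvalue equation of [xi]. *)
Lemma Lambda2_7_expand xi : Lambda2_7 Phi0 1%:M xi ->
  xi = \sum_(i < 7) (8^-1 * \tr ((basisR (36 + i))^T *m xi)) *: basisR (36 + i).
Proof.
move=> [xs x7]; have xsE c d : xi d c = - xi c d by rewrite -[xi in LHS]trmxK xs !mxE.
apply/matrixP => a b.
have -> : \sum_(i < 7) (8^-1 * \tr ((basisR (36 + i))^T *m xi)) *: basisR (36 + i) =
    \sum_(m <- gammas) (8^-1 * \tr ((mxR R m)^T *m xi)) *: mxR R m.
  rewrite [RHS](big_nth [::]) big_mkord; apply: eq_bigr => i _.
  by rewrite basis_gamma.
rewrite summxE.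
transitivity (\sum_c \sum_d 8^-1 * xi c d * \sum_(m <- gammas) mxR R m a b * mxR R m c d).
  have e : \sum_p \sum_q Phi0 a b p q * xi p q = - 6 * xi a b.
    have := congr1 (fun m : M8 => m a b) x7; rewrite J2_cayley0 3!mxE => ?; lra.
  transitivity (\sum_c (delta R c a * (8^-1 * xi c b) - delta R c b * (8^-1 * xi c a)
      - 8^-1 * \sum_d Phi0 a b c d * xi c d)).
    by rewrite !sumrB -mulr_sumr !sum_delta e (xsE a b); field.
  apply: eq_bigr => c _.
  rewrite -(sum_delta b (fun d => delta R c a * (8^-1 * xi c d))).
  rewrite -(sum_delta a (fun d => delta R c b * (8^-1 * xi c d))) mulr_sumr -!sumrB.
  apply: eq_bigr => d _ /=; rewrite gammas_cayley0.
  by rewrite (deltaC R a c) (deltaC R b d) (deltaC R b c) (deltaC R a d); ring.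
under eq_bigr do under eq_bigr do rewrite mulr_sumr.
under eq_bigr do rewrite exchange_big.
rewrite exchange_big; apply: eq_bigr => m _; rewrite [RHS]mxE /mxtrace mulr_sumr [RHS]mulr_suml.
rewrite exchange_big; apply: eq_bigr => c _; rewrite [(_ *m _) c c]mxE mulr_sumr [RHS]mulr_suml.
by apply: eq_bigr => d _; rewrite [_^T _ _]mxE; ring.
Qed.

End InvariantForms.

(** * Classification by elimination on basis triples *)

Section Classification.
Context (R : realType).
Local Notation Phi0 := (cayley0 R).
Local Notation M8 := 'M[R]_8.
Local Notation bR := (basisR R).
Implicit Types (g u v K h xi : M8).

Lemma linear_sums (f : M8 -> R) (J : Type) (r : seq J) (c : J -> R) (m : J -> M8) :
  (forall x u v, f (x *: u + v) = x * f u + f v) ->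
  f (\sum_(j <- r) c j *: m j) = \sum_(j <- r) c j * f (m j).
Proof.
move=> fl; elim: r => [|j r IH]; last by rewrite !big_cons fl IH.
rewrite !big_nil; have := fl 1 0 0; rewrite scaler0 addr0 mul1r => ?; lra.
Qed.

Lemma sym_part_basis i : (i < 36)%N -> sym_part (bR i) = bR i.
Proof.
move=> i36; rewrite -[bR i in LHS]addr0 sym_partE ?trmx0 ?oppr0//.
exact: basis_sym.
Qed.

Lemma skew_part_basis i : (i < 36)%N -> skew_part (bR i) = 0.
Proof.
move=> i36; rewrite -[bR i]addr0 skew_partE ?trmx0 ?oppr0//.
exact: basis_sym.
Qed.

Lemma basis_skew i : (35 < i < 43)%N -> (bR i)^T = - bR i.
Proof.
move=> /andP[i36 i43]; rewrite -(subnKC i36) basis_gamma; last by lia.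
by apply: gamma_skew; apply: mem_nth; rewrite [size _]/=; lia.
Qed.

Lemma sym_part_gamma i : (35 < i < 43)%N -> sym_part (bR i) = 0.
Proof. by move=> i36; rewrite -[bR i]add0r sym_partE ?trmx0// basis_skew. Qed.

Lemma skew_part_gamma i : (35 < i < 43)%N -> skew_part (bR i) = bR i.
Proof. by move=> i36; rewrite -[bR i in LHS]add0r skew_partE ?trmx0// basis_skew. Qed.

Lemma trace1E i : \tr (bR i) = (trace1 i)%:~R. Proof. exact: mxR_trace. Qed.

Lemma trace2E i j : \tr (bR i *m bR j) = (trace2 i j)%:~R.
Proof. by rewrite -mxR_mul mxR_trace. Qed.

Lemma trace3E i j l : \tr (bR i *m (bR j *m bR l)) = (trace3 i j l)%:~R.
Proof. by rewrite -!mxR_mul mxR_trace. Qed.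

Let trN (A : M8) : \tr (- A) = - \tr A. Proof. exact: linearN. Qed.

Section Values.
Context (rho alpha beta gamma lambda mu : R).
Local Notation gen := (general_form rho alpha beta gamma lambda mu).

Lemma general_form_sym i j l : (j < 36)%N -> (l < 36)%N -> gen (bR i) (bR j) (bR l) =
  rho / 2 * ((trace1 i)%:~R * (trace2 j l)%:~R)
  + alpha / 2 * ((trace1 i)%:~R * ((trace1 j)%:~R * (trace1 l)%:~R))
  + beta / 2 * ((trace1 j)%:~R * (trace2 i l)%:~R + (trace1 l)%:~R * (trace2 i j)%:~R)
  - gamma / 2 * ((trace3 i j l)%:~R + (trace3 i l j)%:~R).
Proof.
move=> j36 l36; rewrite /general_form !sym_part_basis// !skew_part_basis// /quadratic_form.
rewrite trmx0 !mulmx0 mxtrace0 !trace3E !trace2E !trace1E; ring.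
Qed.

Lemma general_form_mixed i j l : (j < 36)%N -> (35 < l < 43)%N -> gen (bR i) (bR j) (bR l) =
  mu / 2 * (trace3 i j l)%:~R.
Proof.
move=> j36 l36; rewrite /general_form sym_part_basis// skew_part_basis// sym_part_gamma//.
rewrite skew_part_gamma// /quadratic_form basis_skew//.
by rewrite !(mulmxN, mulmx0, mul0mx, trmx0) !mxtrace0 ?trN trace3E; ring.
Qed.

Lemma general_form_gamma i j l : (35 < j < 43)%N -> (35 < l < 43)%N -> gen (bR i) (bR j) (bR l) =
  - (lambda / 2) * ((trace1 i)%:~R * (trace2 j l)%:~R).
Proof.
move=> j36 l36; rewrite /general_form !sym_part_gamma// !skew_part_gamma// /quadratic_form.
rewrite !basis_skew// !(mulmxN, mulmx0, mul0mx) !mxtrace0 ?trN trace1E trace2E; ring.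
Qed.

End Values.

Lemma image_basis r i : (r < 13)%N -> (i < 43)%N ->
  let: (j, s) := basis_image r i in
  [/\ (j < 43)%N, (j < 36)%N = (i < 36)%N &
      conjmx8 (spin_reflection R r) (bR i) = (-1) ^+ s *: bR j].
Proof.
move=> r13 i43; have /allP/(_ r) := images_spec; rewrite mem_iota r13 => /(_ isT)/andP[_].
move=> /allP/(_ i); rewrite mem_iota i43 => /(_ isT); case: basis_image => j s.
move=> /andP[/andP[j43 /eqP j36] /eqP/(congr1 (mxR R))]; rewrite mxR_conj mxR_scale => e.
split=> //; rewrite spin_reflection_conj e scalerA.
have n0 : (refl_scale r)%:~R != 0 :> R by rewrite gt_eqF// refl_scale_gt0.
by case: s {e}; rewrite ?expr1 ?expr0 ?rmorphN ?mulrN mulVf.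
Qed.

Section Induction.
Context (D : M8 -> M8 -> M8 -> R).
Context (Dl : forall u v x K K', D (x *: K + K') u v = x * D K u v + D K' u v).
Context (Dm : forall K v x u u', D K (x *: u + u') v = x * D K u v + D K u' v).
Context (DC : forall K u v, D K u v = D K v u).
Context (Dinv : forall g, spin7 Phi0 g -> forall K u v, K^T = K ->
  field_space u -> field_space v ->
  D (conjmx8 g K) (conjmx8 g u) (conjmx8 g v) = D K u v).
Context (D0 : forall t, t \in normal_triples -> D (bR t.1.1) (bR t.1.2) (bR t.2) = 0).

Let DlZ x K u v : D (x *: K) u v = x * D K u v.
Proof.
have D00 : D 0 u v = 0 by have := Dl u v 1 0 0; rewrite scaler0 addr0 mul1r => ?; lra.
by rewrite -[x *: K]addr0 Dl D00 addr0.
Qed.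

Let DmZ x K u v : D K (x *: u) v = x * D K u v.
Proof.
have D00 : D K 0 v = 0 by have := Dm K v 1 0 0; rewrite scaler0 addr0 mul1r => ?; lra.
by rewrite -[x *: u]addr0 Dm D00 addr0.
Qed.

Lemma invariant_image r i j l : (r < 13)%N -> (i < 36)%N -> (j < 43)%N -> (l < 43)%N ->
  let: (i', j', l', s) := triple_image r (i, j, l) in
  [/\ (i' < 36)%N, (j' < 43)%N, (l' < 43)%N,
    ((35 < j') && (l' < 36))%N = ((35 < j) && (l < 36))%N &
    D (bR i) (bR j) (bR l) = (-1) ^+ s * D (bR i') (bR j') (bR l')].
Proof.
move=> r13 i36 j43 l43; rewrite /triple_image.
have := image_basis r13 (ltn_trans i36 (isT : (36 < 43)%N)); case: (basis_image r i) => i' si.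
have := image_basis r13 j43; case: (basis_image r j) => j' sj.
have := image_basis r13 l43; case: (basis_image r l) => l' sl.
move=> [l43' l36 el] [j43' j36 ej] [_ i36' ei].
split=> //; first by rewrite i36'.
  by rewrite l36 (ltnNge 35 j') (ltnNge 35 j) -[(j' <= 35)%N]/(j' < 36)%N j36.
have := Dinv (spin_reflection_spin7 R r13) (basis_sym R i36) (basis_field_space R j43)
  (basis_field_space R l43).
rewrite ei ej el DlZ DmZ DC DmZ DC => <-; rewrite !mulrA !signr_addb.
by case: si {ei}; case: sj {ej}; case: sl {el}; rewrite ?expr0 ?expr1; ring.
Qed.

(** Induction on the weight: a reduction shows the value to be its own negative, or up to sign a
    value at lower weight. Irreducible triples are normal and fall under [D0]; triples whose last
    two slots are in the wrong order are exchanged first. *)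
Lemma invariant_basis_eq0 i j l : (i < 36)%N -> (j < 43)%N -> (l < 43)%N ->
  D (bR i) (bR j) (bR l) = 0.
Proof.
wlog ord : j l / ~~ ((35 < j) && (l < 36))%N.
  move=> wl i36 j43 l43; have [/andP[j36 l36]|n] := boolP ((35 < j) && (l < 36))%N; last exact: wl.
  by rewrite DC; apply: wl => //; rewrite ltnNge -ltnS l36.
have [n] := ubnP (triple_weight (i, j, l)); elim: n i j l ord => // n IH i j l ord.
rewrite ltnS => wn i36 j43 l43.
have := triples_reducible.
move=> /allP/(_ i); rewrite mem_iota => /(_ i36)/allP/(_ j); rewrite mem_iota => /(_ j43).
move=> /allP/(_ l); rewrite mem_iota => /(_ l43); rewrite (negPf ord).
have lh (p : pred nat) s : lazy_has p s -> exists2 r, r \in s & p r.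
  elim: s => //= x s IHs; case: ifP => [px _|_ /IHs [r rs pr]].
    by exists x; rewrite ?mem_head.
  by exists r => //; rewrite in_cons rs orbT.
case: ifP => [/lh[r]|_ /D0//]; rewrite mem_iota/= => r13; rewrite /reducible_by.
have := invariant_image r13 i36 j43 l43.
case: (triple_image r (i, j, l)) => [[[i' j'] l'] s] [i36' j43' l43' ord' e].
case: ifP => [/eqP[ei ej el] s1|_ w].
  by move: e; rewrite ei ej el s1 expr1 mulN1r => ?; lra.
by rewrite e IH ?mulr0 ?ord'//; apply: leq_trans w wn.
Qed.

Lemma invariant_eq0 K u v : K^T = K -> field_space u -> field_space v -> D K u v = 0.
Proof.
move=> Ks uf vf.
have step (f : M8 -> R) : (forall x u v, f (x *: u + v) = x * f u + f v) ->
    (forall j, (j < 43)%N -> f (bR j) = 0) -> forall u, field_space u -> f u = 0.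
  move=> fl f0 _ [h [xi [hs x7 ->]]].
  rewrite -[h]scale1r fl mul1r (sym_expand hs) (Lambda2_7_expand x7) !linear_sums//.
  rewrite big1 ?add0r ?big1// => i _; rewrite f0 ?mulr0//.
    by rewrite -[43%N]/(36 + 7)%N ltn_add2l.
  by apply: ltn_trans (ltn_ord i) _.
rewrite (sym_expand Ks) (linear_sums _ _ _ (Dl u v)) big1// => i _.
rewrite (step (fun u => D (bR i) u v)) ?mulr0// => j j43.
rewrite (step (fun v => D (bR i) (bR j) v))// => [x w w'|l l43].
  by rewrite DC Dm !(DC _ _ (bR j)).
exact: invariant_basis_eq0.
Qed.

End Induction.

Fact trace_values :
  trace1 0 = 8 /\
  trace1 35 = 0 /\
  trace2 0 0 = 8 /\
  trace2 35 35 = 8 /\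
  trace2 42 42 = - 8 /\
  trace2 35 0 = 0 /\
  trace2 28 5 = 0 /\
  trace2 0 35 = 0 /\
  trace2 35 28 = 0 /\
  trace2 35 5 = 0 /\
  trace3 0 0 0 = 8 /\
  trace3 0 35 35 = 8 /\
  trace3 35 0 35 = 8 /\
  trace3 35 35 0 = 8 /\
  trace3 35 16 36 = 8 /\
  trace3 35 28 5 = 8 /\
  trace3 35 5 28 = 8.
Proof. by vm_compute. Qed.

Opaque trace1 trace2 trace3 basisR.

Theorem invariant_form_classification (Q : M8 -> M8 -> M8 -> R) :
    (forall u v x K K', Q (x *: K + K') u v = x * Q K u v + Q K' u v) ->
    (forall K v x u u', Q K (x *: u + u') v = x * Q K u v + Q K u' v) ->
    (forall K u v, Q K u v = Q K v u) ->
    (forall g, spin7 Phi0 g -> forall K u v, K^T = K ->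
       field_space u -> field_space v ->
       Q (conjmx8 g K) (conjmx8 g u) (conjmx8 g v) = Q K u v) ->
  exists rho alpha beta gamma lambda mu, forall K u v, K^T = K ->
    field_space u -> field_space v ->
    Q K u v = general_form rho alpha beta gamma lambda mu K u v.
Proof.
move=> Ql Qm QC Qinv.
(* As supports, 0 is the empty set, 35 is {5,6,7} and 42 is {7}; (35,16,36) is {5,6,7}, {2,3,4},
   {1}, and (35,28,5) is {5,6,7}, {3,4,7}, {1,2,7}. In the last two cases the labels multiply up to
   all seven gammas, whose product is scalar, so the trace of the product does not vanish. *)
pose q i j l := Q (bR i) (bR j) (bR l).
have [q1 E1] : {x | x = q 0 0 0} by eexists.
have [q2 E2] : {x | x = q 0 35 35} by eexists.
have [q3 E3] : {x | x = q 0 42 42} by eexists.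
have [q4 E4] : {x | x = q 35 0 35} by eexists.
have [q5 E5] : {x | x = q 35 16 36} by eexists.
have [q6 E6] : {x | x = q 35 28 5} by eexists.
(* The system is triangular: the general form takes the values [- 8 gamma] for [q6],
   [32 rho - 8 gamma] for [q2], [32 lambda] for [q3], [32 beta - 8 gamma] for [q4], [4 mu] for [q5]
   and [32 rho + 256 alpha + 64 beta - 8 gamma] for [q1]. *)
pose gamma := - q6 / 8.
pose rho := (q2 + 8 * gamma) / 32.
pose lambda := q3 / 32.
pose beta := (q4 + 8 * gamma) / 32.
pose mu := q5 / 4.
pose alpha := (q1 - 32 * rho - 64 * beta + 8 * gamma) / 256.
exists rho, alpha, beta, gamma, lambda, mu => K u v Ks uf vf.
apply/eqP; rewrite -subr_eq0; apply/eqP; move: K u v Ks uf vf.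
pose gen := general_form rho alpha beta gamma lambda mu.
apply: (@invariant_eq0 (fun K u v => Q K u v - gen K u v)).
- by move=> u v x K K'; rewrite Ql /gen general_form_linearl; ring.
- by move=> K v x u u'; rewrite Qm /gen general_form_linearm; ring.
- by move=> K u v; rewrite QC /gen general_formC.
- move=> g gs K u v Ks uf vf; rewrite Qinv// /gen general_form_conj//.
  exact: spin7_cayley0_orthogonal.
have [a1 [a2 [b1 [b2 [b3 [b4 [b5 [b6 [b7 [b8 [c1 [c2 [c3 [c4 [c5 [c6 c7]]]]]]]]]]]]]]]] := trace_values.
have i8 : (8 : int)%:~R = 8 :> R by rewrite rmorph_nat.
have v1 : q1 = gen (bR 0) (bR 0) (bR 0).
  rewrite /gen general_form_sym; [|exact: isT|exact: isT]; rewrite a1 b1 c1 i8 /alpha; by field.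
have v2 : q2 = gen (bR 0) (bR 35) (bR 35).
  rewrite /gen general_form_sym; [|exact: isT|exact: isT]; rewrite a1 a2 b2 b6 c2 i8 /rho; by field.
have v3 : q3 = gen (bR 0) (bR 42) (bR 42).
  rewrite /gen general_form_gamma; [|exact: isT|exact: isT]; rewrite a1 b3 rmorphN i8 /lambda; by field.
have v4 : q4 = gen (bR 35) (bR 0) (bR 35).
  rewrite /gen general_form_sym; [|exact: isT|exact: isT]; rewrite a1 a2 b2 b4 b6 c3 c4 i8 /beta; by field.
have v5 : q5 = gen (bR 35) (bR 16) (bR 36).
  rewrite /gen general_form_mixed; [|exact: isT|exact: isT]; rewrite c5 i8 /mu; by field.
have v6 : q6 = gen (bR 35) (bR 28) (bR 5).
  rewrite /gen general_form_sym; [|exact: isT|exact: isT]; rewrite a2 b5 b7 b8 c6 c7 i8 /gamma; by field.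
move=> t; rewrite !inE => /or4P[/eqP->|/eqP->|/eqP->|/or4P[/eqP->|/eqP->|/eqP->|/eqP->]]; apply/eqP;
  rewrite subr_eq0; apply/eqP.
- rewrite -[LHS]E1; exact: v1.
- rewrite -[LHS]E2; exact: v2.
- rewrite -[LHS]E3; exact: v3.
- rewrite -[LHS]E4; exact: v4.
- rewrite -[LHS]E5; exact: v5.
- rewrite -[LHS]E6; exact: v6.
- rewrite QC /gen general_formC -[LHS]E4; exact: v4.
Qed.

End Classification.

(** * Partial derivatives *)

Section Partials.
Context (R : realType).
Local Notation V := (pt8 R).
Implicit Types (f g : V -> R) (x y v : V).

Lemma derive_along f y v (s : R) : derivable f (y + s *: v) v ->
  is_derive s 1 (fun t : R => f (y + t *: v)) ('D_v f (y + s *: v)).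
Proof.
move=> df.
have E : (fun h : R => h^-1 *: (((fun t : R => f (y + t *: v)) \o shift s) (h *: (1 : R)) - f (y + s *: v)))
   = (fun h => h^-1 *: ((f \o shift (y + s *: v)) (h *: v) - f (y + s *: v))).
  apply/funext => h /=; congr (_ *: (f _ - _)).
  by rewrite [h *: 1]mulr1 scalerDl addrCA.
by apply: DeriveDef; [rewrite /derivable E|rewrite /derive E].
Qed.

Lemma derive_along_uniq f y v (s d : R) : is_derive s 1 (fun t : R => f (y + t *: v)) d ->
  'D_v f (y + s *: v) = d.
Proof.
move=> [_ <-].
have E : (fun h : R => h^-1 *: (((fun t : R => f (y + t *: v)) \o shift s) (h *: (1 : R)) - f (y + s *: v)))
   = (fun h => h^-1 *: ((f \o shift (y + s *: v)) (h *: v) - f (y + s *: v))).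
  apply/funext => h /=; congr (_ *: (f _ - _)).
  by rewrite [h *: 1]mulr1 scalerDl addrCA.
by rewrite /derive E.
Qed.

Lemma mean_value_along f y v (h : R) : (forall x, differentiable f x) -> 0 < h ->
  exists2 s, 0 < s < h & f (y + h *: v) - f y = h * 'D_v f (y + s *: v).
Proof.
move=> df h0.
have dfs (s : R) : is_derive s 1 (fun t : R => f (y + t *: v)) ('D_v f (y + s *: v)).
  by apply: derive_along; exact: diff_derivable.
have [|c] := MVT h0 (fun s _ => dfs s).
  by apply: derivable_within_continuous => s _; have [] := dfs s.
rewrite in_itv/= => ch; rewrite scale0r addr0 subr0 mulrC => e.
by exists c.
Qed.

Lemma smooth_differentiable f x : smooth f -> differentiable f x.
Proof. by move=> /(_ [::] x). Qed.

Lemma smooth_partial f a : smooth f -> smooth (partial a f).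
Proof. by move=> sf s x; have := sf (rcons s a) x; rewrite foldr_rcons. Qed.

Lemma partialE a f x : differentiable f x -> partial a f x = 'd f x (delta_mx a 0).
Proof. by move=> df; rewrite /partial deriveE. Qed.

Lemma partial_cst a c x : partial a (fun _ : V => c) x = 0.
Proof. exact: derive_cst. Qed.

Lemma differentiable_lin2 f g c d x : differentiable f x -> differentiable g x ->
  differentiable (fun y => c * f y + d * g y) x.
Proof.
move=> df dg; have -> : (fun y => c * f y + d * g y) = c *: f + d *: g by [].
by apply: differentiableD; apply: differentiableZ.
Qed.

Lemma partial_lin2 a f g c d x : differentiable f x -> differentiable g x ->
  partial a (fun y => c * f y + d * g y) x = c * partial a f x + d * partial a g x.
Proof.
move=> df dg; rewrite /partial.
have -> : (fun y => c * f y + d * g y) = c *: f + d *: g by [].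
have df' : derivable f x (delta_mx a 0) by exact: diff_derivable.
have dg' : derivable g x (delta_mx a 0) by exact: diff_derivable.
rewrite deriveD; [|exact: derivableZ|exact: derivableZ].
by rewrite (deriveZ _ df') (deriveZ _ dg').
Qed.

Lemma differentiable_mul f g x : differentiable f x -> differentiable g x ->
  differentiable (fun y => f y * g y) x.
Proof. by move=> df dg; exact: (differentiableM df dg). Qed.

Lemma partialM a f g x : differentiable f x -> differentiable g x ->
  partial a (fun y => f y * g y) x = partial a f x * g x + f x * partial a g x.
Proof.
move=> df dg; rewrite /partial.
have -> : (fun y => f y * g y) = f * g by [].
by rewrite deriveM; [rewrite addrC mulrC|exact: diff_derivable..].
Qed.

Lemma differentiable_lincomb (T : Type) (r : seq T) (c : T -> R) (f : T -> V -> R) x :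
  (forall i, differentiable (f i) x) ->
  differentiable (fun y => \sum_(i <- r) c i * f i y) x.
Proof.
move=> df; elim: r => [|i r IH].
  by under eq_fun do rewrite big_nil; exact: differentiable_cst.
under eq_fun do rewrite big_cons -[X in _ + X]mul1r.
exact: differentiable_lin2.
Qed.

Lemma partial_lincomb (T : Type) (r : seq T) a (c : T -> R) (f : T -> V -> R) x :
  (forall i, differentiable (f i) x) ->
  partial a (fun y => \sum_(i <- r) c i * f i y) x = \sum_(i <- r) c i * partial a (f i) x.
Proof.
move=> df; elim: r => [|i r IH].
  by under eq_fun do rewrite big_nil; rewrite big_nil partial_cst.
under eq_fun do rewrite big_cons -[X in _ + X]mul1r.
rewrite partial_lin2//; first by rewrite big_cons mul1r IH.
exact: differentiable_lincomb.
Qed.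

Lemma differentiable_sums (T : Type) (r : seq T) (f : T -> V -> R) x :
  (forall i, differentiable (f i) x) ->
  differentiable (fun y => \sum_(i <- r) f i y) x.
Proof.
move=> df; have -> : (fun y => \sum_(i <- r) f i y) = (fun y => \sum_(i <- r) 1 * f i y).
  by apply/funext => y; apply: eq_bigr => i _; rewrite mul1r.
exact: differentiable_lincomb.
Qed.

Lemma partial_sums (T : Type) (r : seq T) a (f : T -> V -> R) x :
  (forall i, differentiable (f i) x) ->
  partial a (fun y => \sum_(i <- r) f i y) x = \sum_(i <- r) partial a (f i) x.
Proof.
move=> df; have -> : (fun y => \sum_(i <- r) f i y) = (fun y => \sum_(i <- r) 1 * f i y).
  by apply/funext => y; apply: eq_bigr => i _; rewrite mul1r.
by rewrite partial_lincomb//; apply: eq_bigr => i _; rewrite mul1r.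
Qed.

Lemma foldr_partial_lincomb (T : Type) (r : seq T) s (c : T -> R) (f : T -> V -> R) :
  (forall i, smooth (f i)) ->
  foldr (@partial R) (fun y => \sum_(i <- r) c i * f i y) s =
  (fun y => \sum_(i <- r) c i * foldr (@partial R) (f i) s y).
Proof.
move=> sf; elim: s => //= a s ->; apply/funext => x.
by rewrite partial_lincomb// => i; exact: sf.
Qed.

Lemma smooth_lincomb (T : Type) (r : seq T) (c : T -> R) (f : T -> V -> R) :
  (forall i, smooth (f i)) -> smooth (fun y => \sum_(i <- r) c i * f i y).
Proof.
move=> sf s x; rewrite foldr_partial_lincomb//.
by apply: differentiable_lincomb => i; exact: sf.
Qed.

Lemma smooth_lin2 f g c d : smooth f -> smooth g -> smooth (fun y => c * f y + d * g y).
Proof.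
move=> sf sg.
pose F (b : bool) := if b then f else g; pose C (b : bool) := if b then c else d.
have -> : (fun y => c * f y + d * g y) = (fun y => \sum_(b <- [:: true; false]) C b * F b y).
  by apply/funext => y; rewrite !big_cons big_nil addr0.
by apply: smooth_lincomb => -[].
Qed.

(** Schwarz's theorem. The second difference over a small square of side [h] is symmetric in the two
    directions, and two mean values write it as [h ^+ 2] times either mixed partial at a nearby
    point. By continuity the two mixed partials cannot differ. *)
Lemma partialC f a b x : smooth f -> partial a (partial b f) x = partial b (partial a f) x.
Proof.
move=> sf; apply/eqP; rewrite -subr_eq0; apply/negP => /negP ne.
set ea := delta_mx a 0 : V; set eb := delta_mx b 0 : V.
set L1 := partial a (partial b f) x in ne; set L2 := partial b (partial a f) x in ne.
pose e := `|L1 - L2| / 2; have e0 : 0 < e by rewrite divr_gt0 ?normr_gt0.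
have sf2 c d : continuous (partial c (partial d f)).
  by move=> y; apply: differentiable_continuous; exact: (sf [:: c; d]).
have /cvgrPdist_lt/(_ _ e0) C1 := sf2 a b x.
have /cvgrPdist_lt/(_ _ e0) C2 := sf2 b a x.
have [r /= r0 rP] : exists2 r : R, 0 < r & forall y, `|x - y| < r ->
    `|L1 - partial a (partial b f) y| < e /\ `|L2 - partial b (partial a f) y| < e.
  have [r /= r0 rP] := (nbhs_ballP _ _).1 (filterI C1 C2).
  by exists r => // y xy; apply: rP; rewrite -ball_normE.
(* With this bound the square of side [r / m] stays inside the ball of radius [r]; the summand 1
   makes [m] positive. *)
pose m := `|ea| + `|eb| + 1; have m0 : 0 < m by rewrite ltr_pwDr// addr_ge0.
pose h := r / m; have h0 : 0 < h by rewrite divr_gt0.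
have near s t : 0 < s < h -> 0 < t < h -> `|x - (x + s *: ea + t *: eb)| < r.
  move=> /andP[s0 sh] /andP[t0 th]; rewrite -addrA opprD addrA subrr add0r normrN.
  apply: (le_lt_trans (ler_normD _ _)); rewrite !normrZ !gtr0_norm//.
  have hm : h * m = r by rewrite /h divfK// gt_eqF.
  have := normr_ge0 ea; have := normr_ge0 eb; rewrite -hm /m; nra.
pose D := f (x + h *: ea + h *: eb) - f (x + h *: eb) - f (x + h *: ea) + f x.
have mv c d : smooth f -> exists2 s, 0 < s < h & exists2 t, 0 < t < h &
   f (x + h *: (delta_mx c 0 : V) + h *: delta_mx d 0) - f (x + h *: (delta_mx d 0 : V))
   - f (x + h *: delta_mx c 0) + f x =
   h * (h * partial d (partial c f) (x + s *: delta_mx c 0 + t *: delta_mx d 0)).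
  move=> _; pose F y := f (y + h *: (delta_mx d 0 : V)) - f y.
  have dsh y : differentiable (fun y => f (y + h *: (delta_mx d 0 : V))) y.
    apply: (@differentiable_comp _ _ _ _ (fun y => y + h *: (delta_mx d 0 : V)) f) => //.
    exact: smooth_differentiable.
  have dF y : differentiable F y.
    by apply: differentiableB; [exact: dsh|exact: smooth_differentiable].
  have [s sh] := mean_value_along x (delta_mx c 0) dF h0.
  have -> : 'D_(delta_mx c 0) F (x + s *: delta_mx c 0) =
     partial c f (x + s *: delta_mx c 0 + h *: delta_mx d 0) - partial c f (x + s *: delta_mx c 0).
    rewrite deriveB; [|exact/diff_derivable/dsh|exact/diff_derivable/smooth_differentiable].
    congr (_ - _); apply: derive_along_uniq.
    have := @derive_along f (x + h *: delta_mx d 0) (delta_mx c 0) s.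
    rewrite addrAC => H; have := H (diff_derivable (smooth_differentiable _ sf)).
    rewrite (_ : (fun t : R => f (x + h *: delta_mx d 0 + t *: delta_mx c 0)) =
      (fun t : R => f (x + t *: delta_mx c 0 + h *: delta_mx d 0)))//.
    by apply/funext => t; rewrite addrAC.
  have [t th ->] := mean_value_along (x + s *: delta_mx c 0) (delta_mx d 0)
    (fun y => smooth_differentiable y (smooth_partial c sf)) h0.
  move=> e1; exists s => //; exists t => //; rewrite -e1 /F; ring.
have [s1 s1h [t1 t1h e1]] := mv a b sf.
have [s2 s2h [t2 t2h e2]] := mv b a sf.
have e12 : partial b (partial a f) (x + s1 *: ea + t1 *: eb) =
    partial a (partial b f) (x + s2 *: eb + t2 *: ea).
  move: e1 e2; rewrite -/ea -/eb (addrAC x (h *: eb) (h *: ea)) [_ - f (x + h *: eb) - _]addrAC => -> e2.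
  exact/(mulfI (lt0r_neq0 h0))/(mulfI (lt0r_neq0 h0)).
have [_ d2] := rP _ (near _ _ s1h t1h).
have [d1 _] := rP (x + s2 *: eb + t2 *: ea) ltac:(by rewrite addrAC; exact: near).
rewrite e12 in d2; move: d1 d2; set z := partial a (partial b f) _.
have eE : e = `|L1 - L2| / 2 by [].
clear - ne eE; clearbody L1 L2 z e => d1 d2.
have := le_lt_trans (ler_distD z L1 L2) (ltrD d1 _); rewrite (distrC z) => /(_ _ d2).
by rewrite eE -splitr ltxx.
Qed.

Lemma partial_comp_mx (g : 'M[R]_8) a f x : differentiable f (g *m x) ->
  partial a (fun y => f (g *m y)) x = \sum_b g b a * partial b f (g *m x).
Proof.
move=> df.
have -> : partial a (fun y => f (g *m y)) x = 'D_(g *m delta_mx a 0) f (g *m x).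
  have := @derive_along f (g *m x) (g *m delta_mx a 0) 0.
  rewrite scale0r addr0 => /(_ (diff_derivable df)) H.
  rewrite /partial -[x in LHS]addr0 -[0 in LHS](scale0r (delta_mx a 0)).
  apply: derive_along_uniq; move: H; congr (is_derive _ _ _ _).
  by apply/funext => t; rewrite mulmxDr scalemxAr.
rewrite deriveE// (_ : g *m delta_mx a 0 = \sum_b g b a *: delta_mx b 0); last first.
  rewrite -colE; apply/matrixP => i j; rewrite !ord1 mxE summxE (bigD1 i)//= !mxE eqxx mulr1.
  by rewrite big1 ?addr0// => k ki; rewrite !mxE eq_sym (negPf ki) mulr0.
rewrite linear_sum; apply: eq_bigr => b _.
by rewrite linearZ/= partialE.
Qed.

End Partials.

(** * Plane waves *)

Section Waves.
Context (R : realType).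
Local Notation V := (pt8 R).
Implicit Types (k x : V).

(** Trigonometric polynomials are kept as syntax. They are closed under all operations of [diffpoly]
    on waves of one momentum, and periodicity and derivatives are read off by induction. *)
Inductive trig : Type :=
| Tconst of R | Tcos | Tsin | Tadd of trig & trig | Tmul of trig & trig.

Fixpoint trig_eval (p : trig) (t : R) : R :=
  match p with
  | Tconst c => c | Tcos => cos t | Tsin => sin t
  | Tadd p q => trig_eval p t + trig_eval q t
  | Tmul p q => trig_eval p t * trig_eval q t
  end.

Fixpoint trig_der (p : trig) : trig :=
  match p with
  | Tconst _ => Tconst 0 | Tcos => Tmul (Tconst (-1)) Tsin | Tsin => Tcos
  | Tadd p q => Tadd (trig_der p) (trig_der q)
  | Tmul p q => Tadd (Tmul (trig_der p) q) (Tmul p (trig_der q))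
  end.

Lemma is_derive_trig p (t : R) : is_derive t 1 (trig_eval p) (trig_eval (trig_der p) t).
Proof.
elim: p => [c| | |p IHp q IHq|p IHp q IHq] /=.
- exact: is_derive_cst.
- by rewrite mulN1r; exact: is_derive_cos.
- exact: is_derive_sin.
- exact: (is_deriveD IHp IHq).
- have H := is_deriveM IHp IHq; apply: (is_derive_eq H).
  by rewrite /GRing.scale/=; ring.
Qed.

Lemma trig_periodic p (t : R) : trig_eval p (t + pi *+ 2) = trig_eval p t.
Proof.
by elim: p => [c| | |p IHp q IHq|p IHp q IHq] //=; rewrite ?cosD2pi ?sinD2pi ?IHp ?IHq.
Qed.

(** The mean value theorem over one period replaces integration: a periodic function with constant
    derivative has derivative zero. *)
Lemma trig_mean_zero p c : (forall t, trig_eval (trig_der p) t = c) -> c = 0.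
Proof.
move=> pc; have pi20 : 0 < pi *+ 2 :> R by rewrite mulrn_wgt0// pi_gt0.
have [||s _] := @MVT R (trig_eval p) (trig_eval (trig_der p)) 0 (pi *+ 2) pi20.
- by move=> t _; exact: is_derive_trig.
- by apply: derivable_within_continuous => t _; have [] := is_derive_trig p t.
rewrite -[pi *+ 2 in X in X - _]add0r trig_periodic subrr pc subr0 => /esym/eqP.
by rewrite mulf_eq0 (gt_eqF pi20) orbF => /eqP.
Qed.

Definition phase k x : R := \sum_i k i 0 * x i 0.

Definition wave k p x : R := trig_eval p (phase k x).

Lemma phaseD k x y : phase k (x + y) = phase k x + phase k y.
Proof. by rewrite -big_split; apply: eq_bigr => i _; rewrite mxE mulrDr. Qed.

Lemma phaseZ k c x : phase k (c *: x) = c * phase k x.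
Proof. by rewrite mulr_sumr; apply: eq_bigr => i _; rewrite mxE mulrCA. Qed.

Lemma phase_delta k a : phase k (delta_mx a 0) = k a 0.
Proof.
rewrite /phase (bigD1 a)//= mxE !eqxx mulr1 big1 ?addr0// => i ia.
by rewrite mxE (negPf ia) mulr0.
Qed.

Lemma differentiable_wave k p x : differentiable (wave k p) x.
Proof.
apply: (@differentiable_comp _ _ _ _ (phase k) (trig_eval p)).
  apply: (@differentiable_lincomb R _ _ (fun i => k i 0) (fun i (y : V) => y i 0)) => i.
  exact: differentiable_coord.
by apply/derivable1_diffP; have [] := is_derive_trig p (phase k x).
Qed.

Lemma partial_wave a k p : partial a (wave k p) = wave k (Tmul (Tconst (k a 0)) (trig_der p)).
Proof.
apply/funext => x; rewrite /partial -[x in LHS]addr0 -[0 in LHS](scale0r (delta_mx a 0)).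
apply: derive_along_uniq.
have -> : (fun t : R => wave k p (x + t *: delta_mx a 0)) =
    (trig_eval p \o (fun t : R => t *: (k a 0 : R) + phase k x)).
  by apply/funext => t; rewrite /wave phaseD phaseZ phase_delta/= addrC.
have d1 : is_derive (0 : R) 1 (fun t : R => t *: (k a 0 : R) + phase k x) (k a 0).
  have -> : (fun t : R => t *: (k a 0 : R) + phase k x) = ((k a 0) *: (id : R -> R)) + cst (phase k x).
    by apply/funext => t; rewrite /GRing.scale/= mulrC.
  apply: is_derive_eq; rewrite addr0 [_ *: _]mulr1//.
have := is_derive1_comp (is_derive_trig p _) d1.
by rewrite scale0r add0r mulrC.
Qed.

Lemma smooth_wave k p : smooth (wave k p).
Proof.
move=> s x; suff [q ->] : exists q, foldr (@partial R) (wave k p) s = wave k q.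
  exact: differentiable_wave.
elim: s => [|a s [q /= ->]]; first by exists p.
by rewrite partial_wave; eexists.
Qed.

Lemma dp_eval_wave (I : Type) k (p : I -> trig) (P : diffpoly R I) :
  exists q, dp_eval P (fun i => wave k (p i)) = wave k q.
Proof.
elim: P => [c|i|P [p1 IHP] Q [p2 IHQ]|P [p1 IHP] Q [p2 IHQ]|a P [p1 IHP]] /=.
- by exists (Tconst c).
- by exists (p i).
- by exists (Tadd p1 p2); rewrite IHP IHQ.
- by exists (Tmul p1 p2); rewrite IHP IHQ.
- by rewrite IHP partial_wave; eexists.
Qed.

Lemma divergence_wave (I : Type) k (p : I -> trig) (J : 'I_8 -> diffpoly R I) :
  exists q, divergence J (fun i => wave k (p i)) = wave k (trig_der q).
Proof.
have [q qE] := choice (fun a => dp_eval_wave k p (J a)).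
(* On waves of momentum [k], the divergence of [J] is the phase derivative of the contraction of [k]
   with [J]. *)
pose Q := foldr (fun a t => Tadd (Tmul (Tconst (k a 0)) (q a)) t) (Tconst 0) (index_enum 'I_8).
exists Q; apply/funext => x; rewrite /divergence /wave /Q.
elim: (index_enum _) => [|a r IH]; first by rewrite big_nil.
by rewrite big_cons IH qE partial_wave /wave/=; ring.
Qed.

Lemma divergence_wave_mean (I : Type) k (p : I -> trig) (J : 'I_8 -> diffpoly R I) (c d : R) :
  k != 0 ->
  (forall x, divergence J (fun i => wave k (p i)) x =
     c * sin (phase k x) ^+ 2 - d * cos (phase k x) ^+ 2) -> c = d.
Proof.
move=> k0 H; have [q qE] := divergence_wave k p J.
have onto t : exists x, phase k x = t.
  have /existsP[a ka] : [exists a, k a 0 != 0].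
    rewrite -[X in is_true X]negbK negb_exists; apply/negP => /forallP h.
    by case/eqP: k0; apply/matrixP => i j; rewrite ord1 mxE; apply/eqP; rewrite -[_ == _]negbK h.
  by exists ((t / k a 0) *: delta_mx a 0); rewrite phaseZ phase_delta divfK.
(* The derivative of [(c + d) / 2] times sine times cosine turns [c sin^2 - d cos^2] into the
   constant [(c - d) / 2]. *)
pose W := Tadd q (Tmul (Tconst ((c + d) / 2)) (Tmul Tsin Tcos)).
have W0 t : trig_eval (trig_der W) t = (c - d) / 2.
  have [x xt] := onto t; have := H x; rewrite qE /wave xt => e /=.
  have := cos2Dsin2 t; rewrite e => cs.
  transitivity ((c - d) / 2 * (cos t ^+ 2 + sin t ^+ 2)); last by rewrite cs mulr1.
  by field.
have := trig_mean_zero W0 => ?; lra.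
Qed.

End Waves.

(** * Symbols and divergences *)

Section Polarisation.
Context (R : realType).
Local Notation dl := (delta R).

Lemma quadratic_vanishing (m : 'I_8 -> 'I_8 -> R) :
  (forall k : 'cV[R]_8, \sum_a \sum_b m a b * (k a 0 * k b 0) = 0) ->
  forall a b, m a b + m b a = 0.
Proof.
move=> H a b; pose e i : 'cV[R]_8 := \col_j dl j i.
have S (x y : 'I_8) : \sum_i \sum_j m i j * (e x i 0 * e y j 0) = m x y.
  rewrite -(sum_delta x (fun i => m i y)); apply: eq_bigr => i _.
  rewrite -(sum_delta y (fun j => m i j)) mulr_sumr; apply: eq_bigr => j _.
  by rewrite !mxE; ring.
have := H (e a + e b); have := H (e a); have := H (e b); rewrite !S => h1 h2.
have -> : \sum_i \sum_j m i j * ((e a + e b) i 0 * (e a + e b) j 0) =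
    m a a + m a b + m b a + m b b.
  rewrite -!S -!big_split; apply: eq_bigr => i _ /=; rewrite -!big_split.
  by apply: eq_bigr => j _ /=; rewrite ![(_ + _ : 'cV_8) _ _]mxE; ring.
by move=> ?; lra.
Qed.

(** A cubic form sees only the totally symmetric part of its coefficients, which is all that pairs
    with the symmetric [t]. It will be applied to the third partial derivatives of a component of
    the vector field. *)
Lemma cubic_vanishing (W t : 'I_8 -> 'I_8 -> 'I_8 -> R) :
  (forall k : 'cV[R]_8, sum3 (fun a b c => W a b c * (k a 0 * k b 0 * k c 0)) = 0) ->
  (forall a b c, t b a c = t a b c) -> (forall a b c, t a c b = t a b c) ->
  sum3 (fun a b c => W a b c * t a b c) = 0.
Proof.
move=> H t12 t23; pose e i : 'cV[R]_8 := \col_j dl j i.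
have S x y z : sum3 (fun a b c => W a b c * (e x a 0 * e y b 0 * e z c 0)) = W x y z.
  by rewrite -[RHS]sum3_delta3; apply: eq_sum3 => a b c; rewrite !mxE.
(* Inclusion and exclusion over the sums of three basis vectors isolates the six orderings of [x],
   [y], [z]. *)
have W6 x y z : W x y z + W x z y + W y x z + W y z x + W z x y + W z y x = 0.
  have := H (e x + e y + e z); have := H (e x + e y); have := H (e x + e z).
  have := H (e y + e z); have := H (e x); have := H (e y); have := H (e z).
  move=> h1 h2 h3 h4 h5 h6 h7.
  transitivity (0 - 0 - 0 - 0 + 0 + 0 + 0 : R); last by ring.
  rewrite -{1}h7 -{1}h6 -{1}h5 -{1}h4 -{1}h3 -{1}h2 -{1}h1 -!S -!sum3N -!sum3D.
  by apply: eq_sum3 => a b c; rewrite ![(_ + _ : 'cV_8) _ _]mxE; ring.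
have P12 F : sum3 (R := R) F = sum3 (fun a b c => F b a c) by rewrite /sum3 exchange_big.
have P23 F : sum3 (R := R) F = sum3 (fun a b c => F a c b).
  by rewrite /sum3; apply: eq_bigr => a _; rewrite exchange_big.
set X := sum3 _.
have X1 : X = sum3 (fun a b c => W a c b * t a b c).
  by rewrite /X P23; apply: eq_sum3 => a b c; rewrite t23.
have X2 : X = sum3 (fun a b c => W b a c * t a b c).
  by rewrite /X P12; apply: eq_sum3 => a b c; rewrite t12.
have X3 : X = sum3 (fun a b c => W b c a * t a b c).
  by rewrite X1 P12; apply: eq_sum3 => a b c; rewrite t12.
have X4 : X = sum3 (fun a b c => W c a b * t a b c).
  by rewrite X2 P23; apply: eq_sum3 => a b c; rewrite t23.
have X5 : X = sum3 (fun a b c => W c b a * t a b c).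
  by rewrite X3 P23; apply: eq_sum3 => a b c; rewrite t23.
suff : X + X + X + X + X + X = 0 by move=> ?; lra.
rewrite {2}X1 {2}X2 {2}X3 {2}X4 {2}X5 /X -!sum3D /sum3.
rewrite big1// => a _; rewrite big1// => b _; rewrite big1// => c _.
by rewrite -!mulrDl; have := W6 a b c => W0; rewrite (_ : _ + _ = 0) ?mul0r//; lra.
Qed.

End Polarisation.

Section QuadraticLagrangians.
Context (R : realType).
Local Notation V := (pt8 R).

Definition dp_sum (I T : Type) (r : seq T) (F : T -> diffpoly R I) : diffpoly R I :=
  foldr (fun t P => DPadd (F t) P) (DPconst I 0) r.

Lemma dp_sumE (I T : Type) (r : seq T) (F : T -> diffpoly R I) (u : I -> V -> R) x :
  dp_eval (dp_sum r F) u x = \sum_(t <- r) dp_eval (F t) u x.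
Proof. by elim: r => [|t r IH] /=; rewrite ?big_nil ?big_cons ?IH. Qed.

Section TwoFields.
Context (I : finType).
Implicit Types (A B C N : I -> I -> 'I_8 -> 'I_8 -> R) (u v w : I -> V -> R).

Definition sum4 (F : I -> I -> 'I_8 -> 'I_8 -> R) : R :=
  \sum_i \sum_j \sum_a \sum_b F i j a b.

Lemma eq_sum4 F G : (forall i j a b, F i j a b = G i j a b) -> sum4 F = sum4 G.
Proof. by move=> FG; do 4 (apply: eq_bigr => ? _). Qed.

Lemma sum4D F G : sum4 (fun i j a b => F i j a b + G i j a b) = sum4 F + sum4 G.
Proof.
rewrite /sum4 -big_split; apply: eq_bigr => i _; rewrite -big_split; apply: eq_bigr => j _.
by rewrite -big_split; apply: eq_bigr => a _; rewrite -big_split.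
Qed.

Lemma sum4N F : sum4 (fun i j a b => - F i j a b) = - sum4 F.
Proof.
rewrite /sum4 -sumrN; apply: eq_bigr => i _; rewrite -sumrN; apply: eq_bigr => j _.
by rewrite -sumrN; apply: eq_bigr => a _; rewrite -sumrN.
Qed.

Lemma sum4C F : sum4 F = sum4 (fun i j a b => F j i b a).
Proof.
rewrite /sum4 exchange_big; apply: eq_bigr => i _; apply: eq_bigr => j _; exact: exchange_big.
Qed.

Lemma sum4_combine F1 F2 F3 F4 G1 G2 G3 :
  (forall i j a b, F1 i j a b + F2 i j a b - (F3 i j a b - F4 i j a b) =
     G1 i j a b + G2 i j a b - G3 i j a b) ->
  sum4 F1 + sum4 F2 - (sum4 F3 - sum4 F4) = sum4 G1 + sum4 G2 - sum4 G3.
Proof.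
move=> H; rewrite -(sum4N F4) -(sum4D F3) -(sum4D F1) -sum4N -sum4D.
by rewrite -(sum4N G3) -(sum4D G1) -sum4D; apply: eq_sum4.
Qed.

Definition quad A B u v x : R := sum4 (fun i j a b =>
    (A i j a b * partial a (u i) x * partial b (v j) x
     + B i j a b * u i x * partial a (partial b (v j)) x)).

Definition flux C u v (a : 'I_8) (x : V) : R :=
  \sum_i \sum_j \sum_b C i j a b * (u i x * partial b (v j) x).

(** The syntactic form of [flux]. A total derivative must come from one polynomial valid for all
    fields, so the current is built before the fields are chosen. *)
Definition flux_poly (K : Type) C (P Q : I -> diffpoly R K) (a : 'I_8) : diffpoly R K :=
  dp_sum (index_enum I) (fun i => dp_sum (index_enum I) (fun j =>
    dp_sum (index_enum 'I_8) (fun b =>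
      DPmul (DPconst _ (C i j a b)) (DPmul (P i) (DPpartial b (Q j)))))).

Lemma flux_polyE (K : Type) C (P Q : I -> diffpoly R K) a (w : K -> V -> R) :
  dp_eval (flux_poly C P Q a) w = flux C (fun i => dp_eval (P i) w) (fun i => dp_eval (Q i) w) a.
Proof.
apply/funext => x; rewrite dp_sumE; apply: eq_bigr => i _; rewrite dp_sumE.
by apply: eq_bigr => j _; rewrite dp_sumE.
Qed.

Lemma differentiable_flux C u v a x : (forall i, smooth (u i)) -> (forall i, smooth (v i)) ->
  differentiable (flux C u v a) x.
Proof.
move=> su sv; apply: differentiable_sums => i; apply: differentiable_sums => j.
apply: (@differentiable_lincomb R _ _ (C i j a) (fun b x => u i x * partial b (v j) x)) => b.
by apply: differentiable_mul; apply: smooth_differentiable => //; apply: smooth_partial.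
Qed.

Lemma divergence_flux C u v x : (forall i, smooth (u i)) -> (forall i, smooth (v i)) ->
  \sum_a partial a (flux C u v a) x =
  sum4 (fun i j a b => C i j a b *
    (partial a (u i) x * partial b (v j) x + u i x * partial a (partial b (v j)) x)).
Proof.
move=> su sv.
have d i j b y : differentiable (fun x => u i x * partial b (v j) x) y.
  by apply: differentiable_mul; apply: smooth_differentiable => //; apply: smooth_partial.
have d' i j a y : differentiable (fun x => \sum_b C i j a b * (u i x * partial b (v j) x)) y.
  by apply: (@differentiable_lincomb R _ _ (C i j a) (fun b x => u i x * partial b (v j) x)).
transitivity (\sum_a \sum_i \sum_j \sum_b C i j a b *
    (partial a (u i) x * partial b (v j) x + u i x * partial a (partial b (v j)) x)).
  apply: eq_bigr => a _; rewrite /flux partial_sums; last first.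
    by move=> i; apply: differentiable_sums.
  apply: eq_bigr => i _; rewrite partial_sums//; apply: eq_bigr => j _.
  rewrite (@partial_lincomb R _ _ a (C i j a) (fun b x => u i x * partial b (v j) x))//; apply: eq_bigr => b _.
  by rewrite partialM//; apply: smooth_differentiable => //; apply: smooth_partial.
rewrite exchange_big; apply: eq_bigr => i _; exact: exchange_big.
Qed.

(** Modulo divergences, [u] times a second derivative of [v] is minus a product of first
    derivatives, so only the difference of the two coefficient arrays matters. *)
Definition symbol A B i j a b : R := A i j a b - B i j a b.

(* Integration by parts moves all derivatives onto v *)
Lemma quad_by_parts A B u v x :
  (forall i, smooth (u i)) -> (forall i, smooth (v i)) ->
  quad A B u v x + quad A B v u x =
    \sum_a partial a (flux (fun i j a b => A i j a b + symbol A B j i b a) u v a) x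
  + \sum_a partial a (flux B v u a) x
  - sum4 (fun i j a b =>
      (symbol A B i j a b + symbol A B j i b a) * (u i x * partial a (partial b (v j)) x)).
Proof.
move=> su sv.
(* [FC] is a relabelling of indices written as a vanishing sum. Adding it lets the two sides agree
   term by term. *)
pose F i j a b := symbol A B i j a b * (partial a (v i) x * partial b (u j) x).
have FC : sum4 F - sum4 (fun i j a b => F j i b a) = 0 by rewrite -sum4C subrr.
have E (L X Y Z X' Y' W : R) : X = X' -> Y = Y' -> W = 0 -> L - W = X' + Y' - Z -> L = X + Y - Z.
  by move=> -> -> -> <-; rewrite subr0.
apply: (E _ _ _ _ _ _ _ (divergence_flux
  (fun i j a b => A i j a b + symbol A B j i b a) x su sv) (divergence_flux B x sv su) FC).
apply: sum4_combine => i j a b.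
rewrite /F /symbol.
move: (partial a (partial b (v j)) x) (partial a (partial b (u j)) x) => p1 p2.
move: (partial a (u i) x) (partial b (v j) x) (partial a (v i) x) (partial b (u j) x).
by move: (u i x) (v i x) => *; ring.
Qed.

End TwoFields.

End QuadraticLagrangians.

Section Symbols.
Context (R : realType) (I : finType).
Local Notation V := (pt8 R).
Local Notation coef := (I -> I -> 'I_8 -> 'I_8 -> R).
Implicit Types (A B N : coef) (k : V) (p q : I -> R).

Definition pair_form N (a b : 'I_8) p q : R := \sum_i \sum_j N i j a b * (p i * q j).

Definition symbol_form N k p q : R := \sum_a \sum_b pair_form N a b p q * (k a 0 * k b 0).

Lemma sum4_pair_form N (p : I -> R) (q : 'I_8 -> 'I_8 -> I -> R) :
  sum4 (fun i j a b => N i j a b * (p i * q a b j)) = \sum_a \sum_b pair_form N a b p (q a b).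
Proof.
rewrite /sum4 /pair_form.
transitivity (\sum_i \sum_a \sum_b \sum_j N i j a b * (p i * q a b j)).
  apply: eq_bigr => i _; rewrite exchange_big; apply: eq_bigr => a _; exact: exchange_big.
rewrite exchange_big; apply: eq_bigr => a _; exact: exchange_big.
Qed.

Lemma symbol_formE N k p q :
  symbol_form N k p q = sum4 (fun i j a b => N i j a b * (p i * q j) * (k a 0 * k b 0)).
Proof.
transitivity (\sum_a \sum_b pair_form N a b p (fun j => q j * (k a 0 * k b 0))).
  apply: eq_bigr => a _; apply: eq_bigr => b _; rewrite mulr_suml; apply: eq_bigr => i _.
  by rewrite mulr_suml; apply: eq_bigr => j _; ring.
rewrite -(sum4_pair_form N p (fun a b j => q j * (k a 0 * k b 0))).
by apply: eq_sum4 => i j a b; ring.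
Qed.

Lemma symbol_formB A B k p q :
  symbol_form (symbol A B) k p q = symbol_form A k p q - symbol_form B k p q.
Proof.
rewrite !symbol_formE -sum4N -sum4D; apply: eq_sum4 => i j a b; rewrite /symbol; ring.
Qed.

(** The hypothesis tests [N] only against [k a * k b], hence sees only its part symmetric in [a] and
    [b]. This suffices because [q] has the symmetry of second partial derivatives. *)
Lemma remainder_eq0 N (p : I -> R) (q : 'I_8 -> 'I_8 -> I -> R) :
  (forall a b, q a b = q b a) ->
  (forall a b k, symbol_form N k p (q a b) + symbol_form N k (q a b) p = 0) ->
  sum4 (fun i j a b => (N i j a b + N j i b a) * (p i * q a b j)) = 0.
Proof.
move=> qC H; rewrite (sum4_pair_form (fun i j a b => N i j a b + N j i b a)).
pose m r a b := pair_form N a b p r + pair_form N b a r p.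
have mE r a b : pair_form (fun i j a b => N i j a b + N j i b a) a b p r = m r a b.
  rewrite /m [X in _ + X]/pair_form exchange_big -big_split; apply: eq_bigr => i _ /=.
  by rewrite -big_split; apply: eq_bigr => j _ /=; ring.
under eq_bigr do under eq_bigr do rewrite mE.
have m0 c d a b : m (q c d) a b + m (q c d) b a = 0.
  apply: (@quadratic_vanishing R (m (q c d))) => k; apply: etrans (H c d k).
  transitivity (\sum_a' \sum_b' (pair_form N a' b' p (q c d) * (k a' 0 * k b' 0)
      + pair_form N b' a' (q c d) p * (k b' 0 * k a' 0))).
    by apply: eq_bigr => i _; apply: eq_bigr => j _; rewrite /m; ring.
  under eq_bigr do rewrite big_split; rewrite big_split /=; congr (_ + _).
  by rewrite exchange_big.
set X := \sum_a _; suff : X + X = 0 by move=> ?; lra.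
rewrite {1}/X exchange_big /X -big_split big1// => a _ /=; rewrite -big_split big1// => b _ /=.
by rewrite (qC b a) m0.
Qed.

(** With both arguments equal, integration by parts yields twice the Lagrangian, whence the factor
    [2^-1] in the current. The remainder pairs the field with its second derivatives, and the
    hypothesis makes it vanish. *)
Lemma quad_divergence A B (u : I -> V -> R) x (J := fun a => DPmul (DPconst I 2^-1)
    (DPadd (flux_poly (fun i j a b => A i j a b + symbol A B j i b a) (@DPvar R I) (@DPvar R I) a)
           (flux_poly B (@DPvar R I) (@DPvar R I) a))) :
  (forall i, smooth (u i)) ->
  (forall a b k (p := fun i => u i x) (q := fun j => partial a (partial b (u j)) x),
     symbol_form (symbol A B) k p q + symbol_form (symbol A B) k q p = 0) ->
  quad A B u u x = divergence J u x.
Proof.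
move=> su H; have e := quad_by_parts A B x su su.
have r0 := @remainder_eq0 (symbol A B) (fun i => u i x)
  (fun a b j => partial a (partial b (u j)) x) _ H.
rewrite r0 ?subr0 in e; last first.
  by move=> a b; apply/funext => j; exact: partialC.
have -> : divergence J u x = 2^-1 * (quad A B u u x + quad A B u u x); last by lra.
rewrite e -big_split mulr_sumr; apply: eq_bigr => a _ /=.
rewrite !flux_polyE /=; set f1 := flux _ u u a; set f2 := flux B u u a.
transitivity (partial a (fun y => 2^-1 * f1 y + 2^-1 * f2 y) x).
  by congr partial; apply/funext => y; rewrite mulrDr.
by rewrite partial_lin2 ?mulrDr//; apply: differentiable_flux.
Qed.

Definition cos_wave k p (i : I) := wave k (Tmul (Tconst (p i)) (Tcos R)).

Lemma quad_cos_wave A B k p q x :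
  quad A B (cos_wave k p) (cos_wave k q) x =
  symbol_form A k p q * sin (phase k x) ^+ 2 - symbol_form B k p q * cos (phase k x) ^+ 2.
Proof.
have E c d : symbol_form A k p q * c - symbol_form B k p q * d = sum4 (fun i j a b =>
   A i j a b * (p i * q j) * (k a 0 * k b 0) * c - B i j a b * (p i * q j) * (k a 0 * k b 0) * d).
  have Z (F : coef) z : sum4 F * z = sum4 (fun i j a b => F i j a b * z).
    rewrite mulr_suml; apply: eq_bigr => i _; rewrite mulr_suml; apply: eq_bigr => j _.
    by rewrite mulr_suml; apply: eq_bigr => a _; rewrite mulr_suml.
  by rewrite !symbol_formE !Z -sum4N -sum4D.
rewrite E; apply: eq_sum4 => i j a b; rewrite /cos_wave !partial_wave /wave/=.
by move: (cos _) (sin _) => *; ring.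
Qed.

(** On cosine waves, first-derivative terms give squares of sines and second-derivative terms minus
    squares of cosines; comparing means leaves exactly [A - B]. Two arrays are allowed so that a
    polar form is covered as well. *)
Lemma divergence_symbol A B A' B' k p q (K : Type) (w : K -> trig R) (J : 'I_8 -> diffpoly R K) :
  (forall x, quad A B (cos_wave k p) (cos_wave k q) x + quad A' B' (cos_wave k q) (cos_wave k p) x =
     divergence J (fun i => wave k (w i)) x) ->
  symbol_form (symbol A B) k p q + symbol_form (symbol A' B') k q p = 0.
Proof.
move=> H; have [->|k0] := eqVneq k 0.
  by rewrite /symbol_form !big1 ?addr0// => a _; rewrite big1// => b _; rewrite !mxE mul0r mulr0.
have := @divergence_wave_mean R K k w J (symbol_form A k p q + symbol_form A' k q p)
  (symbol_form B k p q + symbol_form B' k q p) k0.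
rewrite !symbol_formB => e; have := e _; move=> {}e.
suff : symbol_form A k p q + symbol_form A' k q p = symbol_form B k p q + symbol_form B' k q p.
  by move=> ?; lra.
by apply: e => x; rewrite -H !quad_cos_wave; ring.
Qed.

End Symbols.

Section LinearityInFields.
Context (R : realType) (I : finType).
Local Notation V := (pt8 R).
Local Notation coef := (I -> I -> 'I_8 -> 'I_8 -> R).
Implicit Types (A B N : coef) (u v : I -> V -> R).

Lemma quad_coefB A B A' B' u v x :
  quad (fun i j a b => A i j a b - A' i j a b) (fun i j a b => B i j a b - B' i j a b) u v x =
  quad A B u v x - quad A' B' u v x.
Proof.
rewrite /quad -sum4N -sum4D; apply: eq_sum4 => i j a b.
by move: (partial a _ x) (partial b _ x) (partial a _ x) => *; ring.
Qed.

Lemma quad_perturb A B u v e x : (forall i, smooth (u i)) -> (forall i, smooth (v i)) ->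
  quad A B (fun i y => u i y + e * v i y) (fun i y => u i y + e * v i y) x =
  quad A B u u x + e * (quad A B u v x + quad A B v u x) + e ^+ 2 * quad A B v v x.
Proof.
move=> su sv.
have Z (F : coef) z : z * sum4 F = sum4 (fun i j a b => z * F i j a b).
  rewrite mulr_sumr; apply: eq_bigr => i _; rewrite mulr_sumr; apply: eq_bigr => j _.
  by rewrite mulr_sumr; apply: eq_bigr => a _; rewrite mulr_sumr.
have C (F G1 G2 G3 G4 : coef) : (forall i j a b, F i j a b = G1 i j a b +
    e * (G2 i j a b + G3 i j a b) + e ^+ 2 * G4 i j a b) ->
    sum4 F = sum4 G1 + e * (sum4 G2 + sum4 G3) + e ^+ 2 * sum4 G4.
  by move=> H; rewrite -sum4D !Z -!sum4D; apply: eq_sum4.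
have P a f g y : smooth f -> smooth g ->
    partial a (fun y => f y + e * g y) y = partial a f y + e * partial a g y :> R.
  move=> sf sg; transitivity (partial a (fun y => 1 * f y + e * g y) y).
    by congr partial; apply/funext => z; rewrite mul1r.
  by rewrite partial_lin2 ?mul1r//; exact: smooth_differentiable.
have P2 a b f g y : smooth f -> smooth g ->
    partial a (partial b (fun y => f y + e * g y)) y =
    partial a (partial b f) y + e * partial a (partial b g) y :> R.
  move=> sf sg; rewrite -P; [|exact: smooth_partial..].
  by congr partial; apply/funext => z; exact: P.
apply: C => i j a b.
rewrite (P a _ _ x (su i) (sv i)) (P b _ _ x (su j) (sv j)) (P2 a b _ _ x (su j) (sv j)).
move: (partial a (partial b (v j)) x) (partial a (partial b (u j)) x) => p1 p2.
move: (partial a (u i) x) (partial b (v j) x) (partial a (v i) x) (partial b (u j) x).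
by move: (u i x) (v i x) => *; ring.
Qed.

Lemma symbol_formD N k (p q : I -> R) (r := fun i => p i + q i) :
  symbol_form N k r r = symbol_form N k p p + (symbol_form N k p q + symbol_form N k q p)
    + symbol_form N k q q.
Proof. by rewrite !symbol_formE -!sum4D; apply: eq_sum4 => i j a b; rewrite /r; ring. Qed.

End LinearityInFields.

Section PairFields.
Context (R : realType) (Phi : tensor4 R) (eta : 'M[R]_8).
Local Notation V := (pt8 R).
Local Notation M8 := 'M[R]_8.
Local Notation coef := (pair_idx -> pair_idx -> 'I_8 -> 'I_8 -> R).
Implicit Types (A B : coef) (L : lagrangian R) (k z : V).

Definition pair_vec (h xi : M8) (i : pair_idx) : R :=
  match i with inl p => h p.1 p.2 | inr p => xi p.1 p.2 end.

Lemma pair_fieldsE h xi i x : pair_fields h xi i x = pair_vec (h x) (xi x) i :> R.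
Proof. by case: i. Qed.

Lemma pair_vecD h xi h' xi' i :
  pair_vec (h + h') (xi + xi') i = pair_vec h xi i + pair_vec h' xi' i.
Proof. by case: i => p; rewrite /= mxE. Qed.

Lemma pair_vecZ c h xi i : pair_vec (c *: h) (c *: xi) i = c * pair_vec h xi i.
Proof. by case: i => p; rewrite /= mxE. Qed.

Lemma smooth_pair_fields (h xi : V -> M8) i : smooth_mx h -> smooth_mx xi ->
  smooth (pair_fields h xi i).
Proof. by move=> sh sx; case: i => p /=. Qed.

Definition represents L A B := forall h xi, smooth_mx h -> smooth_mx xi ->
  forall x, L h xi x = quad A B (pair_fields h xi) (pair_fields h xi) x.

Definition partial_mx (a : 'I_8) (m : V -> M8) : V -> M8 := fun x =>
  \matrix_(i, j) partial a (fun y => m y i j) x.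

Lemma pair_fields_partial a h xi i :
  partial a (pair_fields h xi i) = pair_fields (partial_mx a h) (partial_mx a xi) i.
Proof. by apply/funext => x; case: i => p /=; rewrite mxE. Qed.

Lemma smooth_mx_partial a (m : V -> M8) : smooth_mx m -> smooth_mx (partial_mx a m).
Proof.
move=> sm i j; have -> : (fun x => partial_mx a m x i j) = partial a (fun y => m y i j).
  by apply/funext => x; rewrite mxE.
exact: smooth_partial.
Qed.

Lemma h_field_partial a h : h_field h -> h_field (partial_mx a h).
Proof.
move=> [sh hs]; split; first exact: smooth_mx_partial.
move=> x; apply/matrixP => i j; rewrite !mxE; congr (partial a _ x).
by apply/funext => y; rewrite -[in RHS]hs mxE.
Qed.

(** The constraints on the fields are linear with constant coefficients and so pass to derivatives.
    This matters because the remainder of integration by parts involves second derivatives of the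
    fields, on which the symbols must agree too. *)
Lemma xi_field_partial a xi : xi_field Phi eta xi -> xi_field Phi eta (partial_mx a xi).
Proof.
move=> [sx x7]; split; first exact: smooth_mx_partial.
have xsE y i j : xi y j i = - xi y i j.
  by have [xs _] := x7 y; rewrite -[xi y in LHS]trmxK xs !mxE.
move=> x; split.
  apply/matrixP => i j; rewrite !mxE.
  transitivity (partial a (fun y => 0 * xi y i j + (-1) * xi y i j) x).
    by congr (partial a _ x); apply/funext => y; rewrite xsE; ring.
  by rewrite partial_lin2 ?mul0r ?add0r ?mulN1r//; apply: smooth_differentiable; exact: sx.
apply/matrixP => i j; rewrite !mxE.
have dx c d y : differentiable (fun y => xi y c d) y by apply: smooth_differentiable; exact: sx.
transitivity (partial a (fun y => 0 * xi y i j + (-3) * xi y i j) x); last first.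
  by rewrite partial_lin2 ?mul0r ?add0r.
transitivity (partial a (fun y => \sum_c 2^-1 * \sum_d cayley_up Phi eta i j c d * xi y c d) x).
  rewrite (@partial_lincomb R _ _ a (fun=> 2^-1) (fun c y => \sum_d cayley_up Phi eta i j c d * xi y c d)).
    rewrite mulr_sumr; apply: eq_bigr => c _; congr (_ * _).
    rewrite (@partial_lincomb R _ _ a (fun d => cayley_up Phi eta i j c d) (fun d y => xi y c d))//.
    by apply: eq_bigr => d _; rewrite mxE.
  by move=> c; apply: (@differentiable_lincomb R _ _ _ (fun d y => xi y c d)).
congr (partial a _ x); apply/funext => y; have [_ J2x] := x7 y.
have := congr1 (fun m : M8 => m i j) J2x; rewrite !mxE mulr_sumr => ->.
by rewrite mul0r add0r.
Qed.

Lemma Lambda2_7D b b' : Lambda2_7 Phi eta b -> Lambda2_7 Phi eta b' ->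
  Lambda2_7 Phi eta (b + b').
Proof.
move=> [b1 b2] [c1 c2]; split; first by rewrite linearD/= b1 c1 opprD.
have -> : J2 Phi eta (b + b') = J2 Phi eta b + J2 Phi eta b'.
  apply/matrixP => i j; rewrite !mxE -mulrDr -big_split; congr (_ * _); apply: eq_bigr => c _.
  by rewrite -big_split; apply: eq_bigr => d _ /=; rewrite mxE mulrDr.
by rewrite b2 c2 scalerDr.
Qed.

Lemma Lambda2_7Z x b : Lambda2_7 Phi eta b -> Lambda2_7 Phi eta (x *: b).
Proof.
move=> [b1 b2]; split; first by rewrite linearZ/= b1 scalerN.
have -> : J2 Phi eta (x *: b) = x *: J2 Phi eta b.
  apply/matrixP => i j; rewrite !mxE [RHS]mulrCA; congr (_ * _).
  rewrite mulr_sumr; apply: eq_bigr => c _; rewrite mulr_sumr; apply: eq_bigr => d _.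
  by rewrite mxE mulrCA.
by rewrite b2 !scalerA mulrC.
Qed.

Definition wave_mx k (p : trig R) (m : M8) : V -> M8 := fun x => wave k p x *: m.

Lemma smooth_wave_mx k p m : smooth_mx (wave_mx k p m).
Proof.
move=> i j; have -> : (fun x => wave_mx k p m x i j) = wave k (Tmul (Tconst (m i j)) p).
  by apply/funext => x; rewrite !mxE /wave/= mulrC.
exact: smooth_wave.
Qed.

Lemma pair_fields_wave k p h xi : pair_fields (wave_mx k p h) (wave_mx k p xi) =
  fun i => wave k (Tmul (Tconst (pair_vec h xi i)) p).
Proof.
by apply/funext => i; apply/funext => x; rewrite pair_fieldsE pair_vecZ /wave/= mulrC.
Qed.

Lemma h_field_wave k p h : h^T = h -> h_field (wave_mx k p h).
Proof. by move=> hs; split; [exact: smooth_wave_mx|move=> x; rewrite linearZ/= hs]. Qed.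

Lemma xi_field_wave k p xi : Lambda2_7 Phi eta xi -> xi_field Phi eta (wave_mx k p xi).
Proof. by move=> x7; split; [exact: smooth_wave_mx|move=> x; exact: Lambda2_7Z]. Qed.

Theorem eq_mod_divP L1 L2 A1 B1 A2 B2 : represents L1 A1 B1 -> represents L2 A2 B2 ->
  eq_mod_div Phi eta L1 L2 <->
  (forall k h xi, h^T = h -> Lambda2_7 Phi eta xi ->
    symbol_form (symbol A1 B1) k (pair_vec h xi) (pair_vec h xi) =
    symbol_form (symbol A2 B2) k (pair_vec h xi) (pair_vec h xi)).
Proof.
move=> r1 r2.
pose A i j a b := A1 i j a b - A2 i j a b; pose B i j a b := B1 i j a b - B2 i j a b.
have sE k p : symbol_form (symbol A B) k p p =
    symbol_form (symbol A1 B1) k p p - symbol_form (symbol A2 B2) k p p.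
  by rewrite !symbol_formE -sum4N -sum4D; apply: eq_sum4 => i j a b; rewrite /symbol /A /B; ring.
have qE h xi x : smooth_mx h -> smooth_mx xi -> L1 h xi x - L2 h xi x =
    quad A B (pair_fields h xi) (pair_fields h xi) x.
  by move=> sh sx; rewrite quad_coefB r1// r2.
split=> [[J HJ] k h xi hs x7|H].
  apply/eqP; rewrite -subr_eq0 -sE; apply/eqP.
  (* Only one Lagrangian is present here; the second one in [divergence_symbol] is taken to be
     zero. *)
  pose Z : coef := fun _ _ _ _ => 0.
  have Z0 p : symbol_form (symbol Z Z) k p p = 0.
    rewrite symbol_formE /sum4 !big1// => i _; rewrite big1// => j _; rewrite big1// => a _.
    by rewrite big1// => b _; rewrite /symbol /Z; ring.
  rewrite -[LHS]addr0 -[X in _ + X = _](Z0 (pair_vec h xi)).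
  apply: (@divergence_symbol _ _ _ _ _ _ _ _ _ _ (fun i => Tmul (Tconst (pair_vec h xi i)) (Tcos R)) J).
  move=> x; have := HJ _ _ (h_field_wave k (Tcos R) hs) (xi_field_wave k (Tcos R) x7) x.
  rewrite qE; [|exact: smooth_wave_mx..]; rewrite pair_fields_wave => <-.
  rewrite -[RHS]addr0; congr (_ + _).
  rewrite /quad /sum4 big1// => i _; rewrite big1// => j _; rewrite big1// => a _.
  by rewrite big1// => b _; rewrite /Z !mul0r addr0.
eexists => h xi hf xf x; have [sh hs] := hf; have [sx x7] := xf.
rewrite qE//; apply: quad_divergence.
  by move=> i; exact: smooth_pair_fields.
move=> a b k p q.
have pE : p = pair_vec (h x) (xi x) by apply/funext => i; exact: pair_fieldsE.
have [sh2 hs2] := h_field_partial a (h_field_partial b hf).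
have [sx2 x72] := xi_field_partial a (xi_field_partial b xf).
set h2 := partial_mx a (partial_mx b h) x in hs2; set xi2 := partial_mx a (partial_mx b xi) x in x72.
have qvE : q = pair_vec (partial_mx a (partial_mx b h) x) (partial_mx a (partial_mx b xi) x).
  by apply/funext => i; rewrite /q pair_fields_partial pair_fields_partial pair_fieldsE.
have S0 h' xi' : h'^T = h' -> Lambda2_7 Phi eta xi' ->
    symbol_form (symbol A B) k (pair_vec h' xi') (pair_vec h' xi') = 0.
  by move=> h's x'7; rewrite sE H ?subrr.
have := S0 _ _ (hs x) (x7 x); have := S0 _ _ (hs2 x) (x72 x).
(* Polarisation: the symbol vanishes on the field, on its second derivative and on their sum, hence
   so does the cross term. *)
have := S0 (h x + partial_mx a (partial_mx b h) x) (xi x + partial_mx a (partial_mx b xi) x).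
rewrite linearD/= hs hs2 => /(_ erefl (Lambda2_7D (x7 x) (x72 x))).
rewrite (_ : pair_vec _ _ = fun i => p i + q i); last first.
  by apply/funext => i; rewrite pair_vecD -pE -qvE.
by rewrite symbol_formD -pE -qvE => e1 e2 e3; lra.
Qed.

End PairFields.

(** * Linearised diffeomorphisms *)

Section Diffeomorphisms.
Context (R : realType) (Phi : tensor4 R) (eta : 'M[R]_8).
Local Notation V := (pt8 R).
Local Notation M8 := 'M[R]_8.
Local Notation coef := (pair_idx -> pair_idx -> 'I_8 -> 'I_8 -> R).
Implicit Types (A B N : coef) (L : lagrangian R) (k z : V) (m : M8).

Definition h_part m : M8 := \matrix_(a, b) (2^-1 * (m a b + m b a)).

Definition xi_part m : M8 := \matrix_(a, b) (2^-1 * (m a b - m b a)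
  - 2^-1 * \sum_p \sum_q cayley_up Phi eta a b p q * m p q).

Definition diffeo_vec m : pair_idx -> R := pair_vec (h_part m) (xi_part m).

Lemma diffeo_vec_linear x m n i :
  diffeo_vec (x *: m + n) i = x * diffeo_vec m i + diffeo_vec n i.
Proof.
rewrite /diffeo_vec; case: i => [[a b]|[a b]] /=; rewrite !mxE; first by ring.
have -> : \sum_p \sum_q cayley_up Phi eta a b p q * (x *: m + n) p q =
    x * (\sum_p \sum_q cayley_up Phi eta a b p q * m p q) +
    \sum_p \sum_q cayley_up Phi eta a b p q * n p q.
  rewrite mulr_sumr -big_split; apply: eq_bigr => p _; rewrite mulr_sumr -big_split.
  by apply: eq_bigr => q _; rewrite !mxE /=; ring.
by ring.
Qed.

(** The variation of field [i] has constant coefficients in the derivatives of the components of the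
    vector field. Writing them out makes the variation a differential polynomial. *)
Definition diffeo_coef (i : pair_idx) (c p : 'I_8) : R :=
  \sum_q diffeo_vec (delta_mx c q) i * eta q p.

Lemma diffeo_vecE m i : diffeo_vec m i = \sum_c \sum_q diffeo_vec (delta_mx c q) i * m c q.
Proof.
have f0 : diffeo_vec 0 i = 0.
  by have := diffeo_vec_linear 1 0 0 i; rewrite scaler0 addr0 mul1r => ?; lra.
rewrite [m in LHS]matrix_sum_delta.
elim/big_rec2: _ => [//|c y n _ <-].
rewrite -[X in X + n]scale1r diffeo_vec_linear mul1r; congr (_ + _).
elim/big_rec2: _ => [//|q y' n' _ <-].
by rewrite diffeo_vec_linear mulrC.
Qed.

Lemma diffeo_coefE (d : 'I_8 -> 'I_8 -> R) i :
  diffeo_vec (\matrix_(a, b) \sum_p eta b p * d a p) i =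
  \sum_c \sum_p diffeo_coef i c p * d c p.
Proof.
rewrite diffeo_vecE; apply: eq_bigr => c _.
transitivity (\sum_q \sum_p diffeo_vec (delta_mx c q) i * (eta q p * d c p)).
  by apply: eq_bigr => q _; rewrite mxE mulr_sumr.
rewrite exchange_big; apply: eq_bigr => p _; rewrite mulr_suml.
by apply: eq_bigr => q _; rewrite mulrA.
Qed.

Definition diffeo_field (zeta : V -> V) (i : pair_idx) (x : V) : R :=
  \sum_c \sum_p diffeo_coef i c p * partial c (fun y => zeta y p 0) x.

Lemma delta_fields (zeta : V -> V) i x : smooth_mx zeta ->
  pair_vec (delta_h eta zeta x) (delta_xi Phi eta zeta x) i = diffeo_field zeta i x.
Proof.
move=> sz; rewrite /diffeo_field -diffeo_coefE.
have dE a b : dzeta eta zeta x a b =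
    (\matrix_(a, b) \sum_p eta b p * partial a (fun y => zeta y p 0) x : M8) a b.
  rewrite mxE /dzeta (@partial_lincomb R _ _ a (fun p => eta b p) (fun p y => zeta y p 0))//.
  by move=> p; apply: smooth_differentiable; exact: sz.
rewrite /diffeo_vec; case: i => [[a b]|[a b]] /=; rewrite [LHS]mxE [RHS]mxE !dE//.
by congr (_ - _ * _); apply: eq_bigr => p _; apply: eq_bigr => q _; rewrite dE.
Qed.

Lemma smooth_diffeo_field zeta i : smooth_mx zeta -> smooth (diffeo_field zeta i).
Proof.
move=> sz.
have -> : diffeo_field zeta i = fun x => \sum_c 1 *
    \sum_p diffeo_coef i c p * partial c (fun y => zeta y p 0) x.
  by apply/funext => x; apply: eq_bigr => c _; rewrite mul1r.
apply: (@smooth_lincomb R _ _ (fun=> 1)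
  (fun c x => \sum_p diffeo_coef i c p * partial c (fun y => zeta y p 0) x)) => c.
apply: (@smooth_lincomb R _ _ _ (fun p x => partial c (fun y => zeta y p 0) x)) => p.
by apply: smooth_partial; exact: sz.
Qed.

(** A quadratic Lagrangian is a polynomial of degree two in the parameter of the variation, so the
    derivative at 0 is the cross term. *)
Lemma derive1_quadratic (a b c : R) : derive1 (fun e : R => a + e * b + e ^+ 2 * c) 0 = b.
Proof.
rewrite (_ : (fun e : R => _) = horner (a%:P + b *: 'X + c *: 'X^2)).
  rewrite derive1E derive_val !derivD derivC !derivZ derivX derivXn add0r.
  by rewrite !hornerD !hornerZ hornerC hornerMn hornerXn expr1 mul0rn mulr0 addr0 mulr1.
by apply/funext => e; rewrite !hornerD !hornerZ hornerC hornerX hornerXn; ring.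
Qed.

Lemma exchange_sum_pair (T : finType) (F : T -> pair_idx -> pair_idx -> R) :
  \sum_t \sum_i \sum_j F t i j = \sum_i \sum_j \sum_t F t i j.
Proof. by rewrite exchange_big; apply: eq_bigr => i _; exact: exchange_big. Qed.

Lemma sum4_sum3 (S : coef) (p : pair_idx -> R) (C : pair_idx -> 'I_8 -> R)
    (E : 'I_8 -> 'I_8 -> 'I_8 -> R) :
  sum4 (fun i j a b => S i j a b * (p i * \sum_c C j c * E a b c)) =
  sum3 (fun a b c => (\sum_i \sum_j S i j a b * (p i * C j c)) * E a b c).
Proof.
transitivity (\sum_a \sum_b \sum_c \sum_i \sum_j S i j a b * (p i * C j c) * E a b c).
  under eq_bigr do under eq_bigr do rewrite exchange_sum_pair.
  under eq_bigr do rewrite exchange_sum_pair.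
  rewrite exchange_sum_pair; do 4 (apply: eq_bigr => ? _).
  by rewrite !mulr_sumr; apply: eq_bigr => c _; rewrite !mulrA.
do 3 (apply: eq_bigr => ? _).
by rewrite mulr_suml; apply: eq_bigr => i _; rewrite mulr_suml.
Qed.

Lemma symbol_form_crossE N k p q : symbol_form N k p q + symbol_form N k q p =
  sum4 (fun i j a b => (N i j a b + N j i b a) * (p i * (q j * (k a 0 * k b 0)))).
Proof.
by rewrite !symbol_formE [X in _ + X]sum4C -sum4D; apply: eq_sum4 => i j a b; ring.
Qed.

Lemma variation_represents L A B h xi zeta x : represents L A B ->
  smooth_mx h -> smooth_mx xi -> smooth_mx zeta ->
  variation Phi eta L h xi zeta x =
  quad A B (pair_fields h xi) (diffeo_field zeta) x +
  quad A B (diffeo_field zeta) (pair_fields h xi) x.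
Proof.
move=> rL sh sx sz; set u := pair_fields h xi; set v := diffeo_field zeta.
have su i : smooth (u i) by exact: smooth_pair_fields.
have sv i : smooth (v i) by exact: smooth_diffeo_field.
have svh a b : smooth (fun y => delta_h eta zeta y a b).
  suff -> : (fun y => delta_h eta zeta y a b) = v (inl (a, b)) by [].
  by apply/funext => y; rewrite /v -delta_fields.
have svx a b : smooth (fun y => delta_xi Phi eta zeta y a b).
  suff -> : (fun y => delta_xi Phi eta zeta y a b) = v (inr (a, b)) by [].
  by apply/funext => y; rewrite /v -delta_fields.
rewrite /variation -[RHS](derive1_quadratic (quad A B u u x) _ (quad A B v v x)).
congr (derive1 _ 0); apply/funext => e; rewrite rL; last 2 first.
- move=> i j; rewrite (_ : (fun y => _) = fun y => 1 * h y i j + e * delta_h eta zeta y i j).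
    by apply: smooth_lin2; [exact: sh|exact: svh].
  by apply/funext => y; rewrite mul1r mxE [X in _ + X]mxE.
- move=> i j; rewrite (_ : (fun y => _) = fun y => 1 * xi y i j + e * delta_xi Phi eta zeta y i j).
    by apply: smooth_lin2; [exact: sx|exact: svx].
  by apply/funext => y; rewrite mul1r mxE [X in _ + X]mxE.
apply: etrans (quad_perturb A B e x su sv).
suff -> : pair_fields (fun y => h y + e *: delta_h eta zeta y)
    (fun y => xi y + e *: delta_xi Phi eta zeta y) = fun i y => u i y + e * v i y by [].
apply/funext => i; apply/funext => y; rewrite /v -delta_fields// /u !pair_fieldsE.
by rewrite pair_vecD pair_vecZ.
Qed.

(* The symbol of the transformation of (h, xi): k z^T with the index of z lowered *)
Definition diffeo_symbol k z : pair_idx -> R :=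
  diffeo_vec (\matrix_(a, b) \sum_p eta b p * (k a 0 * z p 0)).

Lemma diffeo_field_wave k z i :
  diffeo_field (fun x => wave k (Tsin R) x *: z) i =
  wave k (Tmul (Tconst (diffeo_symbol k z i)) (Tcos R)).
Proof.
apply/funext => x; rewrite /diffeo_symbol diffeo_coefE /wave/= mulr_suml.
apply: eq_bigr => c _; rewrite mulr_suml; apply: eq_bigr => p _.
rewrite (_ : (fun y => _) = wave k (Tmul (Tconst (z p 0)) (Tsin R))); last first.
  by apply/funext => y; rewrite !mxE /wave/= mulrC.
by rewrite partial_wave /wave/=; ring.
Qed.

Theorem diffeo_invariantP L A B : represents L A B ->
  diffeo_invariant Phi eta L <->
  (forall k z h xi, h^T = h -> Lambda2_7 Phi eta xi ->
    symbol_form (symbol A B) k (pair_vec h xi) (diffeo_symbol k z) +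
    symbol_form (symbol A B) k (diffeo_symbol k z) (pair_vec h xi) = 0).
Proof.
move=> rL; split=> [[J HJ] k z h xi hs x7|H].
  (* The vector field carries the sine so that its first derivatives are in phase with the cosine
     carried by [h] and [xi]. *)
  pose w (i : pair_idx + 'I_8) := match i with
    | inl i => Tmul (Tconst (pair_vec h xi i)) (Tcos R)
    | inr p => Tmul (Tconst (z p 0)) (Tsin R) end.
  apply: (@divergence_symbol _ _ _ _ _ _ _ _ _ _ w J) => x.
  have sz : smooth_mx (fun x => wave k (Tsin R) x *: z).
    move=> p o; rewrite (_ : (fun y => _) = wave k (Tmul (Tconst (z p o)) (Tsin R))).
      exact: smooth_wave.
    by apply/funext => y; rewrite !mxE /wave/= mulrC.
  have := HJ _ _ _ (h_field_wave k (Tcos R) hs) (xi_field_wave k (Tcos R) x7) sz x.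
  rewrite (variation_represents _ rL) //; [|exact: smooth_wave_mx..].
  rewrite pair_fields_wave (_ : diffeo_field _ = cos_wave k (diffeo_symbol k z)); last first.
    by apply/funext => i; rewrite diffeo_field_wave.
  move=> ->; congr (divergence J _ x); apply/funext => -[i|p] /=.
    by rewrite pair_fields_wave.
  by apply/funext => y; rewrite !mxE /wave/= mulrC.
pose vP (j : pair_idx) : diffpoly R (pair_idx + 'I_8) :=
  dp_sum (index_enum 'I_8) (fun c => dp_sum (index_enum 'I_8) (fun p =>
    DPmul (DPconst _ (diffeo_coef j c p)) (DPpartial c (DPvar R (inr p))))).
pose uP (i : pair_idx) : diffpoly R (pair_idx + 'I_8) := DPvar R (inl i).
exists (fun a => DPadd (flux_poly (fun i j a b => A i j a b + symbol A B j i b a) uP vP a)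
                       (flux_poly B vP uP a)) => h xi zeta [sh hs] [sx x7] sz x.
rewrite (variation_represents _ rL)//.
set u := pair_fields h xi; set v := diffeo_field zeta.
have su i : smooth (u i) by exact: smooth_pair_fields.
have sv i : smooth (v i) by exact: smooth_diffeo_field.
pose d3 (p a b c : 'I_8) := partial a (partial b (partial c (fun y => zeta y p 0))) x.
pose W (p a b c : 'I_8) := \sum_i \sum_j
  (symbol A B i j a b + symbol A B j i b a) * (u i x * diffeo_coef j c p).
have vE j a b : partial a (partial b (v j)) x = \sum_c \sum_p diffeo_coef j c p * d3 p a b c.
  have sp p c : smooth (partial c (fun y => zeta y p 0)).
    by apply: smooth_partial; exact: sz.
  have E f : (forall p c, smooth (f p c)) -> forall a', partial a'
      (fun y => \sum_c \sum_p diffeo_coef j c p * f p c y) =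
      (fun y => \sum_c \sum_p diffeo_coef j c p * partial a' (f p c) y).
    move=> sf a'; apply/funext => y; rewrite partial_sums; last first.
      by move=> c; apply: differentiable_lincomb => p; apply: smooth_differentiable.
    apply: eq_bigr => c _; rewrite partial_lincomb// => p.
    by apply: smooth_differentiable.
  rewrite /v /diffeo_field (E (fun p c => partial c (fun y => zeta y p 0)))//.
  by rewrite (E (fun p c => partial b (partial c (fun y => zeta y p 0))))// => p c; apply: smooth_partial.
have r0 : sum4 (fun i j a b => (symbol A B i j a b + symbol A B j i b a) *
     (u i x * partial a (partial b (v j)) x)) = 0.
  have Mx (y z : R) (F : 'I_8 -> 'I_8 -> R) :
      y * (z * \sum_c \sum_p F c p) = \sum_p y * (z * \sum_c F c p).
    by rewrite exchange_big mulr_sumr mulr_sumr.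
  transitivity (\sum_p sum3 (fun a b c => W p a b c * d3 p a b c)).
    transitivity (\sum_p sum4 (fun i j a b => (symbol A B i j a b + symbol A B j i b a) *
       (u i x * \sum_c diffeo_coef j c p * d3 p a b c))).
      rewrite /sum4 exchange_sum_pair; apply: eq_bigr => i _; apply: eq_bigr => j _.
      rewrite [RHS]exchange_big; apply: eq_bigr => a _.
      rewrite [RHS]exchange_big; apply: eq_bigr => b _.
      apply: (etrans _ (Mx _ _ (fun c p => diffeo_coef j c p * d3 p a b c))).
      exact: (congr1 (fun t => (symbol A B i j a b + symbol A B j i b a) * (u i x * t)) (vE j a b)).
    by apply: eq_bigr => p _; exact: sum4_sum3.
  (* For fixed [p] the momentum occurs three times in [H], twice through the symbol and once through
     the variation; [z] is the basis vector of index [p]. *)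
  rewrite big1// => p _; apply: cubic_vanishing => [k|a b c|a b c].
  - rewrite -(sum4_sum3 _ (fun i => u i x) (fun j c => diffeo_coef j c p)).
    rewrite -[RHS](H k (delta_mx p 0) _ _ (hs x) (x7 x)) symbol_form_crossE.
    apply: eq_sum4 => i j a b; rewrite /u pair_fieldsE /diffeo_symbol diffeo_coefE.
    congr (_ * (_ * _)); rewrite mulr_suml; apply: eq_bigr => c _.
    rewrite (bigD1 p)//= mxE !eqxx big1 ?addr0 => [|q /negbTE qp]; last by rewrite mxE qp !mulr0.
    by rewrite mulr1; ring.
  - by apply: partialC; apply: smooth_partial; exact: sz.
  - apply: (congr1 (fun f => partial a f x)); apply/funext => y.
    by apply: partialC; exact: sz.
have e0 (X Y Z : R) : Z = 0 -> X = Y - Z -> X = Y by move=> ->; rewrite subr0.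
apply: (etrans (e0 _ _ _ r0 (quad_by_parts A B x su sv))).
have EuP : (fun i => dp_eval (uP i) (triple_fields h xi zeta)) = u by [].
have EvP : (fun i => dp_eval (vP i) (triple_fields h xi zeta)) = v.
  apply/funext => j; apply/funext => y; rewrite dp_sumE; apply: eq_bigr => c _.
  by rewrite dp_sumE.
rewrite -big_split; apply: eq_bigr => a _ /=.
rewrite !flux_polyE EuP EvP; set f1 := flux _ u v a; set f2 := flux B v u a.
have d1 : differentiable f1 x by exact: differentiable_flux.
have d2 : differentiable f2 x by exact: differentiable_flux.
move: f1 f2 d1 d2 => f1 f2 d1 d2; have := partial_lin2 a 1 1 d1 d2; rewrite !mul1r => <-.
by congr (partial a _ x); apply/funext => y; rewrite !mul1r.
Qed.

End Diffeomorphisms.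

(** * Symbols of Lagrangians *)

Section HasSymbol.
Context (R : realType).
Local Notation V := (pt8 R).
Local Notation M8 := 'M[R]_8.
Local Notation coef := (pair_idx -> pair_idx -> 'I_8 -> 'I_8 -> R).
Implicit Types (A B N : coef) (L D : lagrangian R) (S d : V -> M8 -> M8 -> R).

(* d is the value of the operator D on the fields (h, xi) when each partial
   derivative is replaced by a component of k *)
Definition linear_of (T : finType) (op : T -> (V -> R) -> V -> R) (wt : T -> V -> R) D d :=
  exists P : pair_idx -> T -> R,
    (forall h xi, smooth_mx h -> smooth_mx xi -> forall x,
       D h xi x = \sum_i \sum_t P i t * op t (pair_fields h xi i) x) /\
    (forall k h xi, d k h xi = \sum_i \sum_t P i t * (wt t k * pair_vec h xi i)).

Definition zeroth_order := linear_of (fun (_ : unit) f => f) (fun _ _ => 1).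
Definition first_order := linear_of (@partial R) (fun a (k : V) => k a 0).
Definition second_order := linear_of (fun t f => partial t.1 (partial t.2 f))
  (fun (t : 'I_8 * 'I_8) (k : V) => k t.1 0 * k t.2 0).

Section LinearOf.
Context (T : finType) (op : T -> (V -> R) -> V -> R) (wt : T -> V -> R).
Local Notation lin := (linear_of op wt).

Lemma linear_of_ext D D' d d' : lin D' d' ->
  (forall h xi, smooth_mx h -> smooth_mx xi -> forall x, D h xi x = D' h xi x) ->
  (forall k h xi, d k h xi = d' k h xi) -> lin D d.
Proof.
move=> [P [PD Pd]] DE dE; exists P; split=> [h xi sh sx x|k h xi]; last by rewrite dE.
by rewrite DE// PD.
Qed.

Lemma linear_of0 : lin (fun _ _ _ => 0) (fun _ _ _ => 0).
Proof.
exists (fun _ _ => 0); split=> *; symmetry; rewrite big1// => i _; rewrite big1// => t _;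
  exact: mul0r.
Qed.

Lemma linear_of_lincomb c D1 d1 D2 d2 : lin D1 d1 -> lin D2 d2 ->
  lin (fun h xi x => c * D1 h xi x + D2 h xi x) (fun k h xi => c * d1 k h xi + d2 k h xi).
Proof.
have E (P Q F : pair_idx -> T -> R) :
    c * (\sum_i \sum_t P i t * F i t) + \sum_i \sum_t Q i t * F i t =
    \sum_i \sum_t (c * P i t + Q i t) * F i t.
  rewrite mulr_sumr -big_split; apply: eq_bigr => i _.
  by rewrite mulr_sumr -big_split; apply: eq_bigr => t _ /=; ring.
move=> [P [PD Pd]] [Q [QD Qd]]; exists (fun i t => c * P i t + Q i t).
split=> [h xi sh sx x|k h xi]; last by rewrite Pd Qd E.
by rewrite PD// QD// (E P Q (fun i t => op t (pair_fields h xi i) x)).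
Qed.

Lemma linear_of_sum (J : Type) (r : seq J) (c : J -> R) (D : J -> lagrangian R)
    (d : J -> V -> M8 -> M8 -> R) : (forall j, lin (D j) (d j)) ->
  lin (fun h xi x => \sum_(j <- r) c j * D j h xi x)
      (fun k h xi => \sum_(j <- r) c j * d j k h xi).
Proof.
move=> l; elim: r => [|j r IH].
  by apply: (linear_of_ext linear_of0) => *; rewrite big_nil.
by apply: (linear_of_ext (linear_of_lincomb (c j) (l j) IH)) => *; rewrite big_cons.
Qed.

Lemma linear_of_field i t : lin (fun h xi => op t (pair_fields h xi i))
  (fun k h xi => wt t k * pair_vec h xi i).
Proof.
exists (fun i' t' => (i' == i)%:R * (t' == t)%:R).
have E (F : pair_idx -> T -> R) :
    F i t = \sum_i' \sum_t' (i' == i)%:R * (t' == t)%:R * F i' t'.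
  rewrite (bigD1 i)//= [X in _ + X]big1 ?addr0 => [|i' /negbTE n]; last first.
    by rewrite big1// => t' _; rewrite n !mul0r.
  rewrite (bigD1 t)//= big1 ?addr0 ?eqxx ?mul1r// => t' /negbTE n.
  by rewrite n mulr0 mul0r.
split=> [h xi sh sx x|k h xi]; first by rewrite -(E (fun i t => op t (pair_fields h xi i) x)).
by rewrite -(E (fun i t => wt t k * pair_vec h xi i)).
Qed.

End LinearOf.

(** The coefficient arrays are hidden, so that the symbol of a composite Lagrangian is assembled
    from those of its factors without ever writing arrays indexed by [pair_idx]. *)
Definition has_symbol L S := exists A B, represents L A B /\
  forall k h xi, symbol_form (symbol A B) k (pair_vec h xi) (pair_vec h xi) = S k h xi.

Lemma has_symbol_ext L L' S S' : has_symbol L' S' ->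
  (forall h xi, smooth_mx h -> smooth_mx xi -> forall x, L h xi x = L' h xi x) ->
  (forall k h xi, S k h xi = S' k h xi) -> has_symbol L S.
Proof.
move=> [A [B [rL sS]]] LE SE; exists A, B; split=> [h xi sh sx x|k h xi].
  by rewrite LE// rL.
by rewrite SE sS.
Qed.

Lemma has_symbol0 : has_symbol (fun _ _ _ => 0) (fun _ _ _ => 0).
Proof.
exists (fun _ _ _ _ => 0), (fun _ _ _ _ => 0); split=> [h xi _ _ x|k h xi].
  symmetry; rewrite /quad /sum4 big1// => i _; rewrite big1// => j _; rewrite big1// => a _.
  by rewrite big1// => b _; rewrite !mul0r addr0.
rewrite symbol_formE /sum4 big1// => i _; rewrite big1// => j _; rewrite big1// => a _.
by rewrite big1// => b _; rewrite /symbol subr0 !mul0r.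
Qed.

Lemma has_symbol_lincomb c L1 S1 L2 S2 : has_symbol L1 S1 -> has_symbol L2 S2 ->
  has_symbol (fun h xi x => c * L1 h xi x + L2 h xi x)
             (fun k h xi => c * S1 k h xi + S2 k h xi).
Proof.
have E (F G : coef) : c * sum4 F + sum4 G = sum4 (fun i j a b => c * F i j a b + G i j a b).
  rewrite sum4D; congr (_ + _); rewrite mulr_sumr; apply: eq_bigr => i _; rewrite mulr_sumr.
  by apply: eq_bigr => j _; rewrite mulr_sumr; apply: eq_bigr => a _; rewrite mulr_sumr.
move=> [A1 [B1 [r1 s1]]] [A2 [B2 [r2 s2]]].
exists (fun i j a b => c * A1 i j a b + A2 i j a b), (fun i j a b => c * B1 i j a b + B2 i j a b).
split=> [h xi sh sx x|k h xi].
  rewrite r1// r2// E; apply: eq_sum4 => i j a b.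
  move: (partial a _ x) (partial b _ x) (partial a _ x) (pair_fields h xi i x) => *; ring.
by rewrite -s1 -s2 !symbol_formE E; apply: eq_sum4 => i j a b; rewrite /symbol; ring.
Qed.

Lemma has_symbol_sum (J : Type) (r : seq J) (c : J -> R) (L : J -> lagrangian R)
    (S : J -> V -> M8 -> M8 -> R) : (forall j, has_symbol (L j) (S j)) ->
  has_symbol (fun h xi x => \sum_(j <- r) c j * L j h xi x)
             (fun k h xi => \sum_(j <- r) c j * S j k h xi).
Proof.
move=> l; elim: r => [|j r IH].
  by apply: (has_symbol_ext has_symbol0) => *; rewrite big_nil.
by apply: (has_symbol_ext (has_symbol_lincomb (c j) (l j) IH)) => *; rewrite big_cons.
Qed.

Lemma product_sum4 (F G : pair_idx -> 'I_8 -> R) :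
  (\sum_i \sum_a F i a) * (\sum_j \sum_b G j b) = sum4 (fun i j a b => F i a * G j b).
Proof.
rewrite mulr_suml; apply: eq_bigr => i _; rewrite mulr_sumr; apply: eq_bigr => j _.
by rewrite mulr_suml; apply: eq_bigr => a _; rewrite mulr_sumr.
Qed.

Lemma has_symbol_first_order D1 d1 D2 d2 : first_order D1 d1 -> first_order D2 d2 ->
  has_symbol (fun h xi x => D1 h xi x * D2 h xi x) (fun k h xi => d1 k h xi * d2 k h xi).
Proof.
move=> [P [PD Pd]] [Q [QD Qd]]; exists (fun i j a b => P i a * Q j b), (fun _ _ _ _ => 0).
split=> [h xi sh sx x|k h xi].
  rewrite PD// QD// (product_sum4 (fun i a => P i a * partial a (pair_fields h xi i) x)
    (fun j b => Q j b * partial b (pair_fields h xi j) x)); apply: eq_sum4 => i j a b.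
  by move: (partial a _ x) (partial b _ x) (partial a _ x) => *; ring.
rewrite Pd Qd product_sum4 symbol_formE; apply: eq_sum4 => i j a b; rewrite /symbol; ring.
Qed.

Lemma has_symbol_second_order D1 d1 D2 d2 : zeroth_order D1 d1 -> second_order D2 d2 ->
  has_symbol (fun h xi x => D1 h xi x * D2 h xi x) (fun k h xi => - (d1 k h xi * d2 k h xi)).
Proof.
move=> [P [PD Pd]] [Q [QD Qd]].
have E (F : pair_idx -> unit -> R) (G : pair_idx -> 'I_8 * 'I_8 -> R) :
    (\sum_i \sum_t F i t) * (\sum_j \sum_t G j t) = sum4 (fun i j a b => F i tt * G j (a, b)).
  rewrite mulr_suml; apply: eq_bigr => i _; rewrite mulr_sumr; apply: eq_bigr => j _.
  rewrite (bigD1 tt)//= big1 ?addr0 => [|[]//].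
  have -> : \sum_t G j t = \sum_a \sum_b G j (a, b).
    by rewrite (pair_bigA _ (fun a b => G j (a, b))); apply: eq_bigr => -[].
  by rewrite mulr_sumr; apply: eq_bigr => a _; rewrite mulr_sumr.
exists (fun _ _ _ _ => 0), (fun i j a b => P i tt * Q j (a, b)).
split=> [h xi sh sx x|k h xi].
  rewrite PD// QD// (E (fun i t => P i t * pair_fields h xi i x)
    (fun j t => Q j t * partial t.1 (partial t.2 (pair_fields h xi j)) x)).
  apply: eq_sum4 => i j a b /=.
  by move: (partial a _ x) (partial b _ x) (partial a _ x) => *; ring.
rewrite Pd Qd E -sum4N symbol_formE; apply: eq_sum4 => i j a b; rewrite /symbol /=; ring.
Qed.

End HasSymbol.

Section SymbolCriteria.
Context (R : realType) (Phi : tensor4 R) (eta : 'M[R]_8).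
Local Notation V := (pt8 R).
Local Notation M8 := 'M[R]_8.
Implicit Types (L : lagrangian R) (S : V -> M8 -> M8 -> R) (k z : V).

Theorem eq_mod_div_symbolP L1 L2 S1 S2 : has_symbol L1 S1 -> has_symbol L2 S2 ->
  eq_mod_div Phi eta L1 L2 <->
  (forall k h xi, h^T = h -> Lambda2_7 Phi eta xi -> S1 k h xi = S2 k h xi).
Proof.
move=> [A1 [B1 [r1 s1]]] [A2 [B2 [r2 s2]]].
apply: iff_trans (eq_mod_divP Phi eta r1 r2) _.
by split=> H k h xi hs x7; have := H k h xi hs x7; rewrite s1 s2.
Qed.

Definition momentum_mx k z : M8 := \matrix_(a, b) \sum_p eta b p * (k a 0 * z p 0).

(** [S] is given only on the diagonal, so the vanishing of the polar form is expressed as additivity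
    of [S] along the variation. *)
Theorem diffeo_symbolP L S : has_symbol L S ->
  diffeo_invariant Phi eta L <->
  (forall k z h xi, h^T = h -> Lambda2_7 Phi eta xi ->
    let dh := h_part (momentum_mx k z) in
    let dx := xi_part Phi eta (momentum_mx k z) in
    S k (h + dh) (xi + dx) = S k h xi + S k dh dx).
Proof.
move=> [A [B [r s]]]; apply: iff_trans (diffeo_invariantP _ _ r) _.
have E k z h xi : S k (h + h_part (momentum_mx k z)) (xi + xi_part Phi eta (momentum_mx k z)) =
    S k h xi + (symbol_form (symbol A B) k (pair_vec h xi) (diffeo_symbol Phi eta k z) +
      symbol_form (symbol A B) k (diffeo_symbol Phi eta k z) (pair_vec h xi)) +
    S k (h_part (momentum_mx k z)) (xi_part Phi eta (momentum_mx k z)).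
  rewrite -!s (_ : pair_vec (h + _) _ = fun i => pair_vec h xi i + diffeo_symbol Phi eta k z i).
    exact: symbol_formD.
  by apply/funext => i; rewrite pair_vecD.
split=> H k z h xi hs x7; have := H k z h xi hs x7; rewrite /= E.
  by move=> ->; rewrite addr0.
by move=> e; lra.
Qed.

End SymbolCriteria.

Section GeneralSymbol.
Context (R : realType) (eta : 'M[R]_8).
Local Notation V := (pt8 R).
Local Notation M8 := 'M[R]_8.
Local Notation E := (invmx eta).
Implicit Types (L D : lagrangian R) (S d : V -> M8 -> M8 -> R) (k z : V).

Lemma has_symbol_sums (J : finType) (L : J -> lagrangian R) (S : J -> V -> M8 -> M8 -> R) :
  (forall j, has_symbol (L j) (S j)) ->
  has_symbol (fun h xi x => \sum_j L j h xi x) (fun k h xi => \sum_j S j k h xi).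
Proof.
move=> l; apply: (has_symbol_ext (has_symbol_sum (index_enum J) (fun=> 1) l)) => *;
  by apply: eq_bigr => j _; rewrite mul1r.
Qed.

Lemma has_symbolZ c L S : has_symbol L S ->
  has_symbol (fun h xi x => c * L h xi x) (fun k h xi => c * S k h xi).
Proof.
by move=> l; apply: (has_symbol_ext (has_symbol_lincomb c l (has_symbol0 R))) => *; rewrite addr0.
Qed.

Lemma linear_of_sums (T J : finType) (op : T -> (V -> R) -> V -> R) (wt : T -> V -> R)
    (D : J -> lagrangian R) (d : J -> V -> M8 -> M8 -> R) :
  (forall j, linear_of op wt (D j) (d j)) ->
  linear_of op wt (fun h xi x => \sum_j D j h xi x) (fun k h xi => \sum_j d j k h xi).
Proof.
move=> l; apply: (linear_of_ext (linear_of_sum (index_enum J) (fun=> 1) l)) => *;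
  by apply: eq_bigr => j _; rewrite mul1r.
Qed.

Lemma has_symbol_sqr3 (D : 'I_8 -> 'I_8 -> 'I_8 -> lagrangian R)
    (d : 'I_8 -> 'I_8 -> 'I_8 -> V -> M8 -> M8 -> R) :
  (forall a b c, first_order (D a b c) (d a b c)) ->
  has_symbol (fun h xi x => sqr3 eta (fun a b c => D a b c h xi x))
             (fun k h xi => sqr3 eta (fun a b c => d a b c k h xi)).
Proof.
move=> l; apply: has_symbol_sums => a; apply: has_symbol_sums => b; apply: has_symbol_sums => c.
apply: has_symbol_sums => p; apply: has_symbol_sums => q; apply: has_symbol_sums => r.
by apply: (has_symbol_ext (has_symbolZ (E a p * E b q * E c r)
  (has_symbol_first_order (l a b c) (l p q r)))) => *; rewrite mulrA.
Qed.

Lemma has_symbol_dot1 (D1 D2 : 'I_8 -> lagrangian R)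
    (d1 d2 : 'I_8 -> V -> M8 -> M8 -> R) :
  (forall a, first_order (D1 a) (d1 a)) -> (forall a, first_order (D2 a) (d2 a)) ->
  has_symbol (fun h xi x => dot1 eta (fun a => D1 a h xi x) (fun a => D2 a h xi x))
             (fun k h xi => dot1 eta (fun a => d1 a k h xi) (fun a => d2 a k h xi)).
Proof.
move=> l1 l2; apply: has_symbol_sums => a; apply: has_symbol_sums => b.
by apply: (has_symbol_ext (has_symbolZ (E a b) (has_symbol_first_order (l1 a) (l2 b)))) => *;
  rewrite mulrA.
Qed.

Definition metric_trace (m : M8) : R := \sum_a \sum_b E a b * m a b.
Definition momentum_div k (m : M8) (b : 'I_8) : R := \sum_a \sum_c E a c * (k c 0 * m a b).

Definition general_symbol (rho alpha beta gamma lambda mu : R) k (h xi : M8) : R :=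
  rho / 2 * sqr3 eta (fun a b c => k a 0 * h b c)
  + alpha / 2 * dot1 eta (fun a => k a 0 * metric_trace h) (fun a => k a 0 * metric_trace h)
  + beta * (metric_trace h * (\sum_a \sum_b \sum_c \sum_d E a c * E b d * (k c 0 * k d 0 * h a b)))
  - gamma * dot1 eta (momentum_div k h) (momentum_div k h)
  + lambda / 2 * sqr3 eta (fun a b c => k a 0 * xi b c)
  - mu * dot1 eta (momentum_div k h) (momentum_div k xi).

Lemma has_symbol_general rho alpha beta gamma lambda mu :
  has_symbol (general_lagrangian eta rho alpha beta gamma lambda mu)
             (general_symbol rho alpha beta gamma lambda mu).
Proof.
have Dh a b c : @first_order R (fun h xi => partial a (entry h b c)) (fun k h xi => k a 0 * h b c).
  exact: (linear_of_field _ _ (inl (b, c)) a).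
have Dx a b c : @first_order R (fun h xi => partial a (entry xi b c)) (fun k h xi => k a 0 * xi b c).
  exact: (linear_of_field _ _ (inr (b, c)) a).
have h0 a b : @zeroth_order R (fun h xi x => h x a b) (fun k h xi => 1 * h a b).
  exact: (linear_of_field _ _ (inl (a, b)) tt).
have tr0 : @zeroth_order R (fun h xi => trace_eta eta h) (fun k h xi => metric_trace h).
  apply: linear_of_sums => a; apply: linear_of_sum => b.
  by apply: (linear_of_ext (h0 a b)) => // *; rewrite mul1r.
have Dtr a : @first_order R (fun h xi => partial a (trace_eta eta h))
    (fun k h xi => k a 0 * metric_trace h).
  apply: (linear_of_ext (linear_of_sums (fun b => linear_of_sum (index_enum 'I_8) (fun c => E b c)
    (fun c => Dh a b c)))) => [h xi sh _ x|k h xi].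
    rewrite /trace_eta partial_sums => [|b].
      apply: eq_bigr => b _; apply: (partial_lincomb _ _ _ (f := fun c y => h y b c)) => c.
      by apply: smooth_differentiable; exact: sh.
    apply: (differentiable_lincomb _ _ (f := fun c y => h y b c)) => c.
    by apply: smooth_differentiable; exact: sh.
  rewrite mulr_sumr; apply: eq_bigr => b _; rewrite mulr_sumr; apply: eq_bigr => c _; ring.
have Divh b : @first_order R (fun h xi x => div1 eta h x b) (fun k h xi => momentum_div k h b).
  by apply: linear_of_sums => a; apply: linear_of_sum => c; exact: Dh.
have Divx b : @first_order R (fun h xi x => div1 eta xi x b) (fun k h xi => momentum_div k xi b).
  by apply: linear_of_sums => a; apply: linear_of_sum => c; exact: Dx.
have Div2 : @second_order R (fun h xi => div2 eta h)
    (fun k h xi => \sum_a \sum_b \sum_c \sum_d E a c * E b d * (k c 0 * k d 0 * h a b)).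
  apply: linear_of_sums => a; apply: linear_of_sums => b; apply: linear_of_sums => c.
  by apply: linear_of_sum => d; exact: (linear_of_field _ _ (inl (a, b)) (c, d)).
have s1 := has_symbol_sqr3 Dh; have s2 := has_symbol_dot1 Dtr Dtr.
have s3 := has_symbol_second_order tr0 Div2; have s4 := has_symbol_dot1 Divh Divh.
have s5 := has_symbol_sqr3 Dx; have s6 := has_symbol_dot1 Divh Divx.
apply: (has_symbol_ext (has_symbol_lincomb (rho / 2) s1 (has_symbol_lincomb (alpha / 2) s2
  (has_symbol_lincomb (- beta) s3 (has_symbol_lincomb (- gamma) s4
  (has_symbol_lincomb (lambda / 2) s5 (has_symbol_lincomb (- mu) s6 (has_symbol0 R)))))))).
  move=> h xi _ _ x; rewrite /general_lagrangian /grad_sqr /grad_trace_sqr.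
  move: (sqr3 _ _) (sqr3 _ _) (dot1 _ _ _) (trace_eta _ _ _) (div2 _ _ _) (dot1 _ _ _) (dot1 _ _ _).
  by move=> *; ring.
move=> k h xi; rewrite /general_symbol.
move: (sqr3 _ _) (sqr3 _ _) (dot1 _ _ _) (metric_trace _) (\sum_a _) (dot1 _ _ _) (dot1 _ _ _).
by move=> *; ring.
Qed.

End GeneralSymbol.

(** * Symbols in an orthonormal frame *)

Section Frame.
Context (R : realType) (g : 'M[R]_8) (gu : g \in unitmx).
Local Notation V := (pt8 R).
Local Notation M8 := 'M[R]_8.
Local Notation G := (invmx g).
Local Notation E := (invmx (g^T *m g)).
Local Notation eta := (g^T *m g).
Local Notation Phi0 := (cayley0 R).
Local Notation Phi := (pullback4 g Phi0).
Implicit Types (k z : V) (h xi m : M8).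

Let EG : E = G *m G^T. Proof. exact: invmx_gram. Qed.

Let ET : E^T = E. Proof. by rewrite EG trmx_mul trmxK. Qed.

Definition bilin (m : M8) (p q : V) : R := \tr (p^T *m m *m q).

Lemma dot1_bilin (s t : 'I_8 -> R) : dot1 eta s t = bilin E (\col_a s a) (\col_a t a).
Proof.
rewrite /dot1 /bilin /mxtrace big_ord1 !mxE exchange_big; apply: eq_bigr => b _.
rewrite !mxE mulr_suml; apply: eq_bigr => a _; rewrite !mxE; ring.
Qed.

Lemma sum6_split (F : 'I_8 -> 'I_8 -> R) (H : 'I_8 -> 'I_8 -> 'I_8 -> 'I_8 -> R) :
  \sum_a \sum_b \sum_c \sum_p \sum_q \sum_r F a p * H b c q r =
  (\sum_a \sum_p F a p) * (\sum_b \sum_c \sum_q \sum_r H b c q r).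
Proof.
rewrite mulr_suml; apply: eq_bigr => a _; rewrite mulr_sumr; apply: eq_bigr => b _.
rewrite mulr_sumr; apply: eq_bigr => c _; rewrite mulr_suml; apply: eq_bigr => p _.
by rewrite mulr_sumr; apply: eq_bigr => q _; rewrite mulr_sumr.
Qed.

Lemma sqr3_tensor k m :
  sqr3 eta (fun a b c => k a 0 * m b c) = bilin E k k * \tr (m *m E *m m^T *m E).
Proof.
rewrite /sqr3.
transitivity (\sum_a \sum_b \sum_c \sum_p \sum_q \sum_r
    (E a p * k a 0 * k p 0) * (m b c * E c r * m q r * E b q)).
  by do 6 (apply: eq_bigr => ? _); ring.
rewrite (sum6_split (fun a p => E a p * k a 0 * k p 0)
  (fun b c q r => m b c * E c r * m q r * E b q)); congr (_ * _).
  rewrite -[LHS]/(dot1 eta (fun a => k a 0) (fun a => k a 0)) dot1_bilin.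
  by congr bilin; apply/matrixP => i j; rewrite mxE (ord1 j).
apply: eq_bigr => b _; rewrite mxE exchange_big; apply: eq_bigr => q _.
have -> : E q b = E b q by rewrite -[in LHS]ET mxE.
rewrite mxE mulr_suml exchange_big; apply: eq_bigr => r _ /=.
by rewrite mxE [m^T _ _]mxE !mulr_suml.
Qed.

Lemma metric_traceE m : metric_trace eta m = \tr (m *m E).
Proof.
apply: eq_bigr => a _; rewrite mxE; apply: eq_bigr => b _.
by rewrite -[in E a b]ET mxE mulrC.
Qed.

Lemma momentum_divE k m : \col_b momentum_div eta k m b = m^T *m E *m k.
Proof.
apply/matrixP => b j; rewrite (ord1 j) -mulmxA !mxE; apply: eq_bigr => a _.
rewrite !mxE mulr_sumr; apply: eq_bigr => c _; ring.
Qed.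

Lemma momentum_div2E k m :
  \sum_a \sum_b \sum_c \sum_d E a c * E b d * (k c 0 * k d 0 * m a b) = bilin (E *m m *m E) k k.
Proof.
have -> : bilin (E *m m *m E) k k = bilin m (E *m k) (E *m k).
  by rewrite /bilin trmx_mul ET !mulmxA.
rewrite /bilin /mxtrace big_ord1 [RHS]mxE exchange_big; apply: eq_bigr => b _.
rewrite [in RHS]mxE mulr_suml; apply: eq_bigr => a _; rewrite [_^T _ _]mxE [(_ *m k) a _]mxE.
rewrite [(_ *m k) b _]mxE !mulr_suml; apply: eq_bigr => c _.
by rewrite mulr_sumr; apply: eq_bigr => d _; ring.
Qed.

Local Notation fr := (conjmx8 G).

Lemma tr_frame m : \tr (fr m) = \tr (m *m E).
Proof. by rewrite /conjmx8 mxtrace_mulC mulmxA -EG mxtrace_mulC. Qed.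

Lemma frame_mul m n : fr m *m fr n = fr (m *m E *m n).
Proof. by rewrite /conjmx8 EG !mulmxA. Qed.

Lemma tr_frame_momentum k m : \tr (fr (k *m k^T) *m fr m) = bilin (E *m m *m E) k k.
Proof.
by rewrite frame_mul tr_frame /bilin -!mulmxA mxtrace_mulC !mulmxA.
Qed.

Lemma general_symbol_frame rho alpha beta gamma lambda mu k h xi : h^T = h -> xi^T = - xi ->
  general_symbol eta rho alpha beta gamma lambda mu k h xi =
  general_form rho alpha beta gamma lambda mu (fr (k *m k^T)) (fr (h + xi)) (fr (h + xi)).
Proof.
move=> hs xs; rewrite /general_form !sym_part_conj !skew_part_conj sym_partE// skew_partE//.
rewrite /general_symbol !sqr3_tensor momentum_div2E !dot1_bilin !momentum_divE metric_traceE.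
have -> : \col_a (k a 0 * \tr (h *m E)) = \tr (h *m E) *: k.
  by apply/matrixP => i j; rewrite !mxE (ord1 j) mulrC.
have -> : bilin E (\tr (h *m E) *: k) (\tr (h *m E) *: k) = \tr (h *m E) ^+ 2 * bilin E k k.
  by rewrite /bilin [(_ *: _)^T]linearZ/= -!scalemxAl -scalemxAr !mxtraceZ; ring.
have V m n : bilin E (m^T *m E *m k) (n^T *m E *m k) = bilin (E *m (m *m E *m n^T) *m E) k k.
  by rewrite /bilin !trmx_mul trmxK ET !mulmxA.
rewrite !V /quadratic_form conjmx8_tr (frame_mul h h) (frame_mul h xi^T) (frame_mul xi xi^T).
rewrite !tr_frame_momentum !tr_frame !hs.
have -> : \tr (k *m k^T *m E) = bilin E k k.
  by rewrite /bilin -mulmxA mxtrace_mulC.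
by rewrite !mulmxA; field.
Qed.


Lemma frame_momentum_mx k z : fr (momentum_mx eta k z) = (G^T *m k) *m (g *m z)^T.
Proof.
have -> : momentum_mx eta k z = k *m z^T *m eta.
  apply/matrixP => a b; rewrite !mxE; apply: eq_bigr => p _.
  rewrite [(k *m _) a p]mxE big_ord1 [z^T _ _]mxE [eta b p]mxE [eta p b]mxE mulrC.
  by congr (_ * _); apply: eq_bigr => q _; rewrite !mxE mulrC.
by rewrite /conjmx8 trmx_mul !mulmxA mulmxK.
Qed.

(** The symmetric and skew halves of [m] recombine, so both transformation laws together are the
    single map [m - J m]; here carrying [h + xi] as one matrix pays off. *)
Lemma frame_diffeo m : h_part m + xi_part Phi eta m = m - J2 Phi eta m.
Proof. by apply/matrixP => a b; rewrite !mxE; field. Qed.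

Lemma frame_J2 m : fr (J2 Phi eta m) = J2 Phi0 1%:M (fr m).
Proof.
rewrite -[in LHS](conjmx8VK gu m) -[RHS](conjmx8K gu); congr conjmx8.
exact: J2_pullback.
Qed.

End Frame.

(** * The polar form against a linearised diffeomorphism *)

Section DiffeoForm.
Context (R : realType).
Local Notation V := (pt8 R).
Local Notation M8 := 'M[R]_8.
Local Notation Phi0 := (cayley0 R).
Local Notation J := (J2 Phi0 1%:M).
Implicit Types (k z p q x y : V) (h xi m : M8).

Let bilinE m p q : bilin m p q = (p^T *m m *m q) 0 0.
Proof. exact: trace_mx11. Qed.

Lemma bilin_tensor p q x y : bilin (p *m q^T) x y = bilin 1%:M x p * bilin 1%:M q y.
Proof.
rewrite !bilinE !mulmx1 !mulmxA -mulmxA mxE big_ord1; congr (_ * _).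
Qed.

Lemma bilinD m n p q : bilin (m + n) p q = bilin m p q + bilin n p q.
Proof. by rewrite /bilin mulmxDr mulmxDl mxtraceD. Qed.

Lemma bilinZ c m p q : bilin (c *: m) p q = c * bilin m p q.
Proof. by rewrite /bilin -scalemxAr -scalemxAl mxtraceZ. Qed.

Lemma bilinN m p q : bilin (- m) p q = - bilin m p q.
Proof. by rewrite -scaleN1r bilinZ mulN1r. Qed.

Lemma bilin_tr m p q : bilin m^T p q = bilin m q p.
Proof. by rewrite /bilin -mxtrace_tr !trmx_mul !trmxK mulmxA. Qed.

Lemma tr_mul_tensor m p q : \tr (m *m (p *m q^T)) = bilin m q p.
Proof. by rewrite /bilin mulmxA mxtrace_mulC mulmxA. Qed.

Lemma tr_tensor_mul m p q : \tr (p *m q^T *m m) = bilin m q p.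
Proof. by rewrite /bilin -mulmxA mxtrace_mulC. Qed.

(** This is the symmetry of the Cayley form under exchange of its two index pairs. *)
Lemma J2_adjoint m n : \tr (m *m (J n)^T) = \tr (J m *m n^T).
Proof.
rewrite !J2_cayley0 [(_ *: _)^T]linearZ/= -scalemxAr -scalemxAl !mxtraceZ; congr (_ * _).
have alt := cayley0_alternating R.
have sw (a b p q : 'I_8) : Phi0 a b p q = Phi0 p q a b.
  have [_ e2 _] := alt a b p q; have [f1 _ _] := alt a p b q.
  have [_ _ g3] := alt p a b q; have [_ i2 _] := alt p a q b.
  by rewrite i2 g3 f1 e2 !opprK.
transitivity (\sum_a \sum_b \sum_(p < 8) \sum_(q < 8) m a b * (Phi0 a b p q * n p q)).
  apply: eq_bigr => a _; rewrite mxE; apply: eq_bigr => b _; rewrite !mxE mulr_sumr.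
  by apply: eq_bigr => p _; rewrite mulr_sumr.
rewrite (pair_bigA _ (fun a b : 'I_8 => \sum_(p < 8) \sum_(q < 8) m a b * (Phi0 a b p q * n p q))) /=.
under eq_bigr => u _ do rewrite (pair_bigA _ (fun p q : 'I_8 => m u.1 u.2 * (Phi0 u.1 u.2 p q * n p q))) /=.
rewrite exchange_big.
rewrite -(pair_bigA _ (fun p q : 'I_8 => \sum_u m u.1 u.2 * (Phi0 u.1 u.2 p q * n p q))) /=.
apply: eq_bigr => p _; rewrite mxE; apply: eq_bigr => q _; rewrite !mxE mulr_suml.
rewrite -(pair_bigA _ (fun a b : 'I_8 => m a b * (Phi0 a b p q * n p q))) /=.
apply: eq_bigr => a _; rewrite mulr_suml; apply: eq_bigr => b _; rewrite (sw p q a b); ring.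
Qed.

(** Here [k] is contracted twice with an alternating form. *)
Lemma J2_momentum k z : J (k *m z^T) *m k = 0.
Proof.
rewrite J2_cayley0 -scalemxAl; apply/matrixP => a j; rewrite (ord1 j) !mxE.
rewrite [X in _ * X](_ : _ = 0) ?mulr0//.
pose F (b p : 'I_8) : R := k b 0 * k p 0 * \sum_(q < 8) Phi0 a b p q * z q 0.
transitivity (\sum_(b < 8) \sum_(p < 8) F b p).
  apply: eq_bigr => b _; rewrite mxE mulr_suml; apply: eq_bigr => p _; rewrite /F mulr_suml mulr_sumr.
  by apply: eq_bigr => q _; rewrite mxE big_ord1 mxE; ring.
have FN (b p : 'I_8) : F b p = - F p b.
  rewrite /F (mulrC (k p 0)) -mulrN -sumrN; congr (_ * _); apply: eq_bigr => q _.
  by case: (cayley0_alternating R a p b q) => _ -> _; rewrite mulNr.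
set X := \sum_b _; suff : X = - X by move=> ?; lra.
by rewrite {1}/X exchange_big -sumrN; apply: eq_bigr => b _; rewrite -sumrN; apply: eq_bigr.
Qed.

(** All traces reduce to values of [h], [xi] and the metric on [k] and [z]. The operator [J] is
    skew-valued and [J w] kills [k], so it survives only in the term [e8]. *)
Lemma general_form_diffeo rho alpha beta gamma lambda mu k z h xi (w := k *m z^T) :
  h^T = h -> Lambda2_7 Phi0 1%:M xi ->
  general_form rho alpha beta gamma lambda mu (k *m k^T) (h + xi) (w - J w) =
  2^-1 * ((rho - gamma - mu / 2) * (bilin 1%:M k k * bilin h k z)
    + (alpha + beta) * (bilin 1%:M k k * bilin 1%:M k z * \tr h)
    + (beta - gamma + mu / 2) * (bilin 1%:M k z * bilin h k k)
    + (4 * lambda - mu / 2) * (bilin 1%:M k k * bilin xi k z)).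
Proof.
move=> hs [xs x7]; have JT m : (J m)^T = - J m by exact: J2_skew.
have wT : w^T = z *m k^T by rewrite trmx_mul trmxK.
rewrite /general_form sym_partE// skew_partE//.
have -> : sym_part (w - J w) = sym_part w.
  by rewrite /sym_part [(w - _)^T]linearB/= JT opprK addrACA addNr addr0.
have -> : skew_part (w - J w) = skew_part w - J w.
  rewrite /skew_part [(w - _)^T]linearB/= JT opprK.
  by apply/matrixP => a b; rewrite !mxE; field.
have xN p q : bilin xi p q = - bilin xi q p by rewrite -bilin_tr xs bilinN.
have x0 p : bilin xi p p = 0 by have := xN p p => ?; lra.
have hC p q : bilin h p q = bilin h q p by rewrite -bilin_tr hs.
have oneC p q : bilin 1%:M p q = bilin 1%:M q p by rewrite -bilin_tr trmx1.
have trw m : \tr (m *m w) = bilin m z k by exact: tr_mul_tensor.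
have trwT m : \tr (m *m w^T) = bilin m k z by rewrite wT tr_mul_tensor.
have trK m : \tr (k *m k^T *m m) = bilin m k k by exact: tr_tensor_mul.
have tr1 p q : \tr (p *m q^T) = bilin 1%:M q p by rewrite -tr_mul_tensor mul1mx.
have r1 m p q : bilin 1%:M p (m *m q) = bilin m p q by rewrite /bilin mulmx1 mulmxA.
have l1 m p q : bilin 1%:M (m^T *m p) q = bilin m p q by rewrite /bilin mulmx1 trmx_mul trmxK.
have skT : (skew_part w - J w)^T = 2^-1 *: (w^T - w) + J w.
  rewrite [(_ - _)^T]linearB/= JT opprK /skew_part [(_ *: _)^T]linearZ/= [(w - _)^T]linearB/=.
  by rewrite trmxK.
have e2 : \tr (h *m sym_part w) = bilin h k z.
  by rewrite -scalemxAr mxtraceZ mulmxDr mxtraceD trw trwT (hC z); field.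
have e3 : \tr (sym_part w) = bilin 1%:M k z.
  by rewrite mxtraceZ mxtraceD mxtrace_tr tr1 (oneC z); field.
have e4 : bilin (sym_part w) k k = bilin 1%:M k k * bilin 1%:M k z.
  by rewrite bilinZ bilinD bilin_tr bilin_tensor (oneC z); field.
have hw : bilin (h *m w) k k = bilin h k k * bilin 1%:M k z.
  by rewrite mulmxA bilin_tensor r1 (oneC z).
have hwT : bilin (h *m w^T) k k = bilin h k z * bilin 1%:M k k.
  by rewrite wT mulmxA bilin_tensor r1.
have e6 : bilin (h *m sym_part w) k k =
    2^-1 * (bilin h k k * bilin 1%:M k z + bilin h k z * bilin 1%:M k k).
  by rewrite -scalemxAr bilinZ mulmxDr bilinD hw hwT.
have e7 : bilin (sym_part w *m h) k k = bilin (h *m sym_part w) k k.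
  rewrite -[LHS]bilin_tr trmx_mul hs /sym_part [(_ *: _)^T]linearZ/= [(w + _)^T]linearD/= trmxK.
  by rewrite (addrC w).
(* The antisymmetrised [w] contributes 1, and [J], moved onto [xi] where it is -3, contributes 3.
   This 4 is the origin of the 8 in [lambda = mu / 8]. *)
have e8 : \tr (xi *m (2^-1 *: (w^T - w) + J w)) = 4 * bilin xi k z.
  rewrite mulmxDr mxtraceD -scalemxAr mxtraceZ mulmxBr.
  have -> : xi *m J w = - (xi *m (J w)^T) by rewrite JT mulmxN opprK.
  rewrite -!(scaleN1r (_ *m _)) mxtraceD !mxtraceZ J2_adjoint x7 -scalemxAl mxtraceZ trw trwT.
  by rewrite (xN z k); field.
have e9 : bilin (h *m (2^-1 *: (w^T - w) + J w)) k k =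
    2^-1 * (bilin h k z * bilin 1%:M k k - bilin h k k * bilin 1%:M k z).
  rewrite mulmxDr bilinD -scalemxAr bilinZ mulmxBr bilinD bilinN hw hwT.
  rewrite [X in _ + X](_ : _ = 0) ?addr0// /bilin -mulmxA -(mulmxA h) J2_momentum !mulmx0.
  exact: mxtrace0.
have e10 : bilin (sym_part w *m xi^T) k k = 2^-1 * (bilin 1%:M k k * bilin xi k z).
  rewrite -scalemxAl bilinZ xs mulmxN bilinN mulmxDl bilinD wT; congr (_ * _).
  have E p q : p *m q^T *m xi = p *m (xi^T *m q)^T by rewrite trmx_mul trmxK mulmxA.
  by rewrite !E !bilin_tensor !l1 x0 (xN z) mulr0 addr0 mulrN opprK.
rewrite /quadratic_form skT.
rewrite (trK (sym_part w)) (trK h) (trK (h *m _)) (trK (sym_part w *m h)) (trK (h *m (_ + _))).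
rewrite (trK (sym_part w *m _)) e2 e3 e4 e7 e6 e8 e9 e10 tr1.
by move: (bilin 1%:M k k) (bilin h k z) (bilin h k k) (bilin xi k z) (bilin 1%:M k z) (\tr h) => *; field.
Qed.

End DiffeoForm.

(** * The linear conditions and the two-parameter family *)

Section DiffeoInvariance.
Context (R : realType) (g : 'M[R]_8) (gu : g \in unitmx).
Local Notation V := (pt8 R).
Local Notation M8 := 'M[R]_8.
Local Notation G := (invmx g).
Local Notation eta := (g^T *m g).
Local Notation Phi0 := (cayley0 R).
Local Notation Phi := (pullback4 g Phi0).
Local Notation J := (J2 Phi0 1%:M).
Local Notation fr := (conjmx8 G).
Implicit Types (k z : V) (h xi m : M8) (L : lagrangian R) (S : V -> M8 -> M8 -> R).

Lemma conjmx8D u m n : conjmx8 u (m + n) = conjmx8 u m + conjmx8 u n :> M8.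
Proof. by rewrite /conjmx8 mulmxDr mulmxDl. Qed.

Lemma conjmx8Z c u m : conjmx8 u (c *: m) = c *: conjmx8 u m :> M8.
Proof. by rewrite /conjmx8 -scalemxAr -scalemxAl. Qed.

Lemma conjmx8N u m : conjmx8 u (- m) = - conjmx8 u m :> M8.
Proof. by rewrite -scaleN1r conjmx8Z scaleN1r. Qed.

Lemma conjmx8_momentum u k z : conjmx8 u (k *m z^T) = (u^T *m k) *m (u^T *m z)^T :> M8.
Proof. by rewrite /conjmx8 trmx_mul trmxK !mulmxA. Qed.

Lemma general_form_expand rho alpha beta gamma lambda mu K (u w : M8) :
  general_form rho alpha beta gamma lambda mu K (u + w) (u + w) =
  general_form rho alpha beta gamma lambda mu K u u +
  2 * general_form rho alpha beta gamma lambda mu K u w +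
  general_form rho alpha beta gamma lambda mu K w w.
Proof.
pose F := general_form rho alpha beta gamma lambda mu K.
have FC x y : F x y = F y x by exact: general_formC.
have lin x : F (u + w) x = F u x + F w x.
  by have := general_form_linearm rho alpha beta gamma lambda mu K x 1 u w; rewrite scale1r mul1r.
rewrite -/F; clearbody F; rewrite lin !(FC _ (u + w)) !lin (FC w u); ring.
Qed.

Lemma Lambda2_7_frameV xi : Lambda2_7 Phi eta xi <-> Lambda2_7 Phi0 1%:M (fr xi).
Proof. by rewrite -[xi in X in X <-> _](conjmx8VK gu); exact: Lambda2_7_frame. Qed.

(** Momenta transform by the transposed inverse frame and vectors by the frame; since [k], [z] and
    the fields range over everything, the condition can be restated in the model frame. *)
Lemma diffeo_general_formP rho alpha beta gamma lambda mu :
  diffeo_invariant Phi eta (general_lagrangian eta rho alpha beta gamma lambda mu) <->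
  (forall k z h xi, h^T = h -> Lambda2_7 Phi0 1%:M xi ->
    general_form rho alpha beta gamma lambda mu (k *m k^T) (h + xi)
      (k *m z^T - J (k *m z^T)) = 0).
Proof.
apply: iff_trans (diffeo_symbolP Phi eta (has_symbol_general eta _ _ _ _ _ _)) _.
have E k z h xi : h^T = h -> Lambda2_7 Phi eta xi ->
    let dh := h_part (momentum_mx eta k z) in
    let dx := xi_part Phi eta (momentum_mx eta k z) in
    let S := general_symbol eta rho alpha beta gamma lambda mu k in
    let w := (G^T *m k) *m (g *m z)^T in
    S (h + dh) (xi + dx) = S h xi + S dh dx +
      2 * general_form rho alpha beta gamma lambda mu ((G^T *m k) *m (G^T *m k)^T)
        (fr h + fr xi) (w - J w).
  move=> hs [xs _] /=; set m := momentum_mx eta k z.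
  have dhs : (h_part m)^T = h_part m by apply/matrixP => a b; rewrite !mxE addrC.
  have wE : fr m = (G^T *m k) *m (g *m z)^T by exact: frame_momentum_mx.
  have dE : fr (h_part m) + fr (xi_part Phi eta m) = fr m - J (fr m).
    by rewrite -conjmx8D frame_diffeo conjmx8D conjmx8N frame_J2.
  have dxs : (xi_part Phi eta m)^T = - xi_part Phi eta m.
    have -> : xi_part Phi eta m = skew_part m - J2 Phi eta m.
      by apply/matrixP => a b; rewrite !mxE.
    apply: (can_inj (conjmx8VK gu)) => /=.
    rewrite -conjmx8_tr conjmx8N conjmx8D conjmx8N frame_J2// -skew_part_conj.
    by rewrite [(_ - _)^T]linearB/= J2_skew /skew_part [(_ *: _)^T]linearZ/= [(_ - _)^T]linearB/= trmxK opprB opprK addrC -scalerN opprB.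
  rewrite !general_symbol_frame//; last 2 first.
  - by rewrite [(h + _)^T]linearD/= hs dhs.
  - by rewrite [(xi + _)^T]linearD/= xs dxs opprD.
  rewrite -wE -dE -(conjmx8D G (h_part m)) -(conjmx8D G h xi) (addrACA h).
  rewrite (conjmx8D G (h + xi)) conjmx8_momentum.
  by rewrite general_form_expand addrAC.
split=> [H k z h xi hs x7|H k z h xi hs x7 /=].
  have xf : Lambda2_7 Phi eta (conjmx8 g xi) by apply/Lambda2_7_frame.
  have := H (g^T *m k) (G *m z) _ _ (conjmx8_sym g hs) xf.
  rewrite /= E//; last exact: conjmx8_sym.
  rewrite !conjmx8K// !mulmxA -trmx_mul mulmxV// trmx1 !mul1mx => e; lra.
by rewrite E// H ?mulr0 ?addr0//; [exact: conjmx8_sym|exact/Lambda2_7_frameV].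
Qed.

Lemma bilin_delta m a b : bilin m (delta_mx a 0) (delta_mx b 0) = m a b.
Proof. by rewrite /bilin trace_mx11 trmx_delta -rowE -colE !mxE. Qed.

Lemma J2_skew_part m : J (skew_part m) = J m.
Proof.
have mE : m = sym_part m + skew_part m by apply/matrixP => a b; rewrite !mxE; field.
have sm : (sym_part m)^T = sym_part m.
  by rewrite /sym_part [(_ *: _)^T]linearZ/= [(m + _)^T]linearD/= trmxK addrC.
by rewrite [in RHS]mE J2D (J2_sym sm) add0r.
Qed.

Lemma skew_part_skew m : (skew_part m)^T = - skew_part m.
Proof.
by rewrite /skew_part [(_ *: _)^T]linearZ/= [(_ - _)^T]linearB/= trmxK -scalerN opprB.
Qed.

(** [J] ignores symmetric parts, so the variation is 4 times the projection of the skew part onto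
    [Lambda2_7]. *)
Lemma xi_part_Lambda2_7 m : Lambda2_7 Phi eta (xi_part Phi eta m).
Proof.
have -> : xi_part Phi eta m = skew_part m - J2 Phi eta m by apply/matrixP => a b; rewrite !mxE.
apply/Lambda2_7_frameV; rewrite conjmx8D conjmx8N frame_J2// -skew_part_conj -J2_skew_part.
rewrite (_ : _ - _ = 4 *: Lambda2_7_part (skew_part (fr m))).
  by apply: Lambda2_7Z; apply: Lambda2_7_partP; exact: skew_part_skew.
by rewrite /Lambda2_7_part scalerA mulfV ?scale1r ?pnatr_eq0.
Qed.

Theorem diffeo_general_lagrangianP rho alpha beta gamma lambda mu :
  diffeo_invariant Phi eta (general_lagrangian eta rho alpha beta gamma lambda mu) <->
  [/\ alpha = - rho + mu, beta = rho - mu, gamma = rho - mu / 2 & lambda = mu / 8].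
Proof.
apply: iff_trans (diffeo_general_formP _ _ _ _ _ _) _; split=> [H|[-> -> -> ->] k z h xi hs x7].
  have half0 (x : R) : 2^-1 * x = 0 -> x = 0 by move=> ?; lra.
  pose e (a : 'I_8) : V := delta_mx a 0.
  have T h a b : h^T = h -> Lambda2_7 Phi0 1%:M 0 ->
    (rho - gamma - mu / 2) * h a b + (alpha + beta) * ((a == b)%:R * \tr h)
    + (beta - gamma + mu / 2) * ((a == b)%:R * h a a) = 0.
    move=> hs z7; have := H (e a) (e b) h 0 hs z7; rewrite general_form_diffeo// !bilin_delta.
    rewrite !mxE eqxx (_ : true%:R = 1)// => e0.
    by apply: half0; rewrite -[RHS]e0; ring.
  have z7 : Lambda2_7 Phi0 1%:M 0 by split; rewrite ?trmx0 ?oppr0// J20 scaler0.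
  have dT (a b : 'I_8) : (delta_mx a b + delta_mx b a : M8)^T = delta_mx a b + delta_mx b a.
    by rewrite [(_ + _)^T]linearD/= !trmx_delta addrC.
  have dT1 (a : 'I_8) : (delta_mx a a : M8)^T = delta_mx a a by exact: trmx_delta.
  have trd (a : 'I_8) : \tr (delta_mx a a : M8) = 1.
    rewrite /mxtrace (bigD1 a)//= mxE !eqxx big1 ?addr0// => b /negbTE ba.
    by rewrite mxE ba.
  (* Tests with [xi = 0]: an off-diagonal [h] isolates the first coefficient; then, with
     [k = z = e 0], the choice [h = delta_mx 1 1] isolates the second, and [delta_mx 0 0] gives the
     third. *)
  have := T _ 0 1 (dT 0 1) z7; rewrite !mxE /= => t1.
  have := T _ 0 0 (dT1 1) z7; rewrite trd !mxE /= => t2.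
  have := T _ 0 0 (dT1 0) z7; rewrite trd !mxE /= => t3.
  (* The [Lambda2_7] part of a simple 2-form isolates the last coefficient. Its entry at (0, 1) is
     1/4 * 1/2, because [J w] kills [e 0]. *)
  pose w : M8 := e 0 *m (e 1)^T; pose x := Lambda2_7_part (skew_part w).
  have ss := skew_part_skew w.
  have x7 : Lambda2_7 Phi0 1%:M x by exact: Lambda2_7_partP.
  have Jw : J (skew_part w) = J w by exact: J2_skew_part.
  have xv : bilin x (e 0) (e 1) = 8^-1.
    rewrite /x /Lambda2_7_part Jw bilinZ bilinD bilinN.
    have -> : bilin (J w) (e 0) (e 1) = 0.
      by rewrite -bilin_tr J2_skew bilinN /bilin -mulmxA J2_momentum mulmx0 mxtrace0 oppr0.
    by rewrite /skew_part bilinZ bilinD bilinN bilin_tr !bilin_tensor !bilin_delta !mxE /=; field.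
  have t4 := H (e 0) (e 1) 0 x (trmx0 _ _ _) x7.
  have t4' := general_form_diffeo rho alpha beta gamma lambda mu (e 0) (e 1) (trmx0 _ _ _) x7.
  move: t4'; rewrite t4 xv !bilin_delta mxtrace0 !mxE /= => t4'.
  by split; lra.
rewrite general_form_diffeo//; move: (bilin _ _ _) (bilin _ _ _) (bilin _ _ _) (bilin _ _ _) => *.
by field.
Qed.

(** For a transverse [h] every term containing a divergence drops out. Such fields are enough to
    separate the members of the family. *)
Lemma general_form_null rho alpha beta gamma lambda mu k h : h^T = h -> h *m k = 0 ->
  general_form rho alpha beta gamma lambda mu (k *m k^T) h h =
  bilin 1%:M k k * (rho / 2 * \tr (h *m h) + alpha / 2 * \tr h ^+ 2).
Proof.
move=> hs hk; have kh : k^T *m h = 0 by rewrite -[h]hs -trmx_mul hk trmx0.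
have z0 : (0 : M8)^T = - 0 by rewrite trmx0 oppr0.
have := sym_partE hs z0; have := skew_partE hs z0; rewrite /general_form addr0 => -> ->.
have K0 : k *m k^T *m h = 0 by rewrite -mulmxA kh mulmx0.
rewrite /quadratic_form trmx0 !mulmxA K0 !mul0mx !mxtrace0.
have -> : \tr (k *m k^T) = bilin 1%:M k k by rewrite /bilin mulmx1 mxtrace_mulC.
ring.
Qed.

Definition invariant_family (r : R * R) : lagrangian R :=
  fun (h xi : V -> M8) x => r.1 * lagrangian_GR eta h xi x + r.2 * lagrangian' eta h xi x.

Lemma invariant_familyE r : invariant_family r =
  general_lagrangian eta r.1 (- r.1 + r.2) (r.1 - r.2) (r.1 - r.2 / 2) (r.2 / 8) r.2.
Proof.
apply/funext => h; apply/funext => xi; apply/funext => x.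
rewrite /invariant_family /lagrangian_GR /lagrangian' /general_lagrangian.
move: (grad_sqr _ _ _) (grad_trace_sqr _ _ _) (grad_sqr _ _ _) (trace_eta _ _ _) (div2 _ _ _).
by move: (dot1 _ _ _) (dot1 _ _ _) => *; field.
Qed.

Lemma invariant_family_inj L S r r' : has_symbol L S ->
  eq_mod_div Phi eta L (invariant_family r) -> eq_mod_div Phi eta L (invariant_family r') -> r = r'.
Proof.
move=> sL; rewrite !invariant_familyE.
move=> /(eq_mod_div_symbolP Phi eta sL (has_symbol_general eta _ _ _ _ _ _)) H.
move=> /(eq_mod_div_symbolP Phi eta sL (has_symbol_general eta _ _ _ _ _ _)) H'.
have T h : h^T = h -> h *m (delta_mx 0 0 : V) = 0 ->
    (r.1 - r'.1) * (\tr (h *m h) - \tr h ^+ 2) + (r.2 - r'.2) * \tr h ^+ 2 = 0.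
  move=> hs hk; pose e : V := delta_mx 0 0.
  have z7 : Lambda2_7 Phi eta 0.
    by apply/Lambda2_7_frameV; rewrite /conjmx8 mulmx0 mul0mx; split; rewrite ?trmx0 ?oppr0// J20 scaler0.
  have z0 : (0 : M8)^T = - 0 by rewrite trmx0 oppr0.
  have hs' := conjmx8_sym g hs.
  have := H' (g^T *m e) _ 0 hs' z7; rewrite (H (g^T *m e) _ 0 hs' z7).
  rewrite !(general_symbol_frame gu _ _ _ _ _ _ _ hs' z0) addr0 conjmx8K//.
  rewrite conjmx8_momentum !mulmxA -trmx_mul mulmxV// trmx1 mul1mx.
  rewrite !general_form_null// /e bilin_delta mxE eqxx mul1r mul1r => ?; lra.
have dT (a b : 'I_8) : (delta_mx a b + delta_mx b a : M8)^T = delta_mx a b + delta_mx b a.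
  by rewrite [(_ + _)^T]linearD/= !trmx_delta addrC.
have trd (a b : 'I_8) : \tr (delta_mx a b : M8) = (a == b)%:R.
  rewrite /mxtrace (bigD1 a)//= mxE eqxx big1 ?addr0// => c /negbTE ca.
  by rewrite mxE ca.
(* This matrix is transverse to [e_0] and traceless, so it compares the first parameters;
   [delta_mx 1 1] satisfies [\tr (h *m h) = \tr h ^+ 2] and compares the second ones. *)
have := T (delta_mx 1 2 + delta_mx 2 1) (dT _ _).
rewrite !(mulmxDl, mulmxDr, mul_delta_mx_cond) /= !mulr0n !mulr1n !mxtraceD !trd !mxtrace0 /=.
rewrite addr0 => /(_ (addr0 _)) t1.
have := T (delta_mx 1 1) (trmx_delta _ _ _).
rewrite !mul_delta_mx_cond /= !mulr0n !mulr1n !trd /= => /(_ erefl) t2.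
by case: r r' t1 t2 {H H' T} => [a b] [c d] /= t1 t2; congr (_, _); lra.
Qed.

Lemma eq_mod_div_sym L1 L2 S1 S2 : has_symbol L1 S1 -> has_symbol L2 S2 ->
  eq_mod_div Phi eta L1 L2 -> eq_mod_div Phi eta L2 L1.
Proof.
move=> s1 s2 /(eq_mod_div_symbolP Phi eta s1 s2) H.
by apply/(eq_mod_div_symbolP Phi eta s2 s1) => k h xi hs x7; rewrite H.
Qed.

(** The variations stay in the field space, where the two symbols agree; invariance therefore
    depends only on the class modulo divergences. *)
Lemma diffeo_invariant_eq_mod_div L1 L2 S1 S2 : has_symbol L1 S1 -> has_symbol L2 S2 ->
  eq_mod_div Phi eta L1 L2 -> diffeo_invariant Phi eta L1 -> diffeo_invariant Phi eta L2.
Proof.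
move=> s1 s2 /(eq_mod_div_symbolP Phi eta s1 s2) H /(diffeo_symbolP Phi eta s1) D.
apply/(diffeo_symbolP Phi eta s2) => k z h xi hs x7 dh dx.
have dhs : dh^T = dh by apply/matrixP => a b; rewrite !mxE addrC.
have dx7 : Lambda2_7 Phi eta dx by exact: xi_part_Lambda2_7.
rewrite -!H//; first exact: D.
- by rewrite [(h + _)^T]linearD/= hs dhs.
- exact: Lambda2_7D.
Qed.

Theorem diffeo_invariant_familyP L S (c : R * R * R * R * R * R) : has_symbol L S ->
  let: (rho, alpha, beta, gamma, lambda, mu) := c in
  eq_mod_div Phi eta L (general_lagrangian eta rho alpha beta gamma lambda mu) ->
  diffeo_invariant Phi eta L <-> exists! r, eq_mod_div Phi eta L (invariant_family r).
Proof.
case: c => -[[[[rho alpha] beta] gamma] lambda] mu sL LG.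
have sG := has_symbol_general eta; split=> [D|[r [Lr _]]].
  have /diffeo_general_lagrangianP[] := diffeo_invariant_eq_mod_div sL (sG _ _ _ _ _ _) LG D.
  move=> ea eb eg el; exists (rho, mu); split; first by rewrite invariant_familyE -ea -eb -eg -el.
  move=> r Lr; apply: invariant_family_inj sL _ Lr.
  by rewrite invariant_familyE -ea -eb -eg -el.
move: Lr; rewrite invariant_familyE => Lr.
apply: (diffeo_invariant_eq_mod_div (sG _ _ _ _ _ _) sL (eq_mod_div_sym sL (sG _ _ _ _ _ _) Lr)).
exact/diffeo_general_lagrangianP.
Qed.

End DiffeoInvariance.

(** * Lagrangians written in the 4-form perturbation *)

Section TensorLagrangians.
Context (R : realType) (g : 'M[R]_8) (gu : g \in unitmx).
Local Notation V := (pt8 R).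
Local Notation M8 := 'M[R]_8.
Local Notation G := (invmx g).
Local Notation eta := (g^T *m g).
Local Notation Phi0 := (cayley0 R).
Local Notation Phi := (pullback4 g Phi0).
Local Notation fr := (conjmx8 G).
Implicit Types (k z : V) (h xi m : M8) (A B : coefs R).

Definition tensor_vec (s : tensor4 R) (I : multi_idx) : R :=
  let: (a, b, c, d) := I in s a b c d.

Let altPhi : alternating4 Phi.
Proof. by apply: pullback4_alternating; exact: cayley0_alternating. Qed.

Lemma perturbation_linear c h xi h' xi' I :
  tensor_vec (perturbation Phi eta (c *: h + h') (c *: xi + xi')) I =
  c * tensor_vec (perturbation Phi eta h xi) I + tensor_vec (perturbation Phi eta h' xi') I.
Proof.
case: I => [[[i j] l] n] /=; rewrite !perturbationE//.
have -> : (c *: h + h' + 4^-1 *: (c *: xi + xi')) *m invmx eta =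
    c *: ((h + 4^-1 *: xi) *m invmx eta) + (h' + 4^-1 *: xi') *m invmx eta.
  by rewrite scalemxAl -mulmxDl; congr (_ *m _); apply/matrixP => a b; rewrite !mxE; ring.
by rewrite gl_actD gl_actZ.
Qed.

Definition perturbation_coef (I : multi_idx) (i : pair_idx) : R :=
  match i with
  | inl p => tensor_vec (perturbation Phi eta (delta_mx p.1 p.2) 0) I
  | inr p => tensor_vec (perturbation Phi eta 0 (delta_mx p.1 p.2)) I
  end.

Lemma linear_deltaE (f : M8 -> R) m : (forall x u v, f (x *: u + v) = x * f u + f v) ->
  f m = \sum_(p : 'I_8 * 'I_8) f (delta_mx p.1 p.2) * m p.1 p.2.
Proof.
move=> fl; rewrite [m in LHS]matrix_sum_delta pair_bigA /= linear_sums//.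
by apply: eq_bigr => p _; rewrite mulrC.
Qed.

Lemma perturbation_coefE h xi I : tensor_vec (perturbation Phi eta h xi) I =
  \sum_i perturbation_coef I i * pair_vec h xi i.
Proof.
have -> : tensor_vec (perturbation Phi eta h xi) I =
    tensor_vec (perturbation Phi eta h 0) I + tensor_vec (perturbation Phi eta 0 xi) I.
  by have := perturbation_linear 1 h 0 0 xi I; rewrite !scale1r !addr0 add0r mul1r.
rewrite big_sumType /=; congr (_ + _).
  apply: (linear_deltaE (f := fun h => tensor_vec (perturbation Phi eta h 0) I)) => x u v.
  by rewrite -perturbation_linear scaler0 addr0.
apply: (linear_deltaE (f := fun xi => tensor_vec (perturbation Phi eta 0 xi) I)) => x u v.
by rewrite -perturbation_linear scaler0 addr0.
Qed.

Lemma has_symbol_lagrangian_of A B : has_symbol (lagrangian_of Phi eta A B)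
  (fun k h xi => let p := tensor_vec (perturbation Phi eta h xi) in
     symbol_form (symbol A B) k p p).
Proof.
pose phi (h xi : V -> M8) x := perturbation Phi eta (h x) (xi x).
have cE (h xi : V -> M8) I : component (phi h xi) I =
    (fun x => \sum_i perturbation_coef I i * pair_fields h xi i x).
  apply/funext => x; rewrite [LHS]perturbation_coefE.
  by apply: eq_bigr => i _; rewrite pair_fieldsE.
have d0 I : @zeroth_order R (fun (h xi : V -> M8) => component (phi h xi) I)
    (fun k h xi => tensor_vec (perturbation Phi eta h xi) I).
  apply: (linear_of_ext (linear_of_sum (index_enum pair_idx) (perturbation_coef I)
    (fun i => linear_of_field (fun _ f => f) (fun _ _ => 1) i tt))) => [h xi sh sx x|k h xi].
    by rewrite cE.
  by rewrite perturbation_coefE; apply: eq_bigr => i _; rewrite mul1r.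
have p1 (h xi : V -> M8) I a : smooth_mx h -> smooth_mx xi -> partial a (component (phi h xi) I) =
    fun x => \sum_i perturbation_coef I i * partial a (pair_fields h xi i) x.
  move=> sh sx; apply/funext => x; rewrite cE partial_lincomb// => i.
  by apply: smooth_differentiable; exact: smooth_pair_fields.
have d1 I a : @first_order R (fun (h xi : V -> M8) => partial a (component (phi h xi) I))
    (fun k h xi => k a 0 * tensor_vec (perturbation Phi eta h xi) I).
  apply: (linear_of_ext (linear_of_sum (index_enum pair_idx) (perturbation_coef I)
    (fun i => linear_of_field (@partial R) (fun a (k : V) => k a 0) i a))) => [h xi sh sx x|k h xi].
    by rewrite p1.
  by rewrite perturbation_coefE mulr_sumr; apply: eq_bigr => i _; rewrite mulrCA.
have d2 I a b : @second_order R (fun (h xi : V -> M8) => partial a (partial b (component (phi h xi) I)))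
    (fun k h xi => k a 0 * k b 0 * tensor_vec (perturbation Phi eta h xi) I).
  apply: (linear_of_ext (linear_of_sum (index_enum pair_idx) (perturbation_coef I)
    (fun i => linear_of_field (fun t f => partial t.1 (partial t.2 f))
       (fun (t : 'I_8 * 'I_8) (k : V) => k t.1 0 * k t.2 0) i (a, b)))) => [h xi sh sx x|k h xi].
    rewrite p1// partial_lincomb// => i; apply: smooth_differentiable; apply: smooth_partial.
    exact: smooth_pair_fields.
  by rewrite perturbation_coefE mulr_sumr; apply: eq_bigr => i _; rewrite mulrCA.
pose p h xi := tensor_vec (perturbation Phi eta h xi).
apply: (@has_symbol_ext _ _ (lagrangian_of Phi eta A B) _ (fun k h xi =>
   \sum_I \sum_J \sum_a \sum_b (A I J a b * ((k a 0 * p h xi I) * (k b 0 * p h xi J)) +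
     B I J a b * - (p h xi I * (k a 0 * k b 0 * p h xi J))))) => // [|k h xi]; last first.
  by rewrite /= symbol_formE; apply: eq_sum4 => I J a b; rewrite /symbol /p; ring.
apply: has_symbol_sums => I; apply: has_symbol_sums => J; apply: has_symbol_sums => a.
apply: has_symbol_sums => b.
apply: (has_symbol_ext (has_symbol_lincomb (A I J a b) (has_symbol_first_order (d1 I a) (d1 J b))
  (has_symbolZ (B I J a b) (has_symbol_second_order (d0 I) (d2 J a b))))) => // h xi sh sx x.
by rewrite !mulrA.
Qed.

End TensorLagrangians.

(** * Lagrangians invariant under Spin(7) *)

Section InvariantLagrangians.
Context (R : realType) (g : 'M[R]_8) (gu : g \in unitmx).
Local Notation V := (pt8 R).
Local Notation M8 := 'M[R]_8.
Local Notation G := (invmx g).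
Local Notation eta := (g^T *m g).
Local Notation Phi0 := (cayley0 R).
Local Notation Phi := (pullback4 g Phi0).
Local Notation fr := (conjmx8 G).
Implicit Types (k z : V) (h xi m : M8) (A B : coefs R) (s : tensor4 R).

Lemma Lambda4_perturbation_mem h xi : h^T = h -> Lambda2_7 Phi eta xi ->
  Lambda4_1_7_35 Phi eta (perturbation Phi eta h xi).
Proof.
move=> hs x7; apply/(Lambda4_frame gu).
rewrite -[h](conjmx8VK gu) -[xi](conjmx8VK gu) perturbation_frame// pullback4K//.
by apply: perturbation_mem_std; [exact: conjmx8_sym|exact/Lambda2_7_frameV].
Qed.

Lemma perturbationZ c h xi I : tensor_vec (perturbation Phi eta (c *: h) (c *: xi)) I =
  c * tensor_vec (perturbation Phi eta h xi) I.
Proof.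
rewrite !perturbation_coefE mulr_sumr; apply: eq_bigr => i _.
by rewrite pair_vecZ; ring.
Qed.

Lemma phase_mul (o : M8) k x : phase k (o *m x) = phase (o^T *m k) x.
Proof.
rewrite /phase; transitivity (\sum_i \sum_j k i 0 * (o i j * x j 0)).
  by apply: eq_bigr => i _; rewrite mxE mulr_sumr.
rewrite exchange_big; apply: eq_bigr => j _; rewrite mxE mulr_suml.
by apply: eq_bigr => i _; rewrite mxE; ring.
Qed.

(** Spin(7)-invariance is an equality at each point, so one plane wave suffices; the rotated field
    is again a plane wave, of momentum [o^T *m k]. *)
Lemma invariant_symbol A B o k h xi : spin7_invariant Phi eta A B -> spin7 Phi o ->
  h^T = h -> Lambda2_7 Phi eta xi -> let s := perturbation Phi eta h xi in
  symbol_form (symbol A B) (o^T *m k) (tensor_vec (pullback4 o s)) (tensor_vec (pullback4 o s)) =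
  symbol_form (symbol A B) k (tensor_vec s) (tensor_vec s).
Proof.
move=> inv os hs x7 s; have ou : o \in unitmx by case: os.
have [->|k0] := eqVneq k 0.
  rewrite mulmx0; have Z p : symbol_form (symbol A B) 0 p p = 0.
    by rewrite /symbol_form big1// => a _; rewrite big1// => b _; rewrite !mxE !mulr0.
  by rewrite !Z.
pose phi (x : V) : tensor4 R := perturbation Phi eta (wave k (Tcos R) x *: h) (wave k (Tcos R) x *: xi).
have phiE x : phi x = fun a b c d => wave k (Tcos R) x * s a b c d.
  by apply: tensor4P => a b c d; exact: (perturbationZ _ _ _ (a, b, c, d)).
have phif : phi_field Phi eta phi.
  split=> [a b c d|x]; last first.
    apply: Lambda4_perturbation_mem; first by rewrite linearZ/= hs.
    exact: Lambda2_7Z.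
  rewrite (_ : (fun x => _) = wave k (Tmul (Tconst (s a b c d)) (Tcos R))).
    exact: smooth_wave.
  by apply/funext => x; rewrite phiE /wave/= mulrC.
have E x : quadratic_lagrangian A B phi x =
    quad A B (cos_wave k (tensor_vec s)) (cos_wave k (tensor_vec s)) x.
  rewrite -[LHS]/(quad A B (component phi) (component phi) x).
  suff -> : component phi = cos_wave k (tensor_vec s) by [].
  apply/funext => -[[[a b] c] d]; apply/funext => y.
  by rewrite /component phiE /cos_wave /wave/= mulrC.
pose phi' (y : V) : tensor4 R := pullback4 o (phi (o *m y)).
have E' x : quadratic_lagrangian A B phi' x = quad A B (cos_wave (o^T *m k) (tensor_vec (pullback4 o s)))
    (cos_wave (o^T *m k) (tensor_vec (pullback4 o s))) x.
  rewrite -[LHS]/(quad A B (component phi') (component phi') x).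
  suff -> : component phi' = cos_wave (o^T *m k) (tensor_vec (pullback4 o s)) by [].
  apply/funext => -[[[a b] c] d]; apply/funext => y.
  by rewrite /component /phi' phiE pullback4Z /cos_wave /wave/= mulrC phase_mul.
have I x : quadratic_lagrangian A B phi' x = quadratic_lagrangian A B phi (o *m x).
  exact: inv.
have Q x := etrans (esym (E' x)) (etrans (I x) (E (o *m x))); clear I E E' phif.
(* At phase 0 only the second-derivative coefficients are visible. *)
have := Q 0; rewrite mulmx0 !quad_cos_wave.
have ph0 (q : V) : phase q 0 = 0 by rewrite /phase big1// => i _; rewrite mxE mulr0.
rewrite !ph0 sin0 cos0 expr0n /= !mulr0 !sub0r expr1n !mulr1 => /oppr_inj eB.
have kk : 0 < \sum_i k i 0 ^+ 2.
  have [i ki] : exists i, k i 0 != 0.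
    apply/existsP; rewrite -negb_forall; apply: contra k0 => /forallP H.
    by apply/eqP/matrixP => i j; rewrite (ord1 j) mxE; apply/eqP/H.
  rewrite (bigD1 i)//= ltr_wpDr ?sumr_ge0//; first by move=> j _; exact: sqr_ge0.
  by rewrite exprn_even_gt0.
(* A point of phase [pi / 2], where only the first-derivative coefficients are visible. *)
pose y := (pi / 2 / \sum_i k i 0 ^+ 2) *: k.
have ph : phase k y = pi / 2.
  rewrite phaseZ (_ : phase k k = \sum_i k i 0 ^+ 2) ?divfK ?gt_eqF//.
have oy : o *m (invmx o *m y) = y by rewrite mulKVmx.
have := Q (invmx o *m y); rewrite oy; clearbody y; clear Q; rewrite !quad_cos_wave -phase_mul oy ph.
rewrite sin_pihalf cos_pihalf expr0n /= !mulr0 !subr0 expr1n !mulr1 => eA.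
by rewrite !symbol_formB eA eB.
Qed.

Definition model_perturbation (u : M8) : tensor4 R :=
  gl_act (sym_part u + 4^-1 *: skew_part u) Phi0.

Lemma model_perturbation_frame h xi : h^T = h -> xi^T = - xi ->
  pullback4 g (model_perturbation (fr h + fr xi)) = perturbation Phi eta h xi.
Proof.
move=> hs xs; have xs' : (fr xi)^T = - fr xi by rewrite conjmx8_tr xs conjmx8N.
rewrite /model_perturbation sym_partE// ?skew_partE//; try exact: conjmx8_sym.
by rewrite -perturbation_cayley0 -perturbation_frame// !conjmx8VK.
Qed.

Lemma model_perturbation_conj o u : spin7 Phi0 o ->
  model_perturbation (conjmx8 o u) = pullback4 o (model_perturbation u).
Proof.
move=> os; have oo := spin7_cayley0_orthogonal os; have [_ oP] := os.
rewrite /model_perturbation sym_part_conj skew_part_conj -conjmx8Z -conjmx8D.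
rewrite -[in LHS]oP; apply: gl_act_pullback.
by rewrite /conjmx8 -mulmxA (mulmx1C oo) mulmx1.
Qed.

Lemma model_perturbation_linear x u v I :
  tensor_vec (pullback4 g (model_perturbation (x *: u + v))) I =
  x * tensor_vec (pullback4 g (model_perturbation u)) I +
  tensor_vec (pullback4 g (model_perturbation v)) I.
Proof.
rewrite /model_perturbation sym_part_linear skew_part_linear.
set a := sym_part u; set b := skew_part u; set c := sym_part v; set d := skew_part v.
have -> : x *: a + c + 4^-1 *: (x *: b + d) = x *: (a + 4^-1 *: b) + (c + 4^-1 *: d).
  by apply/matrixP => i j; rewrite !mxE; ring.
case: I => [[[i j] l] n]; rewrite (gl_actD (x *: _)) gl_actZ.
by rewrite /tensor_vec pullback4D pullback4Z.
Qed.

Section InvariantForm.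
Context (A B : coefs R).
Local Notation N := (symbol A B).
Local Notation vec u := (tensor_vec (pullback4 g (model_perturbation u))).

Definition polar_form (a b : 'I_8) (u v : M8) : R :=
  pair_form N a b (vec u) (vec v) + pair_form N a b (vec v) (vec u).

(** The trilinear extension of the symbol. [K] is conjugated because a model momentum [k] is
    [g^T *m k] in the given frame, and the half undoes the doubling in [polar_form]. *)
Definition symmetrised_symbol (K u v : M8) : R :=
  2^-1 * \sum_a \sum_b conjmx8 g K a b * polar_form a b u v.

Lemma pair_form_linearl a b x (p q r : multi_idx -> R) :
  pair_form N a b (fun i => x * p i + q i) r = x * pair_form N a b p r + pair_form N a b q r.
Proof.
rewrite /pair_form mulr_sumr -big_split; apply: eq_bigr => i _.
by rewrite mulr_sumr -big_split; apply: eq_bigr => j _ /=; ring.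
Qed.

Lemma pair_form_linearr a b x (p q r : multi_idx -> R) :
  pair_form N a b r (fun i => x * p i + q i) = x * pair_form N a b r p + pair_form N a b r q.
Proof.
rewrite /pair_form mulr_sumr -big_split; apply: eq_bigr => i _.
by rewrite mulr_sumr -big_split; apply: eq_bigr => j _ /=; ring.
Qed.

Lemma polar_linear a b x (p q r : multi_idx -> R) (s := fun i => x * p i + q i) :
  pair_form N a b s r + pair_form N a b r s =
  x * (pair_form N a b p r + pair_form N a b r p) + (pair_form N a b q r + pair_form N a b r q).
Proof. by rewrite pair_form_linearl pair_form_linearr mulrDr addrACA. Qed.

Lemma symmetrised_symbolC K u v : symmetrised_symbol K u v = symmetrised_symbol K v u.
Proof.
have e a b : polar_form a b u v = polar_form a b v u by exact: addrC.
by rewrite /symmetrised_symbol; under eq_bigr do under eq_bigr do rewrite e.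
Qed.

Lemma symmetrised_symbol_linearl u v x K K' :
  symmetrised_symbol (x *: K + K') u v =
  x * symmetrised_symbol K u v + symmetrised_symbol K' u v.
Proof.
rewrite /symmetrised_symbol mulrCA -mulrDr; congr (_ * _); rewrite mulr_sumr -big_split.
apply: eq_bigr => a _; rewrite mulr_sumr -big_split; apply: eq_bigr => b _ /=.
by rewrite conjmx8D conjmx8Z !mxE; ring.
Qed.

Lemma symmetrised_symbol_linearm K v x u u' :
  symmetrised_symbol K (x *: u + u') v =
  x * symmetrised_symbol K u v + symmetrised_symbol K u' v.
Proof.
rewrite /symmetrised_symbol mulrCA -mulrDr; congr (_ * _); rewrite mulr_sumr -big_split.
apply: eq_bigr => a _; rewrite mulr_sumr -big_split; apply: eq_bigr => b _ /=.
have -> : polar_form a b (x *: u + u') v = x * polar_form a b u v + polar_form a b u' v.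
  have e : vec (x *: u + u') = fun I => x * vec u I + vec u' I.
    by apply/funext => I; exact: model_perturbation_linear.
  apply: etrans (congr1 (fun t => pair_form N a b t (vec v) + pair_form N a b (vec v) t) e) _.
  exact: polar_linear.
by move: (conjmx8 g K a b) (polar_form _ _ _ _) (polar_form _ _ _ _) => *; ring.
Qed.

Lemma symmetrised_symbol_momentum k u :
  symmetrised_symbol (k *m k^T) u u = symbol_form N (g^T *m k) (vec u) (vec u).
Proof.
rewrite /symmetrised_symbol conjmx8_momentum mulr_sumr; apply: eq_bigr => a _.
rewrite mulr_sumr; apply: eq_bigr => b _; rewrite /polar_form.
have -> : (g^T *m k *m (g^T *m k)^T) a b = (g^T *m k) a 0 * (g^T *m k) b 0.
  by rewrite mxE big_ord1 [_^T _ _]mxE.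
by move: (pair_form _ _ _ _ _) ((g^T *m k) a 0) ((g^T *m k) b 0) => *; field.
Qed.

Lemma spin7_frame o : spin7 Phi0 o -> spin7 Phi (G *m o *m g).
Proof.
move=> [ou oP]; split; first by rewrite !unitmx_mul unitmx_inv gu ou.
by rewrite pullback4M !mulmxA mulmxV// mul1mx -pullback4M oP.
Qed.

Lemma symmetrised_symbol_momentum_invariant o k u : spin7_invariant Phi eta A B ->
  spin7 Phi0 o -> field_space u ->
  symmetrised_symbol (conjmx8 o (k *m k^T)) (conjmx8 o u) (conjmx8 o u) =
  symmetrised_symbol (k *m k^T) u u.
Proof.
move=> inv os [h [xi [hs x7 uE]]].
have xf : Lambda2_7 Phi eta (conjmx8 g xi) by apply/Lambda2_7_frame.
have vE : pullback4 g (model_perturbation u) = perturbation Phi eta (conjmx8 g h) (conjmx8 g xi).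
  rewrite -model_perturbation_frame ?conjmx8K// ?uE//; first exact: conjmx8_sym.
  by case: xf.
have := invariant_symbol (g^T *m k) inv (spin7_frame os) (conjmx8_sym g hs) xf.
have gE : g *m (G *m o *m g) = o *m g by rewrite !mulmxA mulmxV// mul1mx.
rewrite /= -vE conjmx8_momentum !symmetrised_symbol_momentum => <-.
rewrite model_perturbation_conj// !pullback4M gE.
by rewrite (mulmxA _ g^T k) -(trmx_mul g) gE trmx_mul mulmxA.
Qed.

Lemma field_spaceD (u v : M8) : field_space u -> field_space v -> field_space (u + v).
Proof.
move=> [h [xi [hs x7 ->]]] [h' [xi' [hs' x7' ->]]]; exists (h + h'), (xi + xi').
split; first by rewrite [(h + _)^T]linearD/= hs hs'.
- exact: Lambda2_7D.
- exact: addrACA.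
Qed.

(** Invariance is known for [K = k k^T] and equal fields. Polarising in the fields and then in [k]
    extends it to different fields and to all symmetric [K]. *)
Lemma polarised_invariance (Q : M8 -> M8 -> M8 -> R) o :
  (forall u v x K K', Q (x *: K + K') u v = x * Q K u v + Q K' u v) ->
  (forall K v x u u', Q K (x *: u + u') v = x * Q K u v + Q K u' v) ->
  (forall K u v, Q K u v = Q K v u) ->
  (forall k u, field_space u ->
     Q (conjmx8 o (k *m k^T)) (conjmx8 o u) (conjmx8 o u) = Q (k *m k^T) u u) ->
  forall K u v, K^T = K -> field_space u -> field_space v ->
    Q (conjmx8 o K) (conjmx8 o u) (conjmx8 o v) = Q K u v.
Proof.
move=> Ql Qm QC Q0 K u v Ks uf vf.
pose D K u v := Q (conjmx8 o K) (conjmx8 o u) (conjmx8 o v) - Q K u v.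
have DC K' u' v' : D K' u' v' = D K' v' u' by rewrite /D (QC K') (QC (conjmx8 o K')).
have Dm K' v' x u' w : D K' (x *: u' + w) v' = x * D K' u' v' + D K' w v'.
  by rewrite /D conjmx8D conjmx8Z !Qm; ring.
have Dl u' v' x K1 K2 : D (x *: K1 + K2) u' v' = x * D K1 u' v' + D K2 u' v'.
  by rewrite /D conjmx8D conjmx8Z !Ql; ring.
have D0 k w : field_space w -> D (k *m k^T) w w = 0 by move=> wf; rewrite /D Q0// subrr.
apply/eqP; rewrite -subr_eq0 -/(D K u v); apply/eqP; clearbody D.
have Dk k : D (k *m k^T) u v = 0.
  have := D0 k _ (field_spaceD uf vf); rewrite -[u in u + v]scale1r Dm !(DC _ _ (_ + _)) !Dm.
  by rewrite (DC _ v u) !D0// => ?; lra.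
have DE K' : D K' u v = \sum_p D (delta_mx p.1 p.2) u v * K' p.1 p.2.
  by apply: (linear_deltaE (f := fun K => D K u v)) => *; exact: Dl.
have q0 a b : D (delta_mx a b) u v + D (delta_mx b a) u v = 0.
  apply: (quadratic_vanishing (m := fun a b => D (delta_mx a b) u v)) => k.
  rewrite -[RHS](Dk k) DE -(pair_bigA _ (fun a b => D (delta_mx a b) u v * (k *m k^T) a b)).
  by apply: eq_bigr => c _; apply: eq_bigr => d _; rewrite [(k *m _) c d]mxE big_ord1 [_^T _ _]mxE.
have := DE K; rewrite -(pair_bigA _ (fun a b => D (delta_mx a b) u v * K a b)) /= => e.
suff : D K u v + D K u v = 0 by move=> ?; lra.
rewrite {1}e exchange_big e -big_split big1// => a _; rewrite -big_split big1// => b _ /=.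
by rewrite -[in K b a]Ks mxE -mulrDl addrC q0 mul0r.
Qed.

Theorem spin7_invariant_lagrangian : spin7_invariant Phi eta A B ->
  exists rho alpha beta gamma lambda mu,
    eq_mod_div Phi eta (lagrangian_of Phi eta A B)
      (general_lagrangian eta rho alpha beta gamma lambda mu).
Proof.
move=> inv; have [rho [alpha [beta [gamma [lambda [mu H]]]]]] :=
  invariant_form_classification symmetrised_symbol_linearl symmetrised_symbol_linearm
    symmetrised_symbolC (fun o os => polarised_invariance symmetrised_symbol_linearl
      symmetrised_symbol_linearm symmetrised_symbolC
      (fun k u => symmetrised_symbol_momentum_invariant k inv os)).
exists rho, alpha, beta, gamma, lambda, mu.
apply/(eq_mod_div_symbolP Phi eta (has_symbol_lagrangian_of g A B)
  (has_symbol_general eta rho alpha beta gamma lambda mu)) => k h xi hs x7.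
have xs : xi^T = - xi by case: x7.
have uf : field_space (fr h + fr xi).
  by exists (fr h), (fr xi); split=> //; [exact: conjmx8_sym|exact/Lambda2_7_frameV].
rewrite general_symbol_frame// conjmx8D conjmx8_momentum -H//; last first.
  by rewrite trmx_mul trmxK.
rewrite symmetrised_symbol_momentum mulmxA -trmx_mul mulVmx// trmx1 mul1mx.
by rewrite model_perturbation_frame.
Qed.

End InvariantForm.

End InvariantLagrangians.

(** * Equivariance of the triple contraction *)

Section Naturality.
Context (R : realType).
Local Notation M8 := 'M[R]_8.
Local Notation Phi0 := (cayley0 R).
Implicit Types (u o : M8) (s t P : tensor4 R).

Lemma triple_contraction_mode1 P u s :
  triple_contraction P (mode1 u s) = u *m triple_contraction P s.
Proof.
apply/matrixP => a b; rewrite !mxE.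
transitivity (\sum_p u a p * sum3 (fun e f l => s p e f l * P b e f l)); last first.
  by apply: eq_bigr => p _; rewrite mxE.
rewrite /sum3; under [RHS]eq_bigr do rewrite mulr_sumr.
rewrite [RHS]exchange_big; apply: eq_bigr => e _; under [RHS]eq_bigr do rewrite mulr_sumr.
rewrite [RHS]exchange_big; apply: eq_bigr => f _; under [RHS]eq_bigr do rewrite mulr_sumr.
rewrite [RHS]exchange_big; apply: eq_bigr => l _; rewrite mulr_suml.
by apply: eq_bigr => p _; rewrite mulrA.
Qed.

Lemma triple_contractionC P s : triple_contraction s P = (triple_contraction P s)^T.
Proof. by apply/matrixP => a b; rewrite !mxE; apply: eq_sum3 => *; exact: mulrC. Qed.

Lemma triple_contraction_linear P x s t :
  triple_contraction P (fun a b c d => x * s a b c d + t a b c d) =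
  x *: triple_contraction P s + triple_contraction P t.
Proof.
apply/matrixP => a b; rewrite !mxE /sum3 mulr_sumr -big_split; apply: eq_bigr => e _.
rewrite mulr_sumr -big_split; apply: eq_bigr => f _; rewrite mulr_sumr -big_split.
by apply: eq_bigr => l _ /=; ring.
Qed.

Lemma triple_contraction_mode4 P u s :
  triple_contraction P (mode4 u s) = triple_contraction (mode4 u^T P) s.
Proof.
apply/matrixP => a b; rewrite !mxE; apply: eq_bigr => e _; apply: eq_bigr => f _.
exact: (sum_adjoint (fun p => s a e f p) (fun p => P b e f p)).
Qed.

Lemma triple_contraction_mode3 P u s :
  triple_contraction P (mode3 u s) = triple_contraction (mode3 u^T P) s.
Proof.
apply/matrixP => a b; rewrite !mxE; apply: eq_bigr => e _; rewrite exchange_big [RHS]exchange_big.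
apply: eq_bigr => l _; exact: (sum_adjoint (fun p => s a e p l) (fun p => P b e p l)).
Qed.

Lemma triple_contraction_mode2 P u s :
  triple_contraction P (mode2 u s) = triple_contraction (mode2 u^T P) s.
Proof.
apply/matrixP => a b; rewrite !mxE /sum3 exchange_big [RHS]exchange_big; apply: eq_bigr => f _.
rewrite exchange_big [RHS]exchange_big; apply: eq_bigr => l _.
exact: (sum_adjoint (fun p => s a p f l) (fun p => P b p f l)).
Qed.

(** The three contracted slots move [o] onto [Phi0]. Since [o] fixes [Phi0] and is orthogonal, these
    three factors amount to one [o^T] on the remaining slot. *)
Lemma triple_contraction_spin7 o s : spin7 Phi0 o ->
  triple_contraction Phi0 (pullback4 o s) = conjmx8 o (triple_contraction Phi0 s).
Proof.
move=> os; have oo := spin7_cayley0_orthogonal os; have [_ oP] := os.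
rewrite pullback4E triple_contraction_mode1 triple_contraction_mode2 triple_contraction_mode3.
rewrite triple_contraction_mode4 !trmxK /conjmx8 -mulmxA; congr (_ *m _).
have -> : mode4 o (mode3 o (mode2 o Phi0)) = mode1 o^T Phi0.
  rewrite -[in LHS]oP pullback4E.
  rewrite !(mode21, mode31, mode41, mode32, mode42, mode43).
  by rewrite !(mode11, mode22, mode33, mode44, mode21, mode31, mode41, mode32, mode42, mode43) (mulmx1C oo) mode4_id mode3_id mode2_id.
by rewrite triple_contractionC triple_contraction_mode1 trmx_mul trmxK -triple_contractionC.
Qed.

End Naturality.

(** * Realising every choice of the six constants *)

Section Realisation.
Context (R : realType) (g : 'M[R]_8) (gu : g \in unitmx).
Local Notation V := (pt8 R).
Local Notation M8 := 'M[R]_8.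
Local Notation G := (invmx g).
Local Notation eta := (g^T *m g).
Local Notation Phi0 := (cayley0 R).
Local Notation Phi := (pullback4 g Phi0).
Local Notation fr := (conjmx8 G).
Implicit Types (k z : V) (h xi m : M8) (s t : tensor4 R).

(* Inverts the parametrisation in the frame g: the triple contraction of the
   perturbation is 24 h + 18 (tr h) 1 + 24 xi, of trace 168 tr h *)
Definition frame_field s : M8 :=
  let m := triple_contraction Phi0 (pullback4 G s) in
  24^-1 *: (m - (18 / 168 * \tr m)%:M).

Lemma frame_field_perturbation h xi : h^T = h -> Lambda2_7 Phi eta xi ->
  frame_field (perturbation Phi eta h xi) = fr h + fr xi.
Proof.
move=> hs x7; have x7' : Lambda2_7 Phi0 1%:M (fr xi) by apply/Lambda2_7_frameV.
have hs' := conjmx8_sym G hs.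
rewrite /frame_field -[in perturbation _ _ _ _](conjmx8VK gu h) -[in perturbation _ _ _ _](conjmx8VK gu xi).
rewrite perturbation_frame// pullback4K// triple_contraction_perturbation//.
set a := fr h in hs' *; set b := fr xi in x7' *.
have trb : \tr b = 0.
  by case: x7' => bs _; have := mxtrace_tr b; rewrite bs -scaleN1r mxtraceZ => ?; lra.
have -> : \tr (24 *: a + (18 * \tr a)%:M + 24 *: b) = 168 * \tr a.
  by rewrite !mxtraceD !mxtraceZ trb mxtrace_scalar; ring.
by apply/matrixP => i j; rewrite !mxE; case: (i == j); rewrite ?mulr1n ?mulr0n; field.
Qed.

Lemma frame_field_linear x s t : frame_field (fun a b c d => x * s a b c d + t a b c d) =
  x *: frame_field s + frame_field t.
Proof.
rewrite /frame_field; have -> : pullback4 G (fun a b c d => x * s a b c d + t a b c d) =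
    fun a b c d => x * pullback4 G s a b c d + pullback4 G t a b c d.
  by apply: tensor4P => a b c d; rewrite pullback4D pullback4Z.
rewrite triple_contraction_linear.
rewrite mxtraceD mxtraceZ; move: (triple_contraction _ _) (triple_contraction _ _) => p q.
by apply/matrixP => i j; rewrite !mxE; case: (i == j); rewrite ?mulr1n ?mulr0n; ring.
Qed.

Lemma frame_field_sum (J : Type) (r : seq J) (c : J -> R) (t : J -> tensor4 R) :
  frame_field (fun i j p q => \sum_(n <- r) c n * t n i j p q) =
  \sum_(n <- r) c n *: frame_field (t n).
Proof.
elim: r => [|n r IH].
  rewrite big_nil; have := frame_field_linear (-1) (fun _ _ _ _ => 0) (fun _ _ _ _ => 0).
  rewrite scaleN1r addNr => <-; congr frame_field.
  by apply: tensor4P => i j k l; rewrite big_nil mulr0 addr0.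
rewrite big_cons -IH -frame_field_linear; congr frame_field.
by apply: tensor4P => i j k l; rewrite big_cons.
Qed.

Lemma frame_field_spin7 o s : spin7 Phi o ->
  frame_field (pullback4 o s) = conjmx8 (g *m o *m G) (frame_field s).
Proof.
move=> [ou oP]; set q := g *m o *m G.
have qs : spin7 Phi0 q.
  split; first by rewrite !unitmx_mul unitmx_inv gu ou.
  by rewrite -!pullback4M oP pullback4K.
have GqE : pullback4 G (pullback4 o s) = pullback4 q (pullback4 G s).
  by rewrite !pullback4M /q !mulmxA mulVmx// mul1mx.
have qq := spin7_cayley0_orthogonal qs.
rewrite /frame_field GqE triple_contraction_spin7// mxtrace_conj; last exact: mulmx1C.
rewrite conjmx8Z conjmx8D conjmx8N; congr (_ *: (_ - _)).
by rewrite /conjmx8 mul_mx_scalar -scalemxAl qq scale_scalar_mx mulr1.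
Qed.

Definition unit_tensor (I : multi_idx) : tensor4 R := fun a b c d => (I == (a, b, c, d))%:R.

Lemma frame_field_expand s : frame_field s = \sum_I tensor_vec s I *: frame_field (unit_tensor I).
Proof.
rewrite -frame_field_sum; congr frame_field; apply: tensor4P => a b c d.
rewrite (bigD1 (a, b, c, d))//= /unit_tensor eqxx mulr1 big1 ?addr0// => I /negbTE n.
by rewrite n mulr0.
Qed.

Lemma exchange_sum4 (F : 'I_8 -> 'I_8 -> 'I_8 -> 'I_8 -> R) :
  \sum_a \sum_b \sum_c \sum_d F a b c d = \sum_c \sum_d \sum_a \sum_b F a b c d.
Proof.
under eq_bigr do rewrite exchange_big.
rewrite exchange_big; apply: eq_bigr => c _; under eq_bigr do rewrite exchange_big.
exact: exchange_big.
Qed.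

Section GivenConstants.
Context (rho alpha beta gamma lambda mu : R).
Local Notation gen := (general_form rho alpha beta gamma lambda mu).

(** The general form pulled back along the linear map [frame_field] and evaluated on coordinate
    tensors. It is defined on all 4-tensors; on perturbations [frame_field] returns the fields. *)
Definition realising_coefs : coefs R := fun I J a b =>
  gen (fr (delta_mx a b)) (frame_field (unit_tensor I)) (frame_field (unit_tensor J)).

Let gen_suml (J : finType) (c : J -> R) (K : J -> M8) u v :
  gen (\sum_j c j *: K j) u v = \sum_j c j * gen (K j) u v.
Proof.
by apply: (linear_sums (f := fun K => gen K u v)) => *; rewrite general_form_linearl.
Qed.

Let gen_summ (J : finType) (c : J -> R) (u : J -> M8) K v :
  gen K (\sum_j c j *: u j) v = \sum_j c j * gen K (u j) v.
Proof.
by apply: (linear_sums (f := fun u => gen K u v)) => *; rewrite general_form_linearm.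
Qed.

Let gen_sumr (J : finType) (c : J -> R) (v : J -> M8) K u :
  gen K u (\sum_j c j *: v j) = \sum_j c j * gen K u (v j).
Proof.
rewrite general_formC gen_summ; apply: eq_bigr => j _; by rewrite general_formC.
Qed.

Lemma realising_pair_form a b s t :
  pair_form realising_coefs a b (tensor_vec s) (tensor_vec t) =
  gen (fr (delta_mx a b)) (frame_field s) (frame_field t).
Proof.
rewrite (frame_field_expand s) (frame_field_expand t) gen_summ; apply: eq_bigr => I _.
rewrite gen_sumr mulr_sumr; apply: eq_bigr => J _; rewrite /realising_coefs.
by move: (gen _ _ _) => x; ring.
Qed.

Lemma fr_expand u (c : 'I_8 -> 'I_8 -> R) :
  \sum_(p : 'I_8 * 'I_8) c p.1 p.2 *: conjmx8 u (delta_mx p.1 p.2) =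
  conjmx8 u (\matrix_(a, b) c a b) :> M8.
Proof.
rewrite [X in conjmx8 u X]matrix_sum_delta pair_bigA /=.
elim/big_rec2: _ => [|p x y _ ->]; first by rewrite /conjmx8 mulmx0 mul0mx.
by rewrite conjmx8D conjmx8Z mxE.
Qed.

Lemma realising_symbol k s :
  symbol_form (symbol realising_coefs (fun _ _ _ _ => 0)) k (tensor_vec s) (tensor_vec s) =
  gen (fr (k *m k^T)) (frame_field s) (frame_field s).
Proof.
have -> : k *m k^T = \matrix_(a, b) (k a 0 * k b 0).
  by apply/matrixP => a b; rewrite !mxE big_ord1 [_^T _ _]mxE.
rewrite -fr_expand gen_suml -(pair_bigA _ (fun a b => k a 0 * k b 0 *
  gen (fr (delta_mx a b)) (frame_field s) (frame_field s))) /=.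
apply: eq_bigr => a _; apply: eq_bigr => b _; rewrite -realising_pair_form mulrC; congr (_ * _).
by apply: eq_bigr => I _; apply: eq_bigr => J _; rewrite /symbol subr0.
Qed.

Definition gradient (phi : V -> tensor4 R) (x : V) (a : 'I_8) : tensor4 R :=
  fun i j p q => partial a (fun y => phi y i j p q) x.

Lemma realising_quadratic phi x :
  quadratic_lagrangian realising_coefs (fun _ _ _ _ => 0) phi x =
  \sum_a \sum_b gen (fr (delta_mx a b)) (frame_field (gradient phi x a)) (frame_field (gradient phi x b)).
Proof.
rewrite /quadratic_lagrangian.
transitivity (\sum_a \sum_b \sum_I \sum_J realising_coefs I J a b *
   (tensor_vec (gradient phi x a) I * tensor_vec (gradient phi x b) J)); last first.
  by apply: eq_bigr => a _; apply: eq_bigr => b _; rewrite -realising_pair_form.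
transitivity (\sum_I \sum_a \sum_b \sum_J realising_coefs I J a b *
   (tensor_vec (gradient phi x a) I * tensor_vec (gradient phi x b) J)).
  apply: eq_bigr => I _; rewrite exchange_big; apply: eq_bigr => a _.
  rewrite exchange_big; apply: eq_bigr => b _; apply: eq_bigr => J _.
  rewrite !mul0r addr0 -mulrA; congr (_ * (_ * _)).
    by case: I => [[[? ?] ?] ?].
  by case: J => [[[? ?] ?] ?].
rewrite exchange_big; apply: eq_bigr => a _; exact: exchange_big.
Qed.

Lemma gradient_pullback (o : M8) phi x a : (forall i j p q, smooth (fun y => phi y i j p q)) ->
  gradient (fun y => pullback4 o (phi (o *m y))) x a =
  fun i j p q => \sum_c o c a * pullback4 o (gradient phi (o *m x) c) i j p q.
Proof.
move=> sp; apply: tensor4P => i j l' l; rewrite /gradient.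
have sd p q r n y : differentiable (fun y => phi y p q r n) y by exact: smooth_differentiable.
have d1 p q r y : differentiable (fun y => \sum_n o p i * o q j * o r l' * o n l * phi y p q r n) y.
  exact: (differentiable_lincomb _ _ (f := fun n y => phi y p q r n)).
have d2 p q y : differentiable (fun y => \sum_r \sum_n o p i * o q j * o r l' * o n l * phi y p q r n) y.
  by apply: differentiable_sums => r; exact: d1.
have d3 p y : differentiable
    (fun y => \sum_q \sum_r \sum_n o p i * o q j * o r l' * o n l * phi y p q r n) y.
  by apply: differentiable_sums => q; exact: d2.
rewrite (partial_comp_mx (g := o) a (f := fun y => pullback4 o (phi y) i j l' l)); last first.
  by apply: differentiable_sums => p; exact: d3.
apply: eq_bigr => c _; congr (_ * _); rewrite /pullback4 partial_sums//.
apply: eq_bigr => p _; rewrite partial_sums//; apply: eq_bigr => q _; rewrite partial_sums//.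
apply: eq_bigr => r _.
exact: (partial_lincomb _ _ _ (f := fun n y => phi y p q r n)).
Qed.

(** The chain rule rotates the derivative indices by [o], and equivariance rotates the recovered
    fields by [q], which is [o] seen in the model frame. The form is invariant under the
    simultaneous action of the orthogonal [q]. *)
Lemma realising_spin7_invariant : spin7_invariant Phi eta realising_coefs (fun _ _ _ _ => 0).
Proof.
move=> o os phi [sp _] x; rewrite !realising_quadratic.
set q := g *m o *m G.
pose U c := frame_field (gradient phi (o *m x) c).
have E a : frame_field (gradient (fun y => pullback4 o (phi (o *m y))) x a) =
    \sum_c o c a *: conjmx8 q (U c).
  rewrite gradient_pullback// frame_field_sum; apply: eq_bigr => c _.
  by rewrite frame_field_spin7.
have qs : spin7 Phi0 q.
  have [ou oP] := os; split; first by rewrite !unitmx_mul unitmx_inv gu ou.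
  by rewrite -!pullback4M oP pullback4K.
have qq := spin7_cayley0_orthogonal qs.
transitivity (\sum_c \sum_d gen (conjmx8 q (fr (delta_mx c d))) (conjmx8 q (U c)) (conjmx8 q (U d))).
  (* The two factors [o] produced by the chain rule are exactly the conjugation by [q] of the
     momentum argument. *)
  have Kq c d : conjmx8 q (fr (delta_mx c d)) =
      \sum_(p : 'I_8 * 'I_8) (o c p.1 * o d p.2) *: fr (delta_mx p.1 p.2).
    rewrite (fr_expand _ (fun a b => o c a * o d b)) /conjmx8 /q.
    have -> : (\matrix_(a, b) (o c a * o d b) : M8) = o^T *m delta_mx c d *m o.
      apply/matrixP => a b; rewrite -(mul_delta_mx (0 : 'I_1)) mulmxA -mulmxA -rowE -colE !mxE big_ord1.
      by rewrite !mxE.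
    have Gg : G *m (g *m o *m G) = o *m G by rewrite !mulmxA mulVmx// mul1mx.
    rewrite -[RHS]/((G^T *m (o^T *m delta_mx c d *m o)) *m G) -[RHS]mulmxA.
    transitivity ((G *m (g *m o *m G))^T *m delta_mx c d *m (G *m (g *m o *m G))).
      by rewrite (trmx_mul G) !mulmxA.
    by rewrite Gg trmx_mul !mulmxA.
  under [RHS]eq_bigr do under eq_bigr do rewrite Kq gen_suml.
  transitivity (\sum_c \sum_d \sum_a \sum_b o c a * o d b *
      gen (fr (delta_mx a b)) (conjmx8 q (U c)) (conjmx8 q (U d))); last first.
    by do 2 (apply: eq_bigr => ? _); rewrite pair_bigA.
  transitivity (\sum_a \sum_b \sum_c \sum_d o c a * o d b *
      gen (fr (delta_mx a b)) (conjmx8 q (U c)) (conjmx8 q (U d))).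
    apply: eq_bigr => a _; apply: eq_bigr => b _.
    apply: (etrans (congr2 (gen (fr (delta_mx a b))) (E a) (E b))).
    clearbody U; clear E; rewrite gen_summ; apply: eq_bigr => c _; rewrite gen_sumr mulr_sumr.
    by apply: eq_bigr => d _; rewrite mulrA.
  exact: (exchange_sum4 (fun a b c d => o c a * o d b *
    gen (fr (delta_mx a b)) (conjmx8 q (U c)) (conjmx8 q (U d)))).
by apply: eq_bigr => c _; apply: eq_bigr => d _; exact: general_form_conj.
Qed.

End GivenConstants.

Theorem general_lagrangian_realised rho alpha beta gamma lambda mu :
  exists A B : coefs R, spin7_invariant Phi eta A B /\
    eq_mod_div Phi eta (lagrangian_of Phi eta A B)
      (general_lagrangian eta rho alpha beta gamma lambda mu).
Proof.
pose A := realising_coefs rho alpha beta gamma lambda mu; pose B : coefs R := fun _ _ _ _ => 0.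
exists A, B; split; first exact: realising_spin7_invariant.
apply/(eq_mod_div_symbolP Phi eta (has_symbol_lagrangian_of g A B)
  (has_symbol_general eta rho alpha beta gamma lambda mu)) => k h xi hs x7.
rewrite /= realising_symbol frame_field_perturbation// general_symbol_frame//; last by case: x7.
by rewrite conjmx8D.
Qed.

End Realisation.

Unset Implicit Arguments.
Set Strict Implicit.

Theorem mainTheorem8 (R : realType) (Phi : tensor4 R) (eta : 'M[R]_8)
    (hPhi : cayley_form Phi eta) :
  (* (h, xi) parametrises the perturbations *)
  (forall s : tensor4 R, Lambda4_1_7_35 Phi eta s <->
     exists! m : 'M[R]_8 * 'M[R]_8,
       [/\ m.1^T = m.1, Lambda2_7 Phi eta m.2
         & s = perturbation Phi eta m.1 m.2]) /\
  (* the most general invariant Lagrangian, modulo total derivatives *)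
  (forall A B : coefs R, spin7_invariant Phi eta A B ->
     exists rho alpha beta gamma lambda mu : R,
       eq_mod_div Phi eta (lagrangian_of Phi eta A B)
         (general_lagrangian eta rho alpha beta gamma lambda mu)) /\
  (forall rho alpha beta gamma lambda mu : R,
     exists A B : coefs R, spin7_invariant Phi eta A B /\
       eq_mod_div Phi eta (lagrangian_of Phi eta A B)
         (general_lagrangian eta rho alpha beta gamma lambda mu)) /\
  (* invariance under linearised diffeomorphisms *)
  (forall rho alpha beta gamma lambda mu : R,
     diffeo_invariant Phi eta
       (general_lagrangian eta rho alpha beta gamma lambda mu) <->
     [/\ alpha = - rho + mu, beta = rho - mu, gamma = rho - mu / 2
       & lambda = mu / 8]) /\
  (* the two-parameter family of invariant Lagrangians *)
  (forall A B : coefs R, spin7_invariant Phi eta A B ->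
     (diffeo_invariant Phi eta (lagrangian_of Phi eta A B) <->
      exists! r : R * R,
        eq_mod_div Phi eta (lagrangian_of Phi eta A B)
          (fun h xi x => r.1 * lagrangian_GR eta h xi x
                         + r.2 * lagrangian' eta h xi x))).
Proof.
case: hPhi => g gu [-> ->]; split; first by move=> s; exact: Lambda4_perturbation.
split; first by move=> A B; exact: spin7_invariant_lagrangian.
split; first exact: general_lagrangian_realised.
split; first exact: diffeo_general_lagrangianP.
move=> A B inv.
have [rho [alpha [beta [gamma [lambda [mu LG]]]]]] := spin7_invariant_lagrangian gu inv.
exact: (@diffeo_invariant_familyP R g gu _ _ (rho, alpha, beta, gamma, lambda, mu)
  (has_symbol_lagrangian_of g A B) LG).
Qed.
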